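(* Let $X$ be the elliptic curve over $\mathbb{F}_2$ given by $y^2+y=x^3+x+1$, and let $x_0$ be its unique $\mathbb{F}_2$-rational point. Write $\mathbb{F}_4=\mathbb{F}_2(\alpha)$, let $x\in|X|$ be the closed point of degree $2$ lying below $(0:\alpha:1)$ and $(0:\alpha^2:1)$, and let $y\in|X|$ be the closed point of degree $2$ lying below $(1:\alpha:1)$ and $(1:\alpha^2:1)$. Let $\mathcal{E}'=\mathcal{E}_{(x,1)}^{(2,0)}$. Then, up to isomorphism, the rank $2$ vector bundles $\mathcal{E}$ on $X$ such that $\mathcal{E}'$ is a Hecke modification of $\mathcal{E}$ at $x$ with weight $1$ are exactly $$\mathcal{E}_{(x_0,1)}^{(1,1)}\oplus\mathcal{E}_{(x_0,1)}^{(1,1)},\qquad \mathcal{E}_{(x,1)}^{(2,2)},\qquad \mathcal{E}_{(y,1)}^{(2,2)}.$$ Moreover, with $q=2$, the multiplicities of $\mathcal{E}'$ as a Hecke modification of these bundles are $q^2-q=2$, $q+1=3$ and $1$, respectively.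
   Context: Notation for bundles. By Atiyah's classification (over any base field, after choosing $x_0$), an indecomposable vector bundle on $X$ is determined by its rank $n$, its degree $d$, a closed point $z\in|X|$ and an integer $\ell\ge 1$ with $\ell|z|=\gcd(n,d)$, where $|z|$ is the degree of $z$; it is denoted $\mathcal{E}_{(z,\ell)}^{(n,d)}$. Concretely, for the bundles used here: let $X_2=X\otimes_{\mathbb{F}_2}\mathbb{F}_4$, let $\pi:X_2\to X$ be the projection, and for a closed point $z\in|X|$ of degree $2$ let $z'\in X_2$ be a closed point above $z$. Then $\mathcal{E}_{(x_0,1)}^{(1,1)}=\mathcal{O}_X(x_0)$, $\mathcal{E}_{(z,1)}^{(2,0)}=\pi_*\mathcal{O}_{X_2}(z'-x_0)$ and $\mathcal{E}_{(z,1)}^{(2,2)}=\pi_*\mathcal{O}_{X_2}(z')$, where $x_0$ is also regarded as a rational point of $X_2$; up to isomorphism these do not depend on the choice of $z'$ above $z$. Hecke modifications. $\mathcal{K}_x$ denotes the skyscraper sheaf supported at $x$ with stalk the residue field $\mathbb{F}(x)$. For vector bundles $\mathcal{E},\mathcal{E}'$ (locally free sheaves) of the same rank, $\mathcal{E}'$ is a Hecke modification of $\mathcal{E}$ at $x$ with weight $1$ if there is a short exact sequence of coherent sheaves $0\to\mathcal{E}'\to\mathcal{E}\to\mathcal{K}_x\to 0$. Two such sequences with the same middle term $\mathcal{E}$ are isomorphic if there are isomorphisms between the left terms and between the right terms which, together with the identity of $\mathcal{E}$, form a commutative diagram. The multiplicity of $\mathcal{E}'$ as a Hecke modification of $\mathcal{E}$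 at $x$ is the number of isomorphism classes of such sequences $0\to\mathcal{E}''\to\mathcal{E}\to\mathcal{K}_x\to0$ with $\mathcal{E}''\cong\mathcal{E}'$. *)

(* Defs.v *)
From HB Require Import structures.
From mathcomp Require Import all_boot all_order all_algebra all_field.
From mathcomp Require Import ring mpoly.
From mathcomp Require Import boolp classical_sets functions.

Set Implicit Arguments.
Unset Strict Implicit.
Unset Printing Implicit Defensive.

Import GRing.Theory.
Local Open Scope classical_set_scope.
Local Open Scope ring_scope.

(* X is handled as a classical variety over F_2: its closed points are the
   Galois orbits of the points of the plane cubic with coordinates in an
   algebraic closure Fbar of F_2, and its regular functions are the Fbar-valued
   functions on these geometric points that are locally quotients of
   homogeneous polynomials of equal degree with coefficients in F_2.  Taking
   coefficients in F_(2^r) instead gives X_r = X (x) F_(2^r), on the same set of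
   geometric points.  Nothing is lost: X_r is geometrically reduced, so a regular
   function is determined by its values, and leaving out the generic point does
   not change the lattice of open sets. *)

Definition Fbar : closedFieldType :=
  projT1 (countable_algebraic_closure 'F_2).

Lemma Fbar_pchar2 : 2%N \in [pchar Fbar].
Proof.
rewrite /Fbar; case: countable_algebraic_closure => K [f _] /=.
by rewrite (fmorph_pchar f) pchar_Fp.
Qed.

(* The subfield of Fbar with 2^r elements (r > 0). *)
Definition GF2 (r : nat) : {pred Fbar} := [pred a | a ^+ (2 ^ r) == a].

Lemma GF2D r (a b : Fbar) : (a + b) ^+ (2 ^ r) = a ^+ (2 ^ r) + b ^+ (2 ^ r).
Proof. by apply: exprDn_pchar; rewrite pnatX (pnatE _ (isT : prime 2)) Fbar_pchar2. Qed.

Lemma oppFbar (a : Fbar) : - a = a.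
Proof. exact: (oppr_pchar2 Fbar_pchar2). Qed.

Lemma GF2_subring r : subring_closed (GF2 r).
Proof.
split=> [|a b|a b]; rewrite !inE ?expr1n //.
  by move=> /eqP ha /eqP hb; rewrite oppFbar GF2D ha hb.
by move=> /eqP ha /eqP hb; rewrite exprMn ha hb.
Qed.
HB.instance Definition _ r := GRing.isSubringClosed.Build Fbar (GF2 r) (GF2_subring r).

Lemma GF2_sub1 r : {subset GF2 1 <= GF2 r}.
Proof.
move=> a; rewrite !inE expn1 => /eqP ha; apply/eqP.
by elim: r => [|r IH]; rewrite ?expr1 // expnS exprM ha.
Qed.

(* Geometric points of X in P^2, by their representative whose last nonzero
   coordinate is 1. *)
Definition normalized (v : 3.-tuple Fbar) : bool :=
  [|| v`_2 == 1, (v`_2 == 0) && (v`_1 == 1)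
    | [&& v`_2 == 0, v`_1 == 0 & v`_0 == 1]].

(* y^2 + y = x^3 + x + 1, homogenized *)
Definition on_curve (v : 3.-tuple Fbar) : bool :=
  let: (X, Y, Z) := (v`_0, v`_1, v`_2) in
  Y ^+ 2 * Z + Y * Z ^+ 2 == X ^+ 3 + X * Z ^+ 2 + Z ^+ 3.

Record point := Point {
  coords :> 3.-tuple Fbar;
  coordsP : normalized coords && on_curve coords }.
HB.instance Definition _ := [isSub for coords].
HB.instance Definition _ := [Choice of point by <:].

Definition form (r d : nat) (G : {mpoly Fbar[3]}) : Prop :=
  G \is d.-homog /\ G \is a mpolyOver 3 (GF2 r).

Definition ev (G : {mpoly Fbar[3]}) (P : point) : Fbar := G.@[tnth P].

(* A contains a basic Zariski open set of X_r around P. *)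
Definition near (r : nat) (P : point) (A : set point) : Prop :=
  exists d G, [/\ form r d G, ev G P != 0 & forall Q, ev G Q != 0 -> A Q].

(* The Zariski topology of X_r; such sets are automatically stable under the
   2^r-power Frobenius, i.e. they are sets of closed points of X_r. *)
Definition zopen (r : nat) (U : set point) : Prop :=
  forall P, U P -> near r P U.

Definition regular_at (r : nat) (f : point -> Fbar) (P : point) : Prop :=
  exists d G H, [/\ form r d G, form r d H &
    near r P [set Q | ev H Q != 0 /\ f Q = ev G Q / ev H Q]].

Lemma form0 r d : form r d 0.
Proof. by split; [exact: dhomog0 | exact: rpred0]. Qed.

Lemma form1 r : form r 0 1.
Proof. by split; [exact: dhomog1 | exact: rpred1]. Qed.

Lemma formD r d G H : form r d G -> form r d H -> form r d (G + H).
Proof. by move=> [g1 g2] [h1 h2]; split; apply: rpredD. Qed.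

Lemma formM r d e G H : form r d G -> form r e H -> form r (d + e) (G * H).
Proof. by move=> [g1 g2] [h1 h2]; split; [exact: dhomogM | exact: rpredM]. Qed.

Lemma form_sub1 r d G : form 1 d G -> form r d G.
Proof. by move=> [g1 g2]; split=> //; apply: mpolyOverS g2; apply: GF2_sub1. Qed.

Lemma evD G H P : ev (G + H) P = ev G P + ev H P.
Proof. exact: mevalD. Qed.
Lemma evM G H P : ev (G * H) P = ev G P * ev H P.
Proof. exact: mevalM. Qed.
Lemma ev1 P : ev 1 P = 1.
Proof. exact: meval1. Qed.
Lemma ev0 P : ev 0 P = 0.
Proof. exact: meval0. Qed.

Lemma near_point r P A : near r P A -> A P.
Proof. by move=> [d [G [_ GP]]]; apply. Qed.

Lemma nearT r P (A : set point) : (forall Q, A Q) -> near r P A.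
Proof.
by move=> h; exists 0%N, 1; split; [exact: form1 | rewrite ev1 oner_eq0 | ].
Qed.

Lemma nearS r P (A B : set point) : A `<=` B -> near r P A -> near r P B.
Proof. by move=> AB [d [G [fG GP GA]]]; exists d, G; split=> // Q /GA /AB. Qed.

Lemma nearI r P (A B : set point) : near r P A -> near r P B -> near r P (A `&` B).
Proof.
move=> [d [G [fG GP GA]]] [e [H [fH HP HB]]].
exists (d + e)%N, (G * H); split; first exact: formM.
  by rewrite evM mulf_neq0.
by move=> Q; rewrite evM mulf_eq0 negb_or => /andP[/GA ? /HB].
Qed.

Lemma near_sub1 r P A : near 1 P A -> near r P A.
Proof. by move=> [d [G [fG GP GA]]]; exists d, G; split=> //; apply: form_sub1. Qed.

Lemma regular_near r f g P :
  near r P [set Q | f Q = g Q] -> regular_at r f P -> regular_at r g P.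
Proof.
move=> nfg [d [G [H [fG fH nf]]]]; exists d, G, H; split=> //.
by apply: nearS (nearI nfg nf) => Q /= [-> ].
Qed.

Lemma regular0 r P : regular_at r 0 P.
Proof.
exists 0%N, 0, 1; split; [exact: form0 | exact: form1 | apply: nearT => Q].
by rewrite /= ev1 ev0 mul0r oner_eq0.
Qed.

Lemma regular1 r P : regular_at r 1 P.
Proof.
exists 0%N, 1, 1; split; [exact: form1 | exact: form1 | apply: nearT => Q].
by rewrite /= ev1 divr1 oner_eq0.
Qed.

Lemma regularD r f g P :
  regular_at r f P -> regular_at r g P -> regular_at r (f + g) P.
Proof.
move=> [d [G [H [fG fH nf]]]] [e [G' [H' [fG' fH' ng]]]].
exists (d + e)%N, (G * H' + G' * H), (H * H'); split.
- by apply: formD; [exact: formM | rewrite addnC; exact: formM].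
- exact: formM.
apply: nearS (nearI nf ng) => Q /= [[hQ fQ] [hQ' gQ]].
rewrite evD !evM mulf_neq0 //; split=> //.
by rewrite addrfctE /= fQ gQ addf_div.
Qed.

Lemma regularM r f g P :
  regular_at r f P -> regular_at r g P -> regular_at r (f * g) P.
Proof.
move=> [d [G [H [fG fH nf]]]] [e [G' [H' [fG' fH' ng]]]].
exists (d + e)%N, (G * G'), (H * H'); split; [exact: formM | exact: formM | ].
apply: nearS (nearI nf ng) => Q /= [[hQ fQ] [hQ' gQ]].
by rewrite !evM mulf_neq0 //; split=> //; rewrite mulrfctE /= fQ gQ mulf_div.
Qed.

Lemma oppfct (f : point -> Fbar) : - f = f.
Proof. by apply/funext => P; rewrite opprfctE oppFbar. Qed.

Lemma regular_sub1 r f P : regular_at 1 f P -> regular_at r f P.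
Proof.
move=> [d [G [H [fG fH nf]]]].
by exists d, G, H; split; [exact: form_sub1 | exact: form_sub1 | exact: near_sub1].
Qed.

Record xopen := XOpen { oset :> set point; osetP : zopen 1 oset }.

(* O_X(U), a regular function on U being extended by 0 outside U. *)
Definition regular_on (U : set point) (f : point -> Fbar) : Prop :=
  (forall P, ~ U P -> f P = 0) /\ (forall P, U P -> regular_at 1 f P).

Record regfun (U : set point) := RegFun {
  regval :> point -> Fbar;
  regvalP : `[< regular_on U regval >] }.
HB.instance Definition _ U := [isSub for @regval U].
HB.instance Definition _ U := [Choice of regfun U by <:].

Lemma regular_on_zmod U : zmod_closed (fun f => `[< regular_on U f >]).
Proof.
split=> [|f g]; first by apply/asboolP; split=> // P _; exact: regular0.
move=> /asboolP [f0 fr] /asboolP [g0 gr]; apply/asboolP.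
rewrite oppfct; split=> P UP.
  by rewrite addrfctE f0 // g0 // addr0.
by apply: regularD; [exact: fr | exact: gr].
Qed.
HB.instance Definition _ U :=
  GRing.SubChoice_isSubZmodule.Build _ _ (regfun U) (@regular_on_zmod U).

Lemma regfunP U (f : regfun U) : regular_on U f.
Proof. exact/asboolP/(regvalP f). Qed.

Lemma regfun_eq U (f g : regfun U) : (forall P, f P = g P) -> f = g.
Proof. by move=> fg; apply: val_inj; apply/funext. Qed.

Lemma regfunD U (f g : regfun U) P : (f + g) P = f P + g P.
Proof. by []. Qed.

Definition cut (A : set point) (f : point -> Fbar) : point -> Fbar :=
  fun P => if `[< A P >] then f P else 0.

Lemma cut_in A f P : A P -> cut A f P = f P.
Proof. by move=> AP; rewrite /cut asboolT. Qed.
Lemma cut_out A f P : ~ A P -> cut A f P = 0.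
Proof. by move=> AP; rewrite /cut asboolF. Qed.
Lemma cutD A f g : cut A (f + g) = cut A f + cut A g.
Proof.
apply/funext => P; rewrite !fctE /cut; case: asboolP => _ //.
by rewrite addr0.
Qed.
Lemma cutM A a f : cut A (a * f) = cut A a * cut A f.
Proof.
apply/funext => P; rewrite !fctE /cut; case: asboolP => _ //.
by rewrite mulr0.
Qed.
Lemma near_cut r (V : set point) f P :
  near r P V -> near r P [set Q | f Q = cut V f Q].
Proof. by apply: nearS => Q VQ /=; rewrite cut_in. Qed.

Lemma xopen_near r (U : xopen) P : oset U P -> near r P U.
Proof. by move=> UP; apply/near_sub1/osetP. Qed.

Section RegfunRing.
Variable U : xopen.

Lemma one_subproof : `[< regular_on U (cut U 1) >].
Proof.
apply/asboolP; split=> P UP; first exact: cut_out.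
apply: regular_near (regular1 1 P); apply: near_cut; exact: xopen_near.
Qed.
Definition regfun_one : regfun U := RegFun one_subproof.

Lemma mul_subproof (f g : regfun U) : `[< regular_on U (regval f * regval g) >].
Proof.
case: (regfunP f) (regfunP g) => f0 fr [g0 gr].
apply/asboolP; split=> P UP; first by rewrite mulrfctE f0 // mul0r.
by apply: regularM; [exact: fr | exact: gr].
Qed.
Definition regfun_mul (f g : regfun U) : regfun U := RegFun (mul_subproof f g).

Lemma regfun_mulA : associative regfun_mul.
Proof. by move=> f g h; apply: regfun_eq => P; rewrite /= !fctE mulrA. Qed.
Lemma regfun_mulC : commutative regfun_mul.
Proof. by move=> f g; apply: regfun_eq => P; rewrite /= !fctE mulrC. Qed.
Lemma regfun_mul1 : left_id regfun_one regfun_mul.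
Proof.
move=> f; apply: regfun_eq => P; rewrite /= fctE.
have [UP|UP] := pselect (oset U P); first by rewrite cut_in // mul1r.
by rewrite cut_out // mul0r; case: (regfunP f) => ->.
Qed.
Lemma regfun_mulD : left_distributive regfun_mul +%R.
Proof. by move=> f g h; apply: regfun_eq => P; rewrite /= !fctE mulrDl. Qed.
End RegfunRing.

HB.instance Definition _ (U : xopen) := GRing.Zmodule_isComPzRing.Build (regfun U)
  (@regfun_mulA U) (@regfun_mulC U) (@regfun_mul1 U) (@regfun_mulD U).

Lemma regfunM (U : xopen) (f g : regfun U) P : (f * g) P = f P * g P.
Proof. by []. Qed.
Lemma regfun1 (U : xopen) P : oset U P -> (1 : regfun U) P = 1.
Proof. exact: cut_in. Qed.

Lemma restr_subproof (U V : xopen) (VU : V `<=` U) (f : regfun U) :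
  `[< regular_on V (cut V f) >].
Proof.
case: (regfunP f) => f0 fr.
apply/asboolP; split=> P VP; first exact: cut_out.
apply: regular_near (fr P (VU _ VP)); apply: near_cut; exact: xopen_near.
Qed.
Definition restr (U V : xopen) (VU : V `<=` U) (f : regfun U) : regfun V :=
  RegFun (restr_subproof VU f).

Record xsheaf := XSheaf {
  sec : forall U : xopen, lmodType (regfun U);
  res : forall U V : xopen, V `<=` U -> sec U -> sec V;
  resD : forall (U V : xopen) (VU : V `<=` U) (s t : sec U),
    res VU (s + t) = res VU s + res VU t;
  resZ : forall (U V : xopen) (VU : V `<=` U) (a : regfun U) (s : sec U),
    res VU (a *: s) = restr VU a *: res VU s;
  res_id : forall (U : xopen) (UU : U `<=` U) (s : sec U), res UU s = s;
  res_comp : forall (U V W : xopen) (VU : V `<=` U) (WV : W `<=` V)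
      (WU : W `<=` U) (s : sec U),
    res WV (res VU s) = res WU s;
  res_glue : forall (U : xopen) (I : Type) (W : I -> xopen)
      (WU : forall i, W i `<=` U) (s : forall i, sec (W i)),
    U `<=` \bigcup_i W i ->
    (forall (i j : I) (V : xopen) (Vi : V `<=` W i) (Vj : V `<=` W j),
       res Vi (s i) = res Vj (s j)) ->
    exists! t : sec U, forall i, res (WU i) t = s i }.

Record hom (E F : xsheaf) := Hom {
  hom_fun :> forall U : xopen, {linear sec E U -> sec F U};
  hom_res : forall (U V : xopen) (VU : V `<=` U) (s : sec E U),
    hom_fun V (res VU s) = res VU (hom_fun U s) }.

Definition is_iso (E F : xsheaf) (u : hom E F) : Prop :=
  exists v : hom F E, forall U, cancel (u U) (v U) /\ cancel (v U) (u U).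

Definition isomorphic (E F : xsheaf) : Prop := exists u : hom E F, is_iso u.

Definition vector_bundle (n : nat) (E : xsheaf) : Prop :=
  forall P : point, exists U : xopen, oset U P /\
  exists e : 'I_n -> sec E U,
  forall (V : xopen) (VU : V `<=` U) (s : sec E V),
    exists! a : 'I_n -> regfun V, s = \sum_i a i *: res VU (e i).

(* s is a section of the image sheaf of u. *)
Definition in_image (E F : xsheaf) (u : hom E F) (U : xopen) (s : sec F U) : Prop :=
  forall P, oset U P -> exists (V : xopen) (VU : V `<=` U) (t : sec E V),
    oset V P /\ u V t = res VU s.

Definition short_exact (E F G : xsheaf) (u : hom E F) (v : hom F G) : Prop :=
  [/\ forall U, injective (u U),
      forall U (s : sec F U), v U s = 0 <-> in_image u s
    & forall U (s : sec G U), in_image v s].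

Section DirectSum.
Variables E F : xsheaf.

Definition dsum_sec (U : xopen) : lmodType (regfun U) := (sec E U * sec F U)%type.
Definition dsum_res (U V : xopen) (VU : V `<=` U) (s : dsum_sec U) : dsum_sec V :=
  (res VU s.1, res VU s.2).

Lemma dsum_resD (U V : xopen) (VU : V `<=` U) (s t : dsum_sec U) :
  dsum_res VU (s + t) = dsum_res VU s + dsum_res VU t.
Proof. by congr pair; rewrite resD. Qed.
Lemma dsum_resZ (U V : xopen) (VU : V `<=` U) (a : regfun U) (s : dsum_sec U) :
  dsum_res VU (a *: s) = restr VU a *: dsum_res VU s.
Proof. by congr pair; rewrite resZ. Qed.
Lemma dsum_res_id (U : xopen) (UU : U `<=` U) (s : dsum_sec U) : dsum_res UU s = s.
Proof. by case: s => s t; congr pair; rewrite res_id. Qed.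
Lemma dsum_res_comp (U V W : xopen) (VU : V `<=` U) (WV : W `<=` V)
    (WU : W `<=` U) (s : dsum_sec U) :
  dsum_res WV (dsum_res VU s) = dsum_res WU s.
Proof. by congr pair; rewrite /= res_comp. Qed.
Lemma dsum_glue (U : xopen) (I : Type) (W : I -> xopen)
    (WU : forall i, W i `<=` U) (s : forall i, dsum_sec (W i)) :
  U `<=` \bigcup_i W i ->
  (forall (i j : I) (V : xopen) (Vi : V `<=` W i) (Vj : V `<=` W j),
     dsum_res Vi (s i) = dsum_res Vj (s j)) ->
  exists! t : dsum_sec U, forall i, dsum_res (WU i) t = s i.
Proof.
move=> cov compat.
have [i j V Vi Vj|t1 [h1 u1]] := @res_glue E U I W WU (fun i => (s i).1) cov.
  by have [] := compat i j V Vi Vj.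
have [i j V Vi Vj|t2 [h2 u2]] := @res_glue F U I W WU (fun i => (s i).2) cov.
  by have [] := compat i j V Vi Vj.
exists (t1, t2); split=> [i|[t1' t2'] h].
  by rewrite /dsum_res /= h1 h2; case: (s i).
by congr pair; [apply: u1 | apply: u2] => i; rewrite -h.
Qed.

Definition dsum : xsheaf :=
  XSheaf dsum_resD dsum_resZ dsum_res_id dsum_res_comp dsum_glue.
End DirectSum.

(* The germ of t generates the maximal ideal of O_(X_r, P). *)
Definition uniformizer (r : nat) (P : point) (t : point -> Fbar) : Prop :=
  [/\ regular_at r t P, t P = 0 &
      forall g, regular_at r g P -> g P = 0 ->
        exists2 h, regular_at r h P & near r P [set Q | g Q = t Q * h Q]].

(* Sections over U of O_(X_r)(D), for a divisor D on X_r given as a finitely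
   supported function on geometric points that is constant on Galois orbits.
   The rational function f is recorded by its values on U outside the support
   of D (and by 0 elsewhere); ord_P f >= - D P is expressed by saying that
   f * t ^ (D P) extends to a regular function at P, t being a uniformizer. *)
Definition divisor_on (r : nat) (D : point -> int) (U : set point)
    (f : point -> Fbar) : Prop :=
  [/\ forall P, ~ U P \/ D P <> 0 -> f P = 0,
      forall P, U P -> D P = 0 -> regular_at r f P
    & forall P, U P -> D P <> 0 -> forall t, uniformizer r P t ->
        exists2 h, regular_at r h P &
          near r P [set Q | D Q = 0 -> f Q * t Q ^ D P = h Q]].

Record divsec (r : nat) (D : point -> int) (U : set point) := DivSec {
  divval :> point -> Fbar;
  divvalP : `[< divisor_on r D U divval >] }.
HB.instance Definition _ r D U := [isSub for @divval r D U].
HB.instance Definition _ r D U := [Choice of divsec r D U by <:].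

Lemma divisor_on_zmod r D U : zmod_closed (fun f => `[< divisor_on r D U f >]).
Proof.
split=> [|f g].
  apply/asboolP; split=> // P UP DP; first exact: regular0.
  move=> t _; exists 0; first exact: regular0.
  by apply: nearT => Q _; rewrite mul0r.
move=> /asboolP [f0 fr fd] /asboolP [g0 gr gd]; apply/asboolP.
rewrite oppfct; split=> P UP.
- by rewrite addrfctE f0 // g0 // addr0.
- by move=> DP; apply: regularD; [exact: fr | exact: gr].
move=> DP t ut; have [h hr nh] := fd P UP DP t ut.
have [k kr nk] := gd P UP DP t ut.
exists (h + k); first exact: regularD.
apply: nearS (nearI nh nk) => Q /= [hQ kQ] DQ.
by rewrite !addrfctE mulrDl hQ // kQ.
Qed.
HB.instance Definition _ r D U :=
  GRing.SubChoice_isSubZmodule.Build _ _ (divsec r D U) (@divisor_on_zmod r D U).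

Lemma divsecP r D U (f : divsec r D U) : divisor_on r D U f.
Proof. exact/asboolP/(divvalP f). Qed.

Lemma divsec_eq r D U (f g : divsec r D U) : (forall P, f P = g P) -> f = g.
Proof. by move=> fg; apply: val_inj; apply/funext. Qed.

Section DivisorSheaf.
Variables (r : nat) (D : point -> int).

Section Scale.
Variable U : xopen.

Lemma divscale_subproof (a : regfun U) (f : divsec r D U) :
  `[< divisor_on r D U (regval a * divval f) >].
Proof.
case: (regfunP a) (divsecP f) => a0 ar [f0 fr fd].
apply/asboolP; split=> P UP.
- by rewrite mulrfctE f0 // mulr0.
- by move=> DP; apply: regularM; [apply/regular_sub1/ar | apply: fr].
move=> DP t ut; have [h hr nh] := fd P UP DP t ut.
exists (regval a * h); first by apply: regularM => //; apply/regular_sub1/ar.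
by apply: nearS nh => Q /= hQ DQ; rewrite !mulrfctE -mulrA hQ.
Qed.
Definition divscale (a : regfun U) (f : divsec r D U) : divsec r D U :=
  DivSec (divscale_subproof a f).

Lemma divscaleA a b f : divscale a (divscale b f) = divscale (a * b) f.
Proof. by apply: divsec_eq => P; rewrite /= !fctE mulrA. Qed.
Lemma divscale1 : left_id 1 divscale.
Proof.
move=> f; apply: divsec_eq => P; rewrite /= fctE.
have [UP|UP] := pselect (oset U P); first by rewrite cut_in // mul1r.
by rewrite cut_out // mul0r; case: (divsecP f) => -> //; left.
Qed.
Lemma divscaleDr : right_distributive divscale +%R.
Proof. by move=> a f g; apply: divsec_eq => P; rewrite /= !fctE mulrDr. Qed.
Lemma divscaleDl f : {morph divscale^~ f : a b / a + b}.
Proof. by move=> a b; apply: divsec_eq => P; rewrite /= !fctE mulrDl. Qed.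
End Scale.

HB.instance Definition _ (U : xopen) := GRing.Zmodule_isLmodule.Build (regfun U)
  (divsec r D U) (@divscaleA U) (@divscale1 U) (@divscaleDr U) (@divscaleDl U).

Definition div_sec (U : xopen) : lmodType (regfun U) := divsec r D U.

Lemma divisor_on_local (A B : set point) f g :
  (forall P, B P -> A P) -> (forall P, B P -> near r P [set Q | f Q = g Q]) ->
  (forall P, ~ B P \/ D P <> 0 -> g P = 0) ->
  divisor_on r D A f -> divisor_on r D B g.
Proof.
move=> BA fg g0 [_ fr fd]; split=> // P BP DP.
  by apply: regular_near (fg P BP) _; apply: fr => //; exact: BA.
move=> t ut; have [h hr nh] := fd P (BA P BP) DP t ut.
by exists h => //; apply: nearS (nearI (fg P BP) nh) => Q /= [<-].
Qed.

Lemma divres_subproof (U V : xopen) (VU : V `<=` U) (f : divsec r D U) :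
  `[< divisor_on r D V (cut V f) >].
Proof.
apply/asboolP; apply: divisor_on_local (divsecP f) => // P.
  by move=> VP; apply: near_cut; exact: xopen_near.
have [VP [//|DP]|VP _] := pselect (oset V P); last by rewrite cut_out.
by rewrite cut_in //; case: (divsecP f) => -> //; right.
Qed.
Definition divres (U V : xopen) (VU : V `<=` U) (f : div_sec U) : div_sec V :=
  DivSec (divres_subproof VU f).

Lemma divresE (U V : xopen) (VU : V `<=` U) (f : div_sec U) P :
  oset V P -> (divres VU f : divsec r D V) P = (f : divsec r D U) P.
Proof. by move=> VP /=; rewrite cut_in. Qed.

Lemma divsec_eq_on (U : xopen) (f g : div_sec U) :
  (forall P, oset U P -> (f : divsec r D U) P = (g : divsec r D U) P) -> f = g.
Proof.
move=> fg; apply: divsec_eq => P; have [/fg //|UP] := pselect (oset U P).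
by case: (divsecP f) => -> //; [case: (divsecP g) => -> // | ]; left.
Qed.

Lemma divresD (U V : xopen) (VU : V `<=` U) (s t : div_sec U) :
  divres VU (s + t) = divres VU s + divres VU t.
Proof. by apply: val_inj; rewrite /= cutD. Qed.
Lemma divresZ (U V : xopen) (VU : V `<=` U) (a : regfun U) (s : div_sec U) :
  divres VU (a *: s) = restr VU a *: divres VU s.
Proof. by apply: val_inj; rewrite /= cutM. Qed.
Lemma divres_id (U : xopen) (UU : U `<=` U) (s : div_sec U) : divres UU s = s.
Proof. by apply: divsec_eq_on => P UP; rewrite divresE. Qed.
Lemma divres_comp (U V W : xopen) (VU : V `<=` U) (WV : W `<=` V)
    (WU : W `<=` U) (s : div_sec U) :
  divres WV (divres VU s) = divres WU s.
Proof.
by apply: divsec_eq_on => P WP; rewrite !divresE //; apply: WV.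
Qed.

Lemma xopenI (U V : xopen) : zopen 1 (oset U `&` oset V).
Proof. by move=> P [UP VP]; apply: nearI; exact: xopen_near. Qed.
Definition meet (U V : xopen) : xopen := XOpen (xopenI (U := U) (V := V)).

Lemma div_glue (U : xopen) (I : Type) (W : I -> xopen)
    (WU : forall i, W i `<=` U) (s : forall i, div_sec (W i)) :
  U `<=` \bigcup_i W i ->
  (forall (i j : I) (V : xopen) (Vi : V `<=` W i) (Vj : V `<=` W j),
     divres Vi (s i) = divres Vj (s j)) ->
  exists! t : div_sec U, forall i, divres (WU i) t = s i.
Proof.
move=> cov compat.
pose sv i : point -> Fbar := divval (s i).
have agree i j P : oset (W i) P -> oset (W j) P -> sv i P = sv j P.
  move=> iP jP; have := compat i j (meet (W i) (W j)) (@subIsetl _ _ _) (@subIsetr _ _ _).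
  by move=> /(congr1 (fun u : divsec r D _ => u P)); rewrite !divresE.
pose F P (UP : oset U P) := sv (projT1 (cid2 (cov P UP))) P.
pose f P := if pselect (oset U P) is left UP then F P UP else 0.
have fE i P : oset (W i) P -> f P = sv i P.
  move=> iP; rewrite /f; case: pselect => [UP|]; last by move=> []; apply: WU iP.
  by rewrite /F; case: cid2 => j _ jP /=; exact: agree.
have fdiv : `[< divisor_on r D U f >].
  apply/asboolP; have f0 P : ~ oset U P \/ D P <> 0 -> f P = 0.
    have [UP [//|DP]|UP _] := pselect (oset U P); last first.
      by rewrite /f; case: pselect.
    have [i _ iP] := cov P UP; rewrite (fE i) //.
    by rewrite /sv; case: (divsecP (s i : divsec r D (W i))) => -> //; right.
  have loc i : divisor_on r D (W i) (cut (W i) f).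
    apply: divisor_on_local (divsecP (s i : divsec r D (W i))) => // P.
      move=> iP; apply: nearS (xopen_near r iP) => Q iQ /=.
      by rewrite cut_in // (fE i).
    have [iP [//|DP]|iP _] := pselect (oset (W i) P); last by rewrite cut_out.
    by rewrite cut_in // f0 //; right.
  split=> // P UP DP; have [i _ iP] := cov P UP; have [_ lr ld] := loc i.
    apply: regular_near (lr P iP DP).
    by apply: nearS (xopen_near r iP) => Q iQ /=; rewrite cut_in.
  move=> t ut; have [h hr nh] := ld P iP DP t ut; exists h => //.
  by apply: nearS (nearI (xopen_near r iP) nh) => Q /= [iQ]; rewrite cut_in.
exists (DivSec fdiv : div_sec U); split=> [i|g hg].
  by apply: divsec_eq_on => P iP; rewrite divresE //= (fE i).
apply: divsec_eq_on => P UP /=; have [i _ iP] := cov P UP.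
rewrite (fE i) // /sv.
by have := congr1 (fun u : divsec r D _ => u P) (hg i); rewrite divresE.
Qed.

(* The push-forward of O_(X_r)(D) along X_r -> X; the preimage of U in X_r is U
   itself, viewed as a set of geometric points. *)
Definition push_O : xsheaf :=
  XSheaf divresD divresZ divres_id divres_comp div_glue.
End DivisorSheaf.

(* The residue field of X at the closed point below P, identified by
   evaluation at P with the subfield F_2(P) of Fbar. *)
Definition residue (P : point) (c : Fbar) : Prop :=
  exists2 f, regular_at 1 f P & f P = c.

Definition sky_on (P : point) (U : set point) (c : Fbar) : Prop :=
  residue P c /\ (~ U P -> c = 0).

Record skysec (P : point) (U : set point) := SkySec {
  skyval : Fbar;
  skyvalP : `[< sky_on P U skyval >] }.
HB.instance Definition _ P U := [isSub for @skyval P U].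
HB.instance Definition _ P U := [Choice of skysec P U by <:].

Lemma residue0 P : residue P 0.
Proof. by exists 0 => //; exact: regular0. Qed.

Lemma sky_on_zmod P U : zmod_closed (fun c => `[< sky_on P U c >]).
Proof.
split=> [|b c]; first by apply/asboolP; split=> //; exact: residue0.
move=> /asboolP [[f fr fb] b0] /asboolP [[g gr gc] c0]; apply/asboolP; split.
  exists (f + g); first exact: regularD.
  by rewrite oppFbar addrfctE fb gc.
by move=> UP; rewrite b0 // c0 // subr0.
Qed.
HB.instance Definition _ P U :=
  GRing.SubChoice_isSubZmodule.Build _ _ (skysec P U) (@sky_on_zmod P U).

Lemma skysecP P U (c : skysec P U) : sky_on P U (skyval c).
Proof. exact/asboolP/(skyvalP c). Qed.

Section Skyscraper.
Variable P : point.

Section Scale.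
Variable U : xopen.

Lemma skyscale_subproof (a : regfun U) (c : skysec P U) :
  `[< sky_on P U (a P * skyval c) >].
Proof.
case: (regfunP a) (skysecP c) => a0 ar [[g gr gc] c0]; apply/asboolP.
split=> [|UP]; last by rewrite a0 // mul0r.
have [UP|UP] := pselect (oset U P); last by rewrite a0 // mul0r; exact: residue0.
exists (regval a * g); first by apply: regularM => //; exact: ar.
by rewrite mulrfctE gc.
Qed.
Definition skyscale (a : regfun U) (c : skysec P U) : skysec P U :=
  SkySec (skyscale_subproof a c).

Lemma skyscaleA a b c : skyscale a (skyscale b c) = skyscale (a * b) c.
Proof. by apply: val_inj; rewrite /= !fctE mulrA. Qed.
Lemma skyscale1 : left_id 1 skyscale.
Proof.
move=> c; apply: val_inj => /=.
have [UP|UP] := pselect (oset U P); first by rewrite cut_in // mul1r.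
by rewrite cut_out // mul0r; have [_ c0] := skysecP c; rewrite [RHS]c0.
Qed.
Lemma skyscaleDr : right_distributive skyscale +%R.
Proof. by move=> a c d; apply: val_inj; rewrite /= mulrDr. Qed.
Lemma skyscaleDl c : {morph skyscale^~ c : a b / a + b}.
Proof. by move=> a b; apply: val_inj; rewrite /= !fctE mulrDl. Qed.
End Scale.

HB.instance Definition _ (U : xopen) := GRing.Zmodule_isLmodule.Build (regfun U)
  (skysec P U) (@skyscaleA U) (@skyscale1 U) (@skyscaleDr U) (@skyscaleDl U).

Definition sky_sec (U : xopen) : lmodType (regfun U) := skysec P U.

Lemma skyres_subproof (U V : xopen) (VU : V `<=` U) (c : skysec P U) :
  `[< sky_on P V (if `[< oset V P >] then val c else 0) >].
Proof.
apply/asboolP; case: asboolP => VP; last by split=> //; exact: residue0.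
by split=> //; case: (skysecP c).
Qed.
Definition skyres (U V : xopen) (VU : V `<=` U) (c : sky_sec U) : sky_sec V :=
  SkySec (skyres_subproof VU c).

Lemma sky_eq_on (U : xopen) (c d : sky_sec U) :
  (oset U P -> val (c : skysec P U) = val (d : skysec P U)) -> c = d.
Proof.
move=> cd; apply: val_inj; have [/cd //|UP] := pselect (oset U P).
by have [[_ c0] [_ d0]] := (skysecP c, skysecP d); rewrite [LHS]c0 // [RHS]d0.
Qed.

Lemma skyresE (U V : xopen) (VU : V `<=` U) (c : sky_sec U) : oset V P ->
  val (skyres VU c : skysec P V) = val (c : skysec P U).
Proof. by move=> VP /=; rewrite asboolT. Qed.

Lemma skyresD (U V : xopen) (VU : V `<=` U) (s t : sky_sec U) :
  skyres VU (s + t) = skyres VU s + skyres VU t.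
Proof. by apply: sky_eq_on => VP; rewrite /= !asboolT. Qed.
Lemma skyresZ (U V : xopen) (VU : V `<=` U) (a : regfun U) (s : sky_sec U) :
  skyres VU (a *: s) = restr VU a *: skyres VU s.
Proof. by apply: sky_eq_on => VP; rewrite /= !asboolT // cut_in. Qed.
Lemma skyres_id (U : xopen) (UU : U `<=` U) (s : sky_sec U) : skyres UU s = s.
Proof. by apply: sky_eq_on => UP; rewrite skyresE. Qed.
Lemma skyres_comp (U V W : xopen) (VU : V `<=` U) (WV : W `<=` V)
    (WU : W `<=` U) (s : sky_sec U) :
  skyres WV (skyres VU s) = skyres WU s.
Proof. by apply: sky_eq_on => WP; rewrite !skyresE //; apply: WV. Qed.

Lemma sky_glue (U : xopen) (I : Type) (W : I -> xopen)
    (WU : forall i, W i `<=` U) (s : forall i, sky_sec (W i)) :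
  U `<=` \bigcup_i W i ->
  (forall (i j : I) (V : xopen) (Vi : V `<=` W i) (Vj : V `<=` W j),
     skyres Vi (s i) = skyres Vj (s j)) ->
  exists! t : sky_sec U, forall i, skyres (WU i) t = s i.
Proof.
move=> cov compat.
have [UP|UP] := pselect (oset U P); last first.
  exists (0 : sky_sec U); split=> [i|t _]; apply: sky_eq_on => // iP.
  by case: UP; apply: WU iP.
have [i _ iP] := cov P UP.
have cP : `[< sky_on P U (val (s i : skysec P (W i))) >].
  by apply/asboolP; split=> //; case: (skysecP (s i)).
exists (SkySec cP : sky_sec U); split=> [j|t ht].
  apply: sky_eq_on => jP; rewrite skyresE //=.
  have := compat i j (meet (W i) (W j)) (@subIsetl _ _ _) (@subIsetr _ _ _).
  by move=> /(congr1 (fun u : skysec P _ => val u)); rewrite !skyresE.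
by apply: sky_eq_on => _ /=; rewrite -(ht i) skyresE.
Qed.

(* The skyscraper sheaf K_x, x the closed point below P. *)
Definition sky : xsheaf :=
  XSheaf skyresD skyresZ skyres_id skyres_comp sky_glue.
End Skyscraper.

Record hecke_seq (P : point) (E : xsheaf) := HeckeSeq {
  hs_sub : xsheaf;
  hs_inj : hom hs_sub E;
  hs_quo : hom E (sky P);
  hs_exact : short_exact hs_inj hs_quo }.

Definition hecke_seq_iso (P : point) (E : xsheaf) (S T : hecke_seq P E) : Prop :=
  exists (u : hom (hs_sub S) (hs_sub T)) (v : hom (sky P) (sky P)),
  [/\ is_iso u, is_iso v,
      forall U s, hs_inj T U (u U s) = hs_inj S U s
    & forall U s, hs_quo T U s = v U (hs_quo S U s)].

(* At the closed point x below P, with weight 1, both bundles having rank n. *)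
Definition hecke_modification (n : nat) (P : point) (E' E : xsheaf) : Prop :=
  [/\ vector_bundle n E', vector_bundle n E
    & exists (i : hom E' E) (p : hom E (sky P)), short_exact i p].

(* There are exactly m isomorphism classes of sequences 0 -> E'' -> E -> K_x -> 0
   with E'' isomorphic to E'. *)
Definition has_multiplicity (P : point) (E' E : xsheaf) (m : nat) : Prop :=
  exists S : 'I_m -> hecke_seq P E,
  [/\ forall i, isomorphic (hs_sub (S i)) E',
      forall i j, hecke_seq_iso (S i) (S j) -> i = j
    & forall T : hecke_seq P E, isomorphic (hs_sub T) E' ->
        exists i, hecke_seq_iso T (S i)].

Lemma x0_subproof :
  normalized [tuple 0; 1; 0] && on_curve [tuple 0; 1; 0].
Proof. by rewrite /normalized /on_curve /= !eqxx /= !(expr0n, mulr0, addr0) orbT eqxx. Qed.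
Definition x0 : point := Point x0_subproof.

Definition rational (P : point) : Prop := forall i, tnth P i \in GF2 1.

Lemma x0_unique P : rational P <-> P = x0.
Proof.
have GF01 a : a \in GF2 1 -> a = 0 \/ a = 1.
  rewrite !inE expn1 expr2 -subr_eq0 -{3}[a]mulr1 -mulrBr mulf_eq0 subr_eq0.
  by case/orP => /eqP; [left | right].
split=> [|-> i]; last first.
  case: i => [[|[|[|//]]] lti]; rewrite (tnth_nth 0) /= !inE ?expr0n ?expr1n //.
move=> rP; apply: val_inj; apply/val_inj; case: P rP => -[[|a [|b [|c []]]] // sz] cP rP.
move: (rP 0) (rP 1) (rP 2) (cP); rewrite !(tnth_nth 0) /normalized /on_curve /=.
move=> /GF01 [] -> /GF01 [] -> /GF01 [] ->.
all: by rewrite ?(expr0n, expr1n, mul0r, mul1r, mulr0, addr0, add0r, oner_eq0,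
  eqxx, eq_sym 0 1, addrr_pchar2 Fbar_pchar2).
Qed.

Section GeometricPoints.
Variable alpha : Fbar.
Hypotheses (alpha4 : alpha \in GF2 2) (alpha2 : alpha \notin GF2 1).

Lemma alphaE : alpha ^+ 2 + alpha = 1.
Proof.
move: alpha4 alpha2; rewrite !inE expn1 -subr_eq0.
have -> : alpha ^+ (2 ^ 2) - alpha
    = (alpha ^+ 2 - alpha) * (alpha ^+ 2 + alpha + 1) by ring.
rewrite mulf_eq0 -(subr_eq0 (alpha ^+ 2)) => /orP[-> //|/eqP h _].
by apply/eqP; rewrite -subr_eq0 oppFbar h.
Qed.

Lemma px_subproof :
  normalized [tuple 0; alpha; 1] && on_curve [tuple 0; alpha; 1].
Proof.
by rewrite /normalized /on_curve /= !eqxx /= !expr1n !mulr1 alphaE expr0n /= ?(mul0r, add0r) eqxx.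
Qed.
Definition px : point := Point px_subproof.

Lemma py_subproof :
  normalized [tuple 1; alpha; 1] && on_curve [tuple 1; alpha; 1].
Proof.
rewrite /normalized /on_curve /= !eqxx /= !expr1n !mulr1 alphaE.
by rewrite -{4}[1]oppFbar addrK.
Qed.
Definition py : point := Point py_subproof.
End GeometricPoints.

(* P as a divisor on X_r; this is constant on orbits only if P is rational over
   F_(2^r), which is the only case used. *)
Definition pt_div (P : point) : point -> int := fun R => (R == P)%:R.

(* O_X(x_0) *)
Definition E11 : xsheaf := push_O 1 (pt_div x0).

(* The bundles E_(z,1)^(2,0) = pi_* O_(X_2)(z' - x_0) and
   E_(z,1)^(2,2) = pi_* O_(X_2)(z'), for a closed point z of degree 2 of X and
   a closed point z' of X_2 above it, i.e. a point rational over F_4. *)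
Definition E20 (z' : point) : xsheaf := push_O 2 (fun R => pt_div z' R - pt_div x0 R).
Definition E22 (z' : point) : xsheaf := push_O 2 (pt_div z').

(* Main.v *)
From HB Require Import structures.
From mathcomp Require Import all_boot all_order all_algebra.
From mathcomp Require Import ring zify mpoly.
From mathcomp Require Import boolp classical_sets.
Require Import Defs.

Set Implicit Arguments.
Unset Strict Implicit.
Unset Printing Implicit Defensive.

Import GRing.Theory Num.Theory.
Local Open Scope classical_set_scope.
Local Open Scope ring_scope.

(** The curve X has exactly five points over F_4: the origin x0, the points P =
    (0, alpha) and Y = (1, alpha), and their conjugates P' and Y'. They form a
    cyclic group of order 5 on which conjugation is inversion and 2 P = Y. Every
    divisor of the proof is supported on them, and every function that is needed
    is built from x, x + 1 and the lines y + alpha, x + y + alpha and their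
    conjugates. A rational function is therefore recorded by its values at the
    remaining, generic, points, and compared with powers of a uniformizer at
    each of the five special points ([ordge], [lead], [ordis]).

    The bundles. Let E' = pi_* O(P - x0), and let E be an extension of K_x by
    E'. A section of E is a rational function with at most a double pole at P
    and a simple pole at P' near x ([rep_polar]). Its two polar parts, at P and,
    through conjugation, at P', form a vector of the plane F_4^2 that is a
    multiple of a fixed nonzero vector, because the quotient K_x has dimension
    one over the residue field F_4 ([class_exists]). The line so obtained
    determines E ([class_iso]), and each of the five lines of the plane occurs.
    One coordinate line gives pi_* O(2 P - x0), which is pi_* O(Y) because 2 P -
    x0 - Y is principal ([extension_Y]). The other gives pi_* O(P + P' - x0),
    which is pi_* O(x0) because x has divisor P + P' - 2 x0 ([extension_x0]);
    and pi_* O(x0) is the sum of two copies of O_X(x0), because x0 is already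
    rational over F_2 ([dsum_iso]). The remaining three lines are permuted by
    the automorphisms F_4^* of E', and all three give pi_* O(P): a
    conjugation-twisted map a f + g2 conj f embeds E' in it, where g2 has
    divisor P' + Y - P - x0 ([extension_P]).

    The multiplicities. A morphism over X between sheaves pushed forward from
    X_2 has the form u f + v conj f, for sections u and v of two line bundles on
    X_2 ([hom_twist], [twist_bound]). For E' and each of the three bundles these
    line bundles have degree one, so each has a one-dimensional space of
    sections: the quotient of two sections has at most one pole, of order one,
    and such a function is constant on a curve of genus one ([simple_pole_cst]).
    The morphisms thus correspond to pairs (a, b) in F_4^2. The morphisms that
    are injective with quotient K_x correspond to the pairs with exactly one
    nonzero entry for O(x0) + O(x0), to those with b = 0 and a nonzero for pi_*
    O(Y), and to those with a and b nonzero for pi_* O(P); the others kill a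
    constant or are not onto at a point away from x ([twist_inj],
    [no_vanishing]). Since a modification only depends on the kernel of the
    quotient map ([iso_of_kernel]), the 6, 3 and 9 morphisms are counted up to
    the three automorphisms of E', which leaves 2, 1 and 3. *)

(** * Characteristic two *)

Lemma two0 : 2%:R = 0 :> Fbar.
Proof. by have := Fbar_pchar2; rewrite inE => /andP[_ /eqP]. Qed.

Lemma addFF (a : Fbar) : a + a = 0.
Proof. exact: addrr_pchar2 Fbar_pchar2 _. Qed.

(** In characteristic two an identity holds as soon as the two sides differ by
    an even polynomial [2 c], which lets [ring] conclude. *)
Lemma char2_eq (c a b : Fbar) : a = b + 2%:R * c -> a = b.
Proof. by rewrite two0 mul0r addr0. Qed.

Lemma addF_eq0 (a b : Fbar) : (a + b == 0) = (a == b).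
Proof. by rewrite addr_eq0 oppFbar. Qed.

Lemma addKF (a b : Fbar) : a + (a + b) = b.
Proof. by rewrite addrA addFF add0r. Qed.

Lemma sqD (a b : Fbar) : (a + b) ^+ 2 = a ^+ 2 + b ^+ 2.
Proof. exact: (GF2D 1). Qed.

Lemma sq_inj : injective (fun a : Fbar => a ^+ 2).
Proof.
move=> a b /= ab; apply/eqP; rewrite -addF_eq0.
have : (a + b) ^+ 2 == 0 by rewrite sqD ab addFF.
by rewrite sqrf_eq0.
Qed.

Lemma sqrt_exists (a : Fbar) : exists b, b ^+ 2 == a.
Proof.
have /closed_rootP[b] : size ('X^2 - a%:P : {poly Fbar}) != 1%N.
  by rewrite size_XnsubC.
by rewrite rootE !hornerE subr_eq0; exists b.
Qed.

(** The inverse of the Frobenius automorphism of [Fbar]. *)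
Definition sqrt2 (a : Fbar) : Fbar := xchoose (sqrt_exists a).

Lemma sqrt2K (a : Fbar) : sqrt2 a ^+ 2 = a.
Proof. exact/eqP/(xchooseP (sqrt_exists a)). Qed.
Lemma sqrt2V (a : Fbar) : sqrt2 (a ^+ 2) = a.
Proof. by apply: sq_inj; rewrite /= sqrt2K. Qed.
Lemma sqrt2D (a b : Fbar) : sqrt2 (a + b) = sqrt2 a + sqrt2 b.
Proof. by apply: sq_inj; rewrite /= sqD !sqrt2K. Qed.
Lemma sqrt2M (a b : Fbar) : sqrt2 (a * b) = sqrt2 a * sqrt2 b.
Proof. by apply: sq_inj; rewrite /= exprMn !sqrt2K. Qed.
Lemma sqrt2_0 : sqrt2 0 = 0.
Proof. by apply: sq_inj; rewrite /= sqrt2K expr0n. Qed.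
Lemma sqrt2_1 : sqrt2 1 = 1.
Proof. by apply: sq_inj; rewrite /= sqrt2K expr1n. Qed.
Lemma sqrt2_inj : injective sqrt2.
Proof. by move=> a b ab; rewrite -(sqrt2K a) ab sqrt2K. Qed.
Lemma sqrt2_eq0 (a : Fbar) : (sqrt2 a == 0) = (a == 0).
Proof. by rewrite -{1}sqrt2_0 (inj_eq sqrt2_inj). Qed.
Lemma sqrt2_inv (a : Fbar) : sqrt2 a^-1 = (sqrt2 a)^-1.
Proof. by apply: sq_inj; rewrite /= exprVn !sqrt2K. Qed.
Lemma sqrt2X (a : Fbar) (n : int) : sqrt2 (a ^ n) = (sqrt2 a) ^ n.
Proof.
apply: sq_inj; rewrite /= sqrt2K -[(_ ^ n) ^+ 2]/((_ ^ n) ^ 2%:Z) exprzAC.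
by rewrite -[_ ^ 2%:Z]/(_ ^+ 2) sqrt2K.
Qed.

Lemma GF4P (a : Fbar) : a \in GF2 2 -> a ^+ 4 = a.
Proof. by rewrite inE => /eqP. Qed.
Lemma sqrt2_GF4 (a : Fbar) : a \in GF2 2 -> sqrt2 a = a ^+ 2.
Proof. by move=> /GF4P a4; apply: sq_inj; rewrite /= sqrt2K -exprM a4. Qed.
Lemma GF4_sq (a : Fbar) : a \in GF2 2 -> a ^+ 2 \in GF2 2.
Proof. by move=> /rpredX ->. Qed.
Lemma GF4V (a : Fbar) : a \in GF2 2 -> a^-1 \in GF2 2.
Proof. by rewrite !inE exprVn => /eqP ->. Qed.
Lemma GF20 (a : Fbar) : a \in GF2 0.
Proof. by rewrite inE expr1. Qed.
Lemma GF4_cube (a : Fbar) : a \in GF2 2 -> a != 0 -> a ^+ 3 = 1.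
Proof.
by move=> /GF4P a4 a0; apply: (mulfI a0); rewrite -exprS a4 mulr1.
Qed.

(** * Points *)

Definition cx (Q : point) : Fbar := Q`_0.
Definition cy (Q : point) : Fbar := Q`_1.
Definition cz (Q : point) : Fbar := Q`_2.

Lemma point_ext (Q R : point) : cx Q = cx R -> cy Q = cy R -> cz Q = cz R -> Q = R.
Proof.
case: Q R => -[[|a [|b [|c []]]] // sQ] cQ [[[|a' [|b' [|c' []]]] // sR] cR].
rewrite /cx /cy /cz /= => ea eb ec.
by apply: val_inj; apply: val_inj => /=; rewrite ea eb ec.
Qed.

Lemma cx_x0 : cx x0 = 0. Proof. by []. Qed.
Lemma cy_x0 : cy x0 = 1. Proof. by []. Qed.
Lemma cz_x0 : cz x0 = 0. Proof. by []. Qed.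

Lemma pointE Q :
  [|| cz Q == 1, (cz Q == 0) && (cy Q == 1)
    | [&& cz Q == 0, cy Q == 0 & cx Q == 1]] /\
  cy Q ^+ 2 * cz Q + cy Q * cz Q ^+ 2
    = cx Q ^+ 3 + cx Q * cz Q ^+ 2 + cz Q ^+ 3.
Proof. by have /andP[? /eqP ?] := coordsP Q. Qed.

Lemma affineP Q : Q = x0 \/ cz Q = 1.
Proof.
have [] := pointE Q; case/or3P => [/eqP|/andP[/eqP z0 /eqP y1]|].
- by right.
- rewrite z0 !(expr0n, mulr0, addr0) /= => /esym/eqP; rewrite expf_eq0 /= => /eqP x0'.
  by left; apply: point_ext.
move=> /and3P[/eqP z0 /eqP y0 /eqP x1].
rewrite z0 y0 x1 !(expr0n, mulr0, addr0, expr1n, mul0r) /= => /esym/eqP.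
by rewrite oner_eq0.
Qed.

Lemma curveE Q : cz Q = 1 -> cy Q ^+ 2 + cy Q = cx Q ^+ 3 + cx Q + 1.
Proof. by move=> z1; have [_] := pointE Q; rewrite z1 !expr1n !mulr1. Qed.

Lemma affine_point_exists (a b : Fbar) : b ^+ 2 + b = a ^+ 3 + a + 1 ->
  exists Q, [/\ cx Q = a, cy Q = b & cz Q = 1].
Proof.
move=> ab.
have h : normalized [tuple a; b; 1] && on_curve [tuple a; b; 1].
  by rewrite /normalized /on_curve /= eqxx /= !expr1n !mulr1 ab.
by exists (Point h).
Qed.

Lemma points_over (a : Fbar) : exists Q, cx Q = a /\ cz Q = 1.
Proof.
have /closed_rootP[b] : size ('X^2 + ('X - (a ^+ 3 + a + 1)%:P) : {poly Fbar}) != 1%N.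
  by rewrite size_polyDl size_polyXn // size_XsubC.
rewrite rootE !(hornerD, hornerXn, hornerN, hornerC, hornerX) addrA subr_eq0.
move=> /eqP hb'.
by have [Q [? ? ?]] := affine_point_exists hb'; exists Q.
Qed.

Lemma opposite_exists Q : cz Q = 1 ->
  exists R, [/\ cx R = cx Q, cy R = cy Q + 1 & cz R = 1].
Proof.
move=> zQ; apply: affine_point_exists; rewrite -(curveE zQ).
by apply: (@char2_eq (cy Q + 1)); ring.
Qed.

Lemma tnth0 (Q : point) : tnth Q 0 = cx Q. Proof. by rewrite (tnth_nth 0). Qed.
Lemma tnth1 (Q : point) : tnth Q 1 = cy Q. Proof. by rewrite (tnth_nth 0). Qed.
Lemma tnth2 (Q : point) : tnth Q 2 = cz Q. Proof. by rewrite (tnth_nth 0). Qed.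

Lemma frob_subproof (Q : point) :
  let v := [tuple cx Q ^+ 2; cy Q ^+ 2; cz Q ^+ 2] in normalized v && on_curve v.
Proof.
rewrite /normalized /on_curve /=.
have [->|z1] := affineP Q.
  by rewrite cx_x0 cy_x0 cz_x0 !(expr0n, expr1n) /= !(mulr0, addr0, eqxx) orbT.
have := congr1 (fun a => a ^+ 2) (curveE z1); rewrite /= !sqD expr1n => h.
by rewrite z1 !expr1n eqxx /= !mulr1 h exprAC.
Qed.

(** The closed points of X are the orbits of this map. *)
Definition Frob (Q : point) : point := Point (frob_subproof Q).

Lemma cx_Frob Q : cx (Frob Q) = cx Q ^+ 2. Proof. by []. Qed.
Lemma cy_Frob Q : cy (Frob Q) = cy Q ^+ 2. Proof. by []. Qed.
Lemma cz_Frob Q : cz (Frob Q) = cz Q ^+ 2. Proof. by []. Qed.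

(** * Forms *)

Lemma evE (G : {mpoly Fbar[3]}) Q :
  ev G Q = \sum_(m <- msupp G) G@_m * (cx Q ^+ m 0 * (cy Q ^+ m 1 * cz Q ^+ m 2)).
Proof.
rewrite /ev mevalE; apply: eq_bigr => m _; congr (_ * _).
rewrite !big_ord_recl big_ord0 mulr1 -tnth0 -tnth1 -tnth2.
by congr (_ * (_ * _)); congr (tnth _ _ ^+ m _); apply: val_inj.
Qed.

Lemma mdeg3 (m : 'X_{1..3}) : mdeg m = (m 0%R + (m 1%R + m 2%R))%N.
Proof.
rewrite mdegE !big_ord_recl big_ord0 addn0.
by congr (_ + (_ + _))%N; congr (m _); apply: val_inj.
Qed.

Lemma form_coord r (i : 'I_3) : form r 1 'X_i.
Proof. by split; [rewrite dhomogX; apply/eqP; exact: mdeg1 | exact: mpolyOverX]. Qed.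

Lemma formZ r d G (a : Fbar) : a \in GF2 r -> form r d G -> form r d (a *: G).
Proof.
move=> ar [g1 g2]; split; first exact: rpredZ.
by rewrite -mul_mpolyC; apply: rpredM => //; rewrite mpolyOverC.
Qed.

Lemma form_coef r d G m : form r d G -> G@_m \in GF2 r.
Proof. by move=> [_ /mpolyOverP]. Qed.

Lemma form_mdeg r d G m : form r d G -> m \in msupp G -> (m 0%R + (m 1%R + m 2%R))%N = d.
Proof. by move=> [/dhomogP h _] /h <-; exact/esym/mdeg3. Qed.

Lemma form_sub0 r d G : form r d G -> form 0 d G.
Proof. by move=> [g1 g2]; split=> //; apply: mpolyOverS g2 => a _; apply: GF20. Qed.

Lemma evZ a G Q : ev (a *: G) Q = a * ev G Q.
Proof. exact: mevalZ. Qed.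
Lemma evX0 Q : ev 'X_0 Q = cx Q. Proof. by rewrite /ev mevalXU tnth0. Qed.
Lemma evX1 Q : ev 'X_1 Q = cy Q. Proof. by rewrite /ev mevalXU tnth1. Qed.
Lemma evX2 Q : ev 'X_2 Q = cz Q. Proof. by rewrite /ev mevalXU tnth2. Qed.
Definition evC := (evD, evM, evZ, ev0, ev1, evX0, evX1, evX2).

(** * Weights at infinity *)

Definition dle (n : nat) (p : {poly Fbar}) : Prop := forall i, (n < i)%N -> p`_i = 0.

Lemma dleM n m p q : dle n p -> dle m q ->
  dle (n + m) (p * q) /\ (p * q)`_(n + m) = p`_n * q`_m.
Proof.
move=> hp hq; split=> [i hi|].
  rewrite coefM big1 // => j _; have [nj|jn] := ltnP n j; first by rewrite hp ?mul0r.
  by rewrite [q`__]hq ?mulr0 //; have := ltn_ord j; lia.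
have hn : (n < (n + m).+1)%N by rewrite ltnS leq_addr.
rewrite coefM (bigD1 (Ordinal hn)) //= addKn big1 ?addr0 // => j jn.
have {}jn : j != n :> nat by apply: contra jn => /eqP jn; apply/eqP/val_inj.
have [nj|jn'] := ltnP n j; first by rewrite hp ?mul0r.
by rewrite [q`__]hq ?mulr0 //; have := ltn_ord j; lia.
Qed.

Lemma dleD n p q : dle n p -> dle n q -> dle n (p + q).
Proof. by move=> hp hq i hi; rewrite coefD hp ?hq ?addr0. Qed.

Lemma dleW n m p : (n <= m)%N -> dle n p -> dle m p.
Proof. by move=> nm hp i hi; apply: hp; apply: leq_ltn_trans hi. Qed.

Definition affine_poly (a b : {poly Fbar}) (Q : point) : Fbar :=
  a.[cx Q] + b.[cx Q] * cy Q.

Lemma affine_polyM a b a' b' Q : cz Q = 1 ->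
  affine_poly a b Q * affine_poly a' b' Q =
  affine_poly (a * a' + b * b' * ('X^3 + 'X + 1)) (a * b' + a' * b + b * b') Q.
Proof.
move=> zQ; rewrite /affine_poly !(hornerD, hornerM, hornerXn, hornerX) hornerC.
rewrite -(curveE zQ).
by apply: (@char2_eq (- (b.[cx Q] * b'.[cx Q] * cy Q))); ring.
Qed.

(** The pole at infinity of [a(x) + b(x) y] is that of the polynomial
    [a(u^2) + u^3 b(u^2)], because x and y have poles of orders 2 and 3 there;
    [wt n c F] says that F is of this form on the affine curve, with a pole of
    order at most n whose leading coefficient is c. *)
Definition wt (n : nat) (c : Fbar) (F : point -> Fbar) : Prop :=
  exists a b : {poly Fbar},
  [/\ forall Q, cz Q = 1 -> F Q = affine_poly a b Q,
      dle n (a \Po 'X^2), dle n ('X^3 * (b \Po 'X^2))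
    & c = (a \Po 'X^2)`_n + ('X^3 * (b \Po 'X^2))`_n].

Lemma wt_ext n c F G : (forall Q, cz Q = 1 -> F Q = G Q) -> wt n c F -> wt n c G.
Proof.
by move=> FG [a [b [h ? ? ?]]]; exists a, b; split=> // Q zQ; rewrite -FG // h.
Qed.

Lemma wt_lift n m c F : (n < m)%N -> wt n c F -> wt m 0 F.
Proof.
move=> nm [a [b [h ha hb _]]]; exists a, b; split=> //; try exact: dleW (ltnW nm) _.
by rewrite ha // hb // addr0.
Qed.

Lemma wtD n c d F G : wt n c F -> wt n d G -> wt n (c + d) (fun Q => F Q + G Q).
Proof.
move=> [a [b [h ha hb ->]]] [a' [b' [h' ha' hb' ->]]]; exists (a + a'), (b + b').
rewrite !comp_polyD mulrDr; split; try exact: dleD.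
  by move=> Q zQ; rewrite h // h' // /affine_poly !hornerD; ring.
by rewrite !coefD; ring.
Qed.

Lemma wt_cst c : wt 0 c (fun=> c).
Proof.
exists c%:P, 0; split.
- by move=> Q _; rewrite /affine_poly hornerC horner0 mul0r addr0.
- by move=> i; rewrite comp_polyC coefC; case: i.
- by move=> i _; rewrite comp_poly0 mulr0 coef0.
- by rewrite comp_poly0 mulr0 coef0 addr0 comp_polyC coefC.
Qed.

Lemma wt_x : wt 2 1 cx.
Proof.
exists 'X, 0; rewrite comp_polyX comp_poly0 mulr0; split.
- by move=> Q _; rewrite /affine_poly hornerX horner0 mul0r addr0.
- by move=> i hi; rewrite coefXn gtn_eqF.
- by move=> i _; rewrite coef0.
- by rewrite coefXn coef0 addr0.
Qed.

Lemma wt_y : wt 3 1 cy.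
Proof.
exists 0, 1; rewrite comp_poly0 -polyC1 comp_polyC polyC1 mulr1; split.
- by move=> Q _; rewrite /affine_poly horner0 hornerC mul1r add0r.
- by move=> i _; rewrite coef0.
- by move=> i hi; rewrite coefXn gtn_eqF.
- by rewrite coefXn coef0 add0r.
Qed.

(** When y^2 is rewritten as x^3 + x + 1 + y, only x^3 reaches the top weight.
    *)
Lemma wtM n m c d F G : wt n c F -> wt m d G ->
  wt (n + m) (c * d) (fun Q => F Q * G Q).
Proof.
move=> [a [b [h ha hb ->]]] [a' [b' [h' ha' hb' ->]]].
exists (a * a' + b * b' * ('X^3 + 'X + 1)), (a * b' + a' * b + b * b').
set p := a \Po _ in ha *; set q := b \Po _ in hb *.
set p' := a' \Po _ in ha' *; set q' := b' \Po _ in hb' *.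
have hqq i : (n + m < i + 6)%N -> (q * q')`_i = 0.
  move=> hi; have [/(_ _ hi) + _] := dleM hb hb'.
  have -> : 'X^3 * q * ('X^3 * q') = q * q' * 'X^6 by ring.
  by rewrite coefMXn ltnNge leq_addl /= addnK.
have [hpp epp] := dleM ha ha'; have [hpr epr] := dleM ha hb'.
have [hrp erp] := dleM hb ha'; have [hrr err] := dleM hb hb'.
have e1 : (a * a' + b * b' * ('X^3 + 'X + 1)) \Po 'X^2
    = p * p' + 'X^3 * q * ('X^3 * q') + (q * q' * 'X^2 + q * q').
  have -> : (a * a' + b * b' * ('X^3 + 'X + 1)) \Po 'X^2
      = p * p' + q * q' * (('X^3 + 'X + 1) \Po 'X^2).
    by rewrite comp_polyD !comp_polyM.
  have -> : ('X^3 + 'X + 1 : {poly Fbar}) \Po 'X^2 = 'X^6 + 'X^2 + 1.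
    by rewrite !comp_polyD comp_Xn_poly comp_polyX -polyC1 comp_polyC -exprM.
  by ring.
have e2 : 'X^3 * ((a * b' + a' * b + b * b') \Po 'X^2)
    = p * ('X^3 * q') + 'X^3 * q * p' + q * q' * 'X^3.
  by rewrite !comp_polyD !comp_polyM -/p -/q -/p' -/q'; ring.
have l1 i : (n + m <= i)%N -> (q * q' * 'X^2 + q * q')`_i = 0.
  move=> hi; rewrite coefD coefMXn; case: ltnP => i2; rewrite !hqq ?addr0 //; lia.
have l2 i : (n + m <= i)%N -> (q * q' * 'X^3)`_i = 0.
  by move=> hi; rewrite coefMXn; case: ltnP => // i2; rewrite hqq //; lia.
rewrite e1 e2; split.
- by move=> Q zQ; rewrite h // h' // affine_polyM.
- apply: dleD; first exact: dleD.
  by move=> i hi; apply: l1; apply: ltnW.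
- apply: dleD; first exact: dleD.
  by move=> i hi; apply: l2; apply: ltnW.
rewrite [X in _ = X + _]coefD l1 // [X in _ = _ + X]coefD l2 // !addr0 !coefD.
by rewrite epp epr erp err; ring.
Qed.

(** The monomial X^i Y^j Z^k of degree d has a pole of order 2i + 3j <= 3d, with
    equality only for Y^d, whose coefficient is the value of the form at x0. *)
Lemma wt_form r d G : form r d G -> wt (3 * d) (ev G x0) (ev G).
Proof.
move=> fG; apply: (@wt_ext _ _ (fun Q =>
  \sum_(m <- msupp G) G@_m * (cx Q ^+ m 0 * (cy Q ^+ m 1 * cz Q ^+ m 2)))).
  by move=> Q _; rewrite evE.
rewrite evE; have : {subset msupp G <= msupp G} by [].
elim: {1 3 4}(msupp G) => [|m s IH] hs.
  rewrite big_nil; apply: (@wt_ext _ _ (fun=> 0)) => [Q _|]; first by rewrite big_nil.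
  case: d {fG hs} => [|d]; first exact: wt_cst.
  by apply: wt_lift (wt_cst 0); rewrite mulnS.
have {}IH := IH (fun m' h => hs m' (@mem_behead _ (m :: s) _ h)).
rewrite big_cons; apply: (@wt_ext _ _ (fun Q =>
  G@_m * (cx Q ^+ m 0 * (cy Q ^+ m 1 * cz Q ^+ m 2)) +
  \sum_(m <- s) G@_m * (cx Q ^+ m 0 * (cy Q ^+ m 1 * cz Q ^+ m 2)))).
  by move=> Q _; rewrite big_cons.
apply: wtD IH; have := form_mdeg fG (hs m (mem_head _ _)).
set i := m 0; set j := m 1; set k := m 2; rewrite cx_x0 cy_x0 cz_x0 expr1n mul1r => ijk.
have hpow n c F l : wt n c F -> wt (n * l) (c ^+ l) (fun Q => F Q ^+ l).
  move=> hF; elim: l => [|l IH]; first by rewrite muln0; apply: wt_cst.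
  rewrite mulnS exprS; apply: wt_ext (wtM hF IH) => Q _; by rewrite exprS.
have h1 : wt (2 * i + 3 * j) G@_m (fun Q => G@_m * (cx Q ^+ i * (cy Q ^+ j * cz Q ^+ k))).
  have := wtM (wt_cst G@_m) (wtM (hpow _ _ _ i wt_x) (hpow _ _ _ j wt_y)).
  by rewrite add0n !expr1n !mulr1; apply: wt_ext => Q ->; rewrite expr1n mulr1.
have [/andP[/eqP i0 /eqP k0]|] := boolP ((i == 0%N) && (k == 0%N)).
  rewrite i0 k0 /= !mulr1; move: h1; rewrite i0 k0 in ijk *.
  by rewrite -ijk addn0.
move=> ik; have -> : G@_m * (0 ^+ i * 0 ^+ k) = 0.
  by rewrite !expr0n; case: (i == 0%N) (k == 0%N) ik => -[] //= _; rewrite !(mul0r, mulr0).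
apply: wt_lift h1; lia.
Qed.

(** * Generic points *)

Definition special_form : {mpoly Fbar[3]} := 'X_2 * ('X_0 * ('X_0 + 'X_2)).

(** The complement of the five points rational over the field with four
    elements; they are the zeros on the curve of Z X (X + Z). *)
Definition generic (Q : point) : Prop := ev special_form Q != 0.

Lemma special_formP r : form r (1 + (1 + 1)) special_form.
Proof. by do !apply: formM; try exact: form_coord; apply: formD; exact: form_coord. Qed.

Lemma genericP Q : generic Q <-> [/\ cz Q = 1, cx Q != 0 & cx Q != 1].
Proof.
rewrite /generic /special_form !evC !mulf_eq0 !negb_or.
have [->|z1] := affineP Q; first by rewrite cz_x0 eqxx; split=> // -[/eqP]; rewrite eq_sym oner_eq0.
rewrite z1 oner_eq0 addF_eq0; split; first by case/and3P.
by case=> _ -> ->.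
Qed.

Lemma generic_z Q : generic Q -> cz Q = 1.
Proof. by case/genericP. Qed.

Lemma generic_over (p : {poly Fbar}) : p != 0 ->
  exists c, [/\ c != 0, c != 1 & p.[c] != 0].
Proof.
move=> p0; have /closed_nonrootP[c] : p * ('X * ('X - 1%:P)) != 0.
  by rewrite !mulf_neq0 ?polyX_eq0 ?polyXsubC_eq0.
rewrite rootE !(hornerM, hornerXsubC, hornerX) !mulf_eq0 !negb_or subr_eq0.
by case/and3P; exists c.
Qed.

(** The values at a point and at its opposite, where y becomes y + 1, determine
    a(x) and b(x) separately. *)
Lemma affine_poly_eq0 a b : (forall Q, generic Q -> affine_poly a b Q = 0) ->
  a = 0 /\ b = 0.
Proof.
move=> h.
have hv c : c != 0 -> c != 1 -> a.[c] = 0 /\ b.[c] = 0.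
  move=> c0 c1; have [Q [xQ zQ]] := points_over c.
  have [R [xR yR zR]] := opposite_exists zQ.
  have gQ : generic Q by apply/genericP; rewrite xQ.
  have gR : generic R by apply/genericP; rewrite xR xQ.
  have := h _ gR; have := h _ gQ; rewrite /affine_poly xR xQ yR mulrDr addrA => ->.
  rewrite add0r mulr1 => b0; split=> //.
  by have := h _ gQ; rewrite /affine_poly xQ b0 mul0r addr0.
split; apply/eqP; apply: contraT => /generic_over[c [c0 c1]];
by have [ac bc] := hv c c0 c1; rewrite ?ac ?bc eqxx.
Qed.

Lemma wt_vanish n c F : wt n c F -> (forall Q, generic Q -> F Q = 0) -> c = 0.
Proof.
move=> [a [b [h _ _ ->]]] F0; have [|-> ->] := @affine_poly_eq0 a b.
  by move=> Q gQ; rewrite -h ?F0 //; apply: generic_z.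
by rewrite !comp_poly0 mulr0 !coef0 addr0.
Qed.

(** Every nonempty open set contains a generic point: at infinity because a form
    that does not vanish there has a nonzero leading coefficient. *)
Lemma form_generic r d G Q : form r d G -> ev G Q != 0 ->
  exists R, generic R /\ ev G R != 0.
Proof.
move=> fG GQ; apply: contrapT => h.
have G0 R : generic R -> ev G R = 0.
  by move=> gR; apply/eqP; apply: contraT => GR; case: h; exists R.
have w := wt_form fG; have [Q0|zQ] := affineP Q.
  by move: GQ; rewrite Q0 (wt_vanish w G0) eqxx.
have [a [b [e _ _ _]]] := w.
have [|a0 b0] := @affine_poly_eq0 a b.
  by move=> R gR; rewrite -e ?G0 //; apply: generic_z.
by move: GQ; rewrite e // a0 b0 /affine_poly !horner0 mul0r addr0 eqxx.
Qed.

Lemma near_generic r Q A : near r Q A -> exists R, generic R /\ A R.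
Proof.
move=> [d [G [fG GQ GA]]]; have [R [gR GR]] := form_generic fG GQ.
by exists R; split=> //; apply: GA.
Qed.

(** * Regular functions *)

(** Clearing the denominators also at the points outside the open set where the
    fraction represents f makes the representation global. *)
Lemma regular_char r f Q : regular_at r f Q <->
  exists d A B, [/\ form r d A, form r d B, ev B Q != 0 &
    forall R, f R * ev B R = ev A R].
Proof.
split=> [[d [G [H [fG fH [e [K [fK KQ hK]]]]]]]|[d [A [B [fA fB BQ h]]]]].
  exists (d + e)%N, (G * K), (H * K); split; try exact: formM.
    by rewrite evM mulf_neq0 //; have [] := hK _ KQ.
  move=> R; rewrite !evM; have [->|KR] := eqVneq (ev K R) 0; first by rewrite !mulr0.
  by have [HR ->] := hK R KR; rewrite mulrA divfK.
exists d, A, B; split=> //; exists d, B; split=> // R BR /=; split=> //.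
by rewrite -h mulfK.
Qed.

Lemma near_form r d G Q : form r d G -> ev G Q != 0 -> near r Q [set R | ev G R != 0].
Proof. by move=> fG GQ; exists d, G; split. Qed.

Lemma regular_ext r f g Q : (forall R, f R = g R) -> regular_at r f Q -> regular_at r g Q.
Proof. by move=> fg; apply: regular_near; apply: nearT => R; apply: fg. Qed.

Lemma regular_neq0 r f Q : regular_at r f Q -> f Q != 0 -> near r Q [set R | f R != 0].
Proof.
move=> /regular_char[d [A [B [fA fB BQ h]]]] fQ.
have AQ : ev A Q != 0 by rewrite -h mulf_neq0.
apply: nearS (near_form fA AQ) => R /=; rewrite -h mulf_eq0 negb_or.
by case/andP.
Qed.

Lemma regularV r f Q : regular_at r f Q -> f Q != 0 ->
  regular_at r (fun R => (f R)^-1) Q.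
Proof.
move=> rf fQ; have nf := regular_neq0 rf fQ.
have /regular_char[d [A [B [fA fB BQ h]]]] := rf.
have AQ : ev A Q != 0 by rewrite -h mulf_neq0.
exists d, B, A; split=> //; apply: nearS (nearI nf (near_form fA AQ)) => R [/= fR AR].
split=> //; move: AR; rewrite -h mulf_eq0 negb_or => /andP[_ BR].
by rewrite invfM mulrCA mulfV // mulr1.
Qed.

(** Density: a neighbourhood on which f does not vanish would contain a generic
    point. *)
Lemma regular_zero r f Q : regular_at r f Q ->
  near r Q [set R | generic R -> f R = 0] -> f Q = 0.
Proof.
move=> rf nf; apply/eqP; apply: contraT => fQ.
have [R [gR [/= fR]]] := near_generic (nearI (regular_neq0 rf fQ) nf).
by move=> /(_ gR) f0; rewrite f0 eqxx in fR.
Qed.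

Lemma regular_cst r (a : Fbar) Q : a \in GF2 r -> regular_at r (fun=> a) Q.
Proof.
move=> ar; apply/regular_char; exists 0%N, (a *: 1), 1; split.
- by apply: formZ => //; apply: form1.
- exact: form1.
- by rewrite ev1 oner_eq0.
by move=> R; rewrite !evC.
Qed.

Lemma regularDf r f g Q : regular_at r f Q -> regular_at r g Q ->
  regular_at r (fun R => f R + g R) Q.
Proof. exact: regularD. Qed.
Lemma regularMf r f g Q : regular_at r f Q -> regular_at r g Q ->
  regular_at r (fun R => f R * g R) Q.
Proof. exact: regularM. Qed.

Lemma regularX r f Q n : regular_at r f Q -> regular_at r (fun R => f R ^+ n) Q.
Proof.
move=> rf; elim: n => [|n IH]; first exact: regular_cst (rpred1 _).
by apply: regular_ext (regularMf rf IH) => R; rewrite exprS.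
Qed.

Lemma regularXz r f Q (n : int) : regular_at r f Q -> f Q != 0 ->
  regular_at r (fun R => f R ^ n) Q.
Proof.
move=> rf fQ; case: n => n; first exact: regularX.
rewrite /exprz; apply: regularV; first exact: regularX.
by rewrite expf_neq0.
Qed.

Lemma regular_agree r f g Q : regular_at r f Q -> regular_at r g Q ->
  near r Q [set R | generic R -> f R = g R] -> f Q = g Q.
Proof.
move=> rf rg nfg; apply/eqP; rewrite -addF_eq0; apply/eqP.
apply: (regular_zero (regularDf rf rg)); apply: nearS nfg => R /= h gR.
by rewrite h // addFF.
Qed.

(** ** Affine charts *)

(** Dividing by this coordinate dehomogenizes at Q. *)
Definition chart (Q : point) : point -> Fbar := if cz Q == 1 then cz else cy.
Definition chart_form (Q : point) : {mpoly Fbar[3]} := if cz Q == 1 then 'X_2 else 'X_1.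

Lemma chart_formE Q R : ev (chart_form Q) R = chart Q R.
Proof. by rewrite /chart_form /chart; case: ifP => _; rewrite evC. Qed.
Lemma chart_formP r Q : form r 1 (chart_form Q).
Proof. by rewrite /chart_form; case: ifP => _; apply: form_coord. Qed.
Lemma chart_neq0 Q : chart Q Q != 0.
Proof.
rewrite /chart; have [->|] := eqVneq (cz Q) 1; first exact: oner_neq0.
by have [->|->] := affineP Q; rewrite ?cy_x0 ?oner_eq0 ?eqxx.
Qed.
Lemma near_chart r Q : near r Q [set R | chart Q R != 0].
Proof.
have := @near_form r 1 (chart_form Q) Q (chart_formP r Q).
rewrite chart_formE chart_neq0 => /(_ isT); apply: nearS => R /=.
by rewrite chart_formE.
Qed.

Lemma near_affine r Q : cz Q = 1 -> near r Q [set R | cz R = 1].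
Proof.
move=> zQ; have := near_chart r Q; apply: nearS => R /=.
by rewrite /chart zQ eqxx; have [->|//] := affineP R; rewrite cz_x0 eqxx.
Qed.

Lemma regular_coord r Q (i : 'I_3) :
  regular_at r (fun R => ev 'X_i R / chart Q R) Q.
Proof.
apply/regular_char; exists (1 + 1)%N, ('X_i * chart_form Q), (chart_form Q * chart_form Q).
split; try by apply: formM; rewrite ?form_coord //; apply: chart_formP.
- by apply: formM; [apply: form_coord | apply: chart_formP].
- by rewrite evM chart_formE mulf_neq0 // chart_neq0.
move=> R; rewrite !evM !chart_formE; have [->|c0] := eqVneq (chart Q R) 0.
  by rewrite !mulr0.
by rewrite mulrA divfK.
Qed.

Lemma regular_x r Q : cz Q = 1 -> regular_at r cx Q.
Proof.
move=> zQ; apply: regular_near (regular_coord r Q 0).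
by apply: nearS (near_affine r zQ) => R /= zR; rewrite evX0 /chart zQ eqxx zR divr1.
Qed.

Lemma regular_y r Q : cz Q = 1 -> regular_at r cy Q.
Proof.
move=> zQ; apply: regular_near (regular_coord r Q 1).
by apply: nearS (near_affine r zQ) => R /= zR; rewrite evX1 /chart zQ eqxx zR divr1.
Qed.

Lemma chart_x0 : chart x0 = cy.
Proof. by rewrite /chart cz_x0 eq_sym oner_eq0. Qed.

Lemma regular_xy r : regular_at r (fun R => cx R / cy R) x0.
Proof. by apply: regular_ext (regular_coord r x0 0) => R; rewrite evX0 chart_x0. Qed.
Lemma regular_zy r : regular_at r (fun R => cz R / cy R) x0.
Proof. by apply: regular_ext (regular_coord r x0 2) => R; rewrite evX2 chart_x0. Qed.

(** A property of functions that is stable under sums and products passes from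
    the coordinates to all forms; this is how [loc_divides] reaches every
    regular function. *)
Lemma form_ind r d G L (C : (point -> Fbar) -> Prop) :
  form r d G ->
  (forall f g, (forall R, f R = g R) -> C f -> C g) ->
  (forall a, a \in GF2 r -> C (fun=> a)) ->
  (forall f g, C f -> C g -> C (fun R => f R + g R)) ->
  (forall f g, C f -> C g -> C (fun R => f R * g R)) ->
  C (fun R => cx R / L R) -> C (fun R => cy R / L R) -> C (fun R => cz R / L R) ->
  C (fun R => ev G R / L R ^+ d).
Proof.
move=> fG Ce Cc CD CM Cx Cy Cz.
have CX f n : C f -> C (fun R => f R ^+ n).
  move=> Cf; elim: n => [|n IH]; first exact: Cc (rpred1 _).
  by apply: Ce (CM _ _ Cf IH) => R; rewrite exprS.
have h : {subset msupp G <= msupp G} by [].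
suff hC : C (fun R => (\sum_(m <- msupp G)
    G@_m * (cx R ^+ m 0 * (cy R ^+ m 1 * cz R ^+ m 2))) / L R ^+ d).
  by apply: Ce hC => R; rewrite -evE.
elim: {1 3}(msupp G) h => [|m s IH] h.
  by apply: Ce (Cc 0 (rpred0 _)) => R; rewrite big_nil mul0r.
apply: Ce (CD _ _ (CM _ _ (Cc _ (form_coef m fG)) (CM _ _ (CX _ (m 0) Cx)
   (CM _ _ (CX _ (m 1) Cy) (CX _ (m 2) Cz)))) (IH _)); last first.
  by move=> m' m's; apply: h; rewrite inE m's orbT.
move=> R; rewrite big_cons mulrDl; congr (_ + _).
rewrite -(form_mdeg fG (h m (mem_head _ _))) !expr_div_n !exprD !invfM; ring.
Qed.

(** ** Uniformizers *)

(** A uniformizer at each of the five special points: the vertical line through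
    an affine one is never tangent, since the derivative of y^2 + y with respect
    to y is 1. At a generic point it is 1, so that a condition on the order
    there is one of regularity. *)
Definition loc (Q : point) : point -> Fbar :=
  if `[< generic Q >] then (fun=> 1)
  else if cz Q == 1 then (fun R => cx R - cx Q) else (fun R => cx R / cy R).

Lemma loc_generic Q R : generic Q -> loc Q R = 1.
Proof. by move=> gQ; rewrite /loc asboolT. Qed.
Lemma loc_affine Q R : ~ generic Q -> cz Q = 1 -> loc Q R = cx R + cx Q.
Proof. by move=> gQ zQ; rewrite /loc asboolF // zQ eqxx oppFbar. Qed.
Lemma loc_x0 R : loc x0 R = cx R / cy R.
Proof.
rewrite /loc asboolF ?cz_x0 1?eq_sym ?oner_eq0 //.
by move=> /genericP[/eqP]; rewrite cz_x0 eq_sym oner_eq0.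
Qed.

Lemma gen_x0 : ~ generic x0.
Proof. by move=> /genericP[/eqP]; rewrite cz_x0 eq_sym oner_eq0. Qed.

Lemma special_x Q : ~ generic Q -> cz Q = 1 -> cx Q = 0 \/ cx Q = 1.
Proof.
move=> gQ zQ; have [->|x0'] := eqVneq (cx Q) 0; first by left.
have [->|x1] := eqVneq (cx Q) 1; first by right.
by case: gQ; apply/genericP.
Qed.

Lemma regular_loc r Q : regular_at r (loc Q) Q.
Proof.
have [gQ|gQ] := pselect (generic Q).
  by apply: regular_ext (regular1 r Q) => R; rewrite loc_generic.
have [->|zQ] := affineP Q.
  by apply: regular_ext (regular_xy r) => R; rewrite loc_x0.
apply: regular_ext (regularDf (regular_x r zQ) (@regular_cst r (cx Q) Q _)).
  by move=> R; rewrite loc_affine.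
by case: (special_x gQ zQ) => ->; rewrite ?rpred0 ?rpred1.
Qed.

Lemma loc_self Q : ~ generic Q -> loc Q Q = 0.
Proof.
move=> gQ; have [->|zQ] := affineP Q; first by rewrite loc_x0 cx_x0 mul0r.
by rewrite loc_affine // addFF.
Qed.

Lemma near_loc r Q : near r Q [set R | generic R -> loc Q R != 0].
Proof.
have [gQ|gQ] := pselect (generic Q).
  by apply: nearT => R /=; rewrite loc_generic // oner_eq0.
have [Q0|zQ] := affineP Q.
  apply: nearS (near_chart r Q) => R /=; rewrite Q0 chart_x0 loc_x0 => y0.
  by move=> /genericP[_ x0' _]; rewrite mulf_neq0 // invr_eq0.
apply: nearT => R /= /genericP[_ x0' x1]; rewrite loc_affine // addF_eq0.
by case: (special_x gQ zQ) => ->.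
Qed.

Lemma chart_eq (F : fieldType) (X Y Z : F) : Y != 0 ->
  Z / Y * (1 + Z / Y + X / Y * (Z / Y) + (Z / Y) ^+ 2) * Y ^+ 3 =
  Y ^+ 2 * Z + Y * Z ^+ 2 + X * Z ^+ 2 + Z ^+ 3.
Proof. by move=> Y0; field. Qed.

Lemma cube_eq (F : fieldType) (X Y : F) : Y != 0 ->
  X ^+ 3 = X / Y * (X / Y) ^+ 2 * Y ^+ 3.
Proof. by move=> Y0; field. Qed.

Lemma ev_value r d G Q : cx Q \in GF2 r -> cy Q \in GF2 r -> form r d G ->
  ev G Q \in GF2 r.
Proof.
move=> xr yr fG; have zr : cz Q \in GF2 r.
  by have [->|->] := affineP Q; rewrite ?cz_x0 ?rpred0 ?rpred1.
rewrite evE; apply: rpred_sum => m _; rewrite !rpredM ?rpredX //.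
exact: form_coef fG.
Qed.

Lemma GF2V r (a : Fbar) : a \in GF2 r -> a^-1 \in GF2 r.
Proof. by rewrite !inE exprVn => /eqP ->. Qed.

Lemma regular_value r f Q : cx Q \in GF2 r -> cy Q \in GF2 r ->
  regular_at r f Q -> f Q \in GF2 r.
Proof.
move=> xr yr /regular_char[d [A [B [fA fB BQ h]]]].
have -> : f Q = ev A Q / ev B Q by rewrite -h mulfK.
by rewrite rpredM ?GF2V ?(ev_value xr yr fA) ?(ev_value xr yr fB).
Qed.

(** The functions congruent to their value at Q modulo [loc Q] are stable under
    sums and products, and by the equation of the curve they contain the
    coordinates: it makes y - y(Q) a multiple of x - x(Q), because y - y(Q) - 1
    is a unit, and makes Z/Y a multiple of X/Y at infinity. *)
Lemma loc_divides r Q f : ~ generic Q -> cx Q \in GF2 r -> cy Q \in GF2 r ->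
  regular_at r f Q -> f Q = 0 ->
  exists2 h, regular_at r h Q & near r Q [set R | f R = loc Q R * h R].
Proof.
move=> gQ xr yr /regular_char[d [A [B [fA fB BQ h]]]] f0.
pose C f := regular_at r f Q /\ exists2 h, regular_at r h Q
  & near r Q [set R | f R = f Q + loc Q R * h R].
have rl := regular_loc r Q.
have C_ext f1 f2 : (forall R, f1 R = f2 R) -> C f1 -> C f2.
  by move=> /funext ->.
have C_cst a : a \in GF2 r -> C (fun=> a).
  move=> ar; split; first exact: regular_cst.
  exists (fun=> 0); first exact: regular_cst (rpred0 _).
  by apply: nearT => R; rewrite /= mulr0 addr0.
have C_D f1 f2 : C f1 -> C f2 -> C (fun R => f1 R + f2 R).
  move=> [r1 [h1 rh1 n1]] [r2 [h2 rh2 n2]]; split; first exact: regularDf.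
  exists (fun R => h1 R + h2 R); first exact: regularDf.
  by apply: nearS (nearI n1 n2) => R [/= -> ->]; ring.
have C_M f1 f2 : C f1 -> C f2 -> C (fun R => f1 R * f2 R).
  move=> [r1 [h1 rh1 n1]] [r2 [h2 rh2 n2]]; split; first exact: regularMf.
  exists (fun R => h1 R * f2 R + h2 R * f1 Q).
    apply: regularDf; apply: regularMf => //.
    exact/regular_cst/(regular_value xr yr).
  by apply: nearS (nearI n1 n2) => R [/= -> e2]; rewrite mulrDl {1}e2; ring.
have C_loc g h1 : regular_at r h1 Q -> near r Q [set R | g R = g Q + loc Q R * h1 R] ->
    regular_at r g Q -> C g.
  by move=> rh1 ng rg; split=> //; exists h1.
have r1 : regular_at r (fun=> 1) Q by exact: regular_cst (rpred1 _).
have r0 : regular_at r (fun=> 0) Q by exact: regular_cst (rpred0 _).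
have rC (i : 'I_3) := regular_coord r Q i.
have [Cx Cy Cz] : [/\ C (fun R => cx R / chart Q R), C (fun R => cy R / chart Q R)
    & C (fun R => cz R / chart Q R)].
  have rx := regular_ext (fun R => congr1 (fun a => a / _) (evX0 R)) (rC 0).
  have ry := regular_ext (fun R => congr1 (fun a => a / _) (evX1 R)) (rC 1).
  have rz := regular_ext (fun R => congr1 (fun a => a / _) (evX2 R)) (rC 2).
  have [Q0|zQ] := affineP Q.
    subst Q; rewrite chart_x0 in rx ry rz *; split.
    - apply: (C_loc _ (fun=> 1)) => //; apply: nearT => R /=.
      by rewrite loc_x0 cx_x0 mul0r add0r mulr1.
    - apply: (C_loc _ (fun=> 0)) => //.
      apply: nearS (near_chart r x0) => R /=; rewrite chart_x0 => yR.
      by rewrite cy_x0 divr1 mulr0 addr0 mulfV.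
    have ru : regular_at r (fun R => 1 + cz R / cy R + cx R / cy R * (cz R / cy R)
        + (cz R / cy R) ^+ 2) x0.
      apply: regularDf; last exact: regularX.
      apply: regularDf; last exact: regularMf.
      by apply: regularDf.
    have u0 : 1 + cz x0 / cy x0 + cx x0 / cy x0 * (cz x0 / cy x0)
        + (cz x0 / cy x0) ^+ 2 != 0.
      by rewrite cz_x0 cx_x0 !mul0r expr0n !addr0 oner_neq0.
    have nu := regular_neq0 ru u0.
    apply: (C_loc _ (fun R => (cx R / cy R) ^+ 2 / (1 + cz R / cy R
       + cx R / cy R * (cz R / cy R) + (cz R / cy R) ^+ 2))) => //.
      by apply: regularMf; [exact: regularX | exact: regularV].
    apply: nearS (nearI (near_chart r x0) nu) => R /=; rewrite chart_x0 => -[yR uR].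
    rewrite cz_x0 mul0r add0r loc_x0; apply: (mulIf uR).
    rewrite -[RHS]mulrA divfK //.
    have [_ e] := pointE R; apply: (mulIf (expf_neq0 3 yR)).
    transitivity (cy R ^+ 2 * cz R + cy R * cz R ^+ 2 + cx R * cz R ^+ 2 + cz R ^+ 3).
      by apply: chart_eq.
    rewrite e; transitivity (cx R ^+ 3); last exact: cube_eq.
    by apply: (@char2_eq (cx R * cz R ^+ 2 + cz R ^+ 3)); ring.
  rewrite /chart zQ eqxx in rx ry rz *; split.
  - apply: (C_loc _ (fun=> 1)) => //; apply: nearS (near_affine r zQ) => R /= zR.
    by rewrite loc_affine // zR zQ !divr1 mulr1 addrC -addrA addFF addr0.
  - pose u R := cy R + (cy Q + 1).
    have ru : regular_at r u Q.
      by apply: regularDf; [exact: regular_y | apply: regular_cst; rewrite rpredD ?rpred1].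
    have uQ : u Q != 0 by rewrite /u addrA addFF add0r oner_neq0.
    have rxx := regular_x r zQ.
    apply: (C_loc _ (fun R => (cx R ^+ 2 + cx R * cx Q + (cx Q ^+ 2 + 1)) / u R)) => //.
      apply: regularMf; last exact: regularV.
      apply: regularDf; last by apply: regular_cst; rewrite rpredD ?rpredX ?rpred1.
      by apply: regularDf; [exact: regularX | apply: regularMf => //; exact: regular_cst].
    apply: nearS (nearI (near_affine r zQ) (regular_neq0 ru uQ)) => R /= [zR uR].
    rewrite loc_affine // zR zQ !divr1; apply/eqP; rewrite -subr_eq0 oppFbar; apply/eqP.
    apply: (mulIf uR); rewrite mul0r.
    set n := _ + _ + (_ + 1); transitivity (cy R * u R + cy Q * u R +
      (cx R + cx Q) * (n / u R * u R)); first by ring.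
    rewrite divfK // /u /n.
    move: (curveE zR) (curveE zQ) => e1 e2.
    transitivity ((cy R ^+ 2 + cy R) + (cy Q ^+ 2 + cy Q) +
      (cx R ^+ 3 + cx R + 1) + (cx Q ^+ 3 + cx Q + 1)).
      apply: (@char2_eq (cx R * cx Q * (cx R + cx Q) + cy R * cy Q - 1)); ring.
    by rewrite e1 e2; apply: (@char2_eq (cx R ^+ 3 + cx R + 1 + (cx Q ^+ 3 + cx Q + 1))); ring.
  apply: (C_loc _ (fun=> 0)) => //; apply: nearS (near_affine r zQ) => R /= zR.
  by rewrite zR zQ !divr1 mulr0 addr0.
have [rA [k rk nk]] := form_ind fA C_ext C_cst C_D C_M Cx Cy Cz.
have [rB _] := form_ind fB C_ext C_cst C_D C_M Cx Cy Cz.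
have A0 : ev A Q = 0 by rewrite -h f0 mul0r.
have B0 : ev B Q / chart Q Q ^+ d != 0.
  by rewrite mulf_neq0 // invr_eq0 expf_neq0 // chart_neq0.
exists (fun R => k R / (ev B R / chart Q R ^+ d)).
  by apply: regularMf => //; apply: regularV.
apply: nearS (nearI nk (regular_neq0 rB B0)) => R /= [].
rewrite A0 mul0r add0r => e BR; rewrite mulrA -e -h.
by rewrite -[f R * _ / _]mulrA mulfK.
Qed.

Lemma loc_uniformizer r Q : ~ generic Q -> cx Q \in GF2 r -> cy Q \in GF2 r ->
  uniformizer r Q (loc Q).
Proof.
move=> gQ xr yr; split; [exact: regular_loc | exact: loc_self|].
by move=> f rf f0; apply: loc_divides.
Qed.

(** Two uniformizers divide each other. *)
Lemma uniformizer_unit r Q t : ~ generic Q -> cx Q \in GF2 r -> cy Q \in GF2 r ->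
  uniformizer r Q t ->
  exists k, [/\ regular_at r k Q, k Q != 0 & near r Q [set R | t R = loc Q R * k R]].
Proof.
move=> gQ xr yr [rt t0 ht]; have [_ l0 hl] := loc_uniformizer gQ xr yr.
have [k rk nk] := hl _ rt t0; have [m rm nm] := ht _ (regular_loc r Q) l0.
exists k; split=> //; apply/eqP => k0.
have : k Q * m Q = 1.
  apply: (regular_agree (regularMf rk rm) (regular1 r Q)).
  apply: nearS (nearI (near_loc r Q) (nearI nk nm)) => R [/= hR [e1 e2]] gR.
  by apply: (mulfI (hR gR)); rewrite [RHS]mulr1 mulrA -e1 -e2.
by rewrite k0 mul0r => /eqP; rewrite eq_sym oner_eq0.
Qed.

(** * Galois conjugation *)

(** For a form over F_4 this amounts to conjugating the coefficients
    ([ev_conj]). *)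
Definition conj (f : point -> Fbar) : point -> Fbar := fun Q => sqrt2 (f (Frob Q)).

Lemma conjD f g R : conj (fun Q => f Q + g Q) R = conj f R + conj g R.
Proof. exact: sqrt2D. Qed.
Lemma conjM f g R : conj (fun Q => f Q * g Q) R = conj f R * conj g R.
Proof. exact: sqrt2M. Qed.
Lemma conjV f R : conj (fun Q => (f Q)^-1) R = (conj f R)^-1.
Proof. exact: sqrt2_inv. Qed.
Lemma conj_cx R : conj cx R = cx R. Proof. exact: sqrt2V. Qed.
Lemma conj_cy R : conj cy R = cy R. Proof. exact: sqrt2V. Qed.
Lemma conj_cst a R : a \in GF2 2 -> conj (fun=> a) R = a ^+ 2.
Proof. exact: sqrt2_GF4. Qed.
Lemma conj_eq f g R : (forall Q, f Q = g Q) -> conj f R = conj g R.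
Proof. by move=> fg; rewrite /conj fg. Qed.

Definition conj_form (G : {mpoly Fbar[3]}) : {mpoly Fbar[3]} :=
  map_mpoly (pFrobenius_aut Fbar_pchar2) G.

Lemma conj_formP r d G : form r d G -> form r d (conj_form G).
Proof.
move=> fG; split; last first.
  apply/mpolyOverP => m; rewrite mcoeff_map_mpoly /= GRing.pFrobenius_autE.
  by rewrite rpredX // (form_coef m fG).
apply/dhomogP => m; rewrite (perm_mem (msupp_map_mpoly G (@fmorph_inj _ _ _))).
by case: fG => /dhomogP h _ /h.
Qed.

Lemma ev_conj_sq G Q : ev (conj_form G) (Frob Q) = ev G Q ^+ 2.
Proof.
rewrite [LHS]evE [in RHS]evE -(GRing.pFrobenius_autE Fbar_pchar2) raddf_sum.
rewrite (perm_big _ (msupp_map_mpoly G (@fmorph_inj _ _ _))); apply: eq_bigr => m _.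
rewrite mcoeff_map_mpoly /= !GRing.pFrobenius_autE cx_Frob cy_Frob cz_Frob.
by rewrite ![in RHS]exprMn -!exprM !(mulnC 2%N).
Qed.

Lemma conj_formK r d G : form r d G -> (r = 1 \/ r = 2)%N -> conj_form (conj_form G) = G.
Proof.
move=> fG r12; have fG2 : form 2 d G by case: r12 fG => -> // /form_sub1.
apply/mpolyP => m; rewrite !mcoeff_map_mpoly /= !GRing.pFrobenius_autE -exprM.
exact: GF4P (form_coef m fG2).
Qed.

Lemma conj_form1 d G : form 1 d G -> conj_form G = G.
Proof.
move=> fG; apply/mpolyP => m; rewrite mcoeff_map_mpoly /= GRing.pFrobenius_autE.
by have := form_coef m fG; rewrite inE => /eqP.
Qed.

Lemma ev_conj d G Q : form 2 d G -> ev (conj_form G) Q = sqrt2 (ev G (Frob Q)).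
Proof.
move=> fG; apply: sq_inj; rewrite /= sqrt2K -ev_conj_sq.
by rewrite (conj_formK fG (or_intror (erefl _))).
Qed.

Lemma ev_Frob1 d G Q : form 1 d G -> ev G (Frob Q) = ev G Q ^+ 2.
Proof. by move=> fG; rewrite -ev_conj_sq (conj_form1 fG). Qed.

Lemma ev_Frob2 d G Q : form 2 d G -> ev G (Frob (Frob Q)) = ev G Q ^+ 4.
Proof.
move=> fG; rewrite -[in LHS](conj_formK fG (or_intror (erefl _))) ev_conj_sq.
by rewrite ev_conj_sq -exprM.
Qed.

Lemma near_Frob Q A : near 2 (Frob Q) A -> near 2 Q [set R | A (Frob R)].
Proof.
move=> [d [G [fG GQ GA]]]; exists d, (conj_form G); split; first exact: conj_formP.
  by rewrite (ev_conj _ fG) sqrt2_eq0.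
by move=> R; rewrite (ev_conj _ fG) sqrt2_eq0 => /GA.
Qed.

Lemma open_Frob (U : xopen) Q : oset U (Frob Q) <-> oset U Q.
Proof.
split=> UQ; have [d [G [fG GQ GU]]] := osetP UQ; apply: GU.
  by move: GQ; rewrite (ev_Frob1 _ fG) expf_eq0.
by rewrite (ev_Frob1 _ fG) expf_eq0.
Qed.

Lemma regular_conj f Q : regular_at 2 f (Frob Q) -> regular_at 2 (conj f) Q.
Proof.
move=> /regular_char[d [A [B [fA fB BQ h]]]]; apply/regular_char.
exists d, (conj_form A), (conj_form B); split; try exact: conj_formP.
  by rewrite (ev_conj _ fB) sqrt2_eq0.
by move=> R; rewrite (ev_conj _ fB) (ev_conj _ fA) -h sqrt2M.
Qed.

Lemma conjK f Q : regular_at 2 f Q -> conj (conj f) Q = f Q.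
Proof.
move=> /regular_char[d [A [B [fA fB BQ h]]]].
have e : f (Frob (Frob Q)) = f Q ^+ 4.
  apply: (mulIf (expf_neq0 4 BQ)); rewrite -exprMn h -(ev_Frob2 _ fA) -h.
  by rewrite (ev_Frob2 _ fB).
by apply: sq_inj; apply: sq_inj; rewrite /= !sqrt2K e -exprM.
Qed.

Lemma conj_regular1 f Q : regular_at 1 f Q -> conj f Q = f Q.
Proof.
move=> /regular_char[d [A [B [fA fB BQ h]]]].
apply: sq_inj; rewrite /= sqrt2K; apply: (mulIf (expf_neq0 2 BQ)).
by rewrite -exprMn h -(ev_Frob1 _ fA) -h (ev_Frob1 _ fB).
Qed.

Lemma conj_regfun (U : xopen) (f : regfun U) : conj f = f.
Proof.
apply/funext => Q; have [f0 fr] := regfunP f.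
have [UQ|UQ] := pselect (oset U Q); first exact: conj_regular1 (fr _ UQ).
by rewrite /conj !f0 ?sqrt2_0 //; move=> /open_Frob.
Qed.

Lemma generic_Frob Q : generic (Frob Q) <-> generic Q.
Proof. by rewrite /generic (ev_Frob1 _ (special_formP 1)) expf_eq0. Qed.

Lemma Frob_x0 : Frob x0 = x0.
Proof. by apply: point_ext; rewrite ?cx_Frob ?cy_Frob ?cz_Frob ?cx_x0 ?cy_x0 ?cz_x0 ?(expr0n, expr1n). Qed.

Lemma conj_loc Q R : conj (loc (Frob Q)) R = loc Q R.
Proof.
have [gQ|gQ] := pselect (generic Q).
  by rewrite /conj !loc_generic ?sqrt2_1 //; apply/generic_Frob.
have [->|zQ] := affineP Q.
  by rewrite Frob_x0 /conj !loc_x0 sqrt2M sqrt2_inv !sqrt2V.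
rewrite /conj !loc_affine ?cz_Frob ?zQ ?expr1n // ?sqrt2D ?sqrt2V //.
by move=> /generic_Frob.
Qed.

(** ** Separating the special points *)

Lemma special_y Q : ~ generic Q -> cz Q = 1 -> cy Q ^+ 2 = cy Q + 1.
Proof.
move=> gQ zQ; have := curveE zQ; case: (special_x gQ zQ) => ->.
  by rewrite expr0n !add0r /= => <-; rewrite addrC -addrA addFF addr0.
by rewrite expr1n addFF add0r => <-; rewrite addrC -addrA addFF addr0.
Qed.

Lemma special_rational Q : ~ generic Q -> cx Q \in GF2 2 /\ cy Q \in GF2 2.
Proof.
move=> gQ; have [->|zQ] := affineP Q; first by rewrite cx_x0 cy_x0 rpred0 rpred1.
split; first by case: (special_x gQ zQ) => ->; rewrite ?rpred0 ?rpred1.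
rewrite inE (_ : 2 ^ 2 = 2 * 2)%N // exprM (special_y gQ zQ) sqD (special_y gQ zQ).
by rewrite expr1n -addrA addFF addr0.
Qed.

Lemma Frob_special Q : ~ generic Q -> cz Q = 1 ->
  cx (Frob Q) = cx Q /\ cy (Frob Q) = cy Q + 1.
Proof.
move=> gQ zQ; rewrite cx_Frob cy_Frob special_y //.
by split=> //; case: (special_x gQ zQ) => ->; rewrite ?expr0n ?expr1n.
Qed.

Lemma FrobK_special Q : ~ generic Q -> Frob (Frob Q) = Q.
Proof.
move=> gQ; have [->|zQ] := affineP Q; first by rewrite !Frob_x0.
have [e1 e2] := Frob_special gQ zQ.
have gF : ~ generic (Frob Q) by move=> /generic_Frob.
have zF : cz (Frob Q) = 1 by rewrite cz_Frob zQ expr1n.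
have [e3 e4] := Frob_special gF zF.
apply: point_ext; rewrite ?e3 ?e4 ?e1 ?e2 //; first by rewrite -addrA addFF addr0.
by rewrite cz_Frob zF zQ expr1n.
Qed.

(** The form Y^2 + Y Z + Z^2 over F_2 vanishes at the special points other than
    the origin, since y^2 + y = 1 there. *)
Definition far_form : {mpoly Fbar[3]} := 'X_1 * 'X_1 + 'X_1 * 'X_2 + 'X_2 * 'X_2.
Lemma far_formP r : form r (1 + 1) far_form.
Proof. by do !apply: formD; apply: formM; apply: form_coord. Qed.
Lemma far_formE Q : ev far_form Q = cy Q ^+ 2 + cy Q * cz Q + cz Q ^+ 2.
Proof. by rewrite !evC -!expr2. Qed.
Lemma far_form_x0 : ev far_form x0 != 0.
Proof. by rewrite far_formE cy_x0 cz_x0 mulr0 expr0n expr1n !addr0 oner_neq0. Qed.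
Lemma far_form_special Q : ~ generic Q -> ev far_form Q != 0 -> Q = x0.
Proof.
move=> gQ; have [//|zQ] := affineP Q.
rewrite far_formE zQ special_y // mulr1 expr1n.
rewrite (_ : _ + _ = 0) ?eqxx //; apply: (@char2_eq (cy Q + 1)); ring.
Qed.

(** For Q affine, the form (X + (x(Q) + 1) Z) (Y + (y(Q) + 1) Z) vanishes at the
    other special points. *)
Lemma near_special Q : near 2 Q [set R | generic R \/ R = Q].
Proof.
have [gQ|gQ] := pselect (generic Q).
  by apply: nearS (near_form (special_formP 2) gQ) => R; left.
have [Q0|zQ] := affineP Q.
  rewrite Q0; apply: nearS (near_form (far_formP 2) far_form_x0) => R /= fR.
  by have [gR|gR] := pselect (generic R); [left | right; apply: far_form_special].
have [xr yr] := special_rational gQ.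
pose G : {mpoly Fbar[3]} := ('X_0 + (cx Q + 1) *: 'X_2) * ('X_1 + (cy Q + 1) *: 'X_2).
have fG : form 2 (1 + 1) G.
  by apply: formM; apply: formD; rewrite ?form_coord //;
     [exact: form_coord | apply: formZ; rewrite ?rpredD ?rpred1 //; exact: form_coord
     |exact: form_coord | apply: formZ; rewrite ?rpredD ?rpred1 //; exact: form_coord].
have GE R : ev G R = (cx R + (cx Q + 1) * cz R) * (cy R + (cy Q + 1) * cz R).
  by rewrite !evC.
have GQ : ev G Q != 0.
  rewrite GE zQ !mulr1 (_ : _ * _ = 1) ?oner_neq0 //.
  by rewrite !addKF mulr1.
apply: nearS (near_form fG GQ) => R /=; rewrite GE mulf_eq0 negb_or => /andP[h1 h2].
have [gR|gR] := pselect (generic R); [by left | right].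
have [R0|zR] := affineP R; first by move: h1; rewrite R0 cx_x0 cz_x0 mulr0 addr0 eqxx.
move: h1 h2; rewrite zR !mulr1 !addF_eq0 => h1 h2.
apply: point_ext; last by rewrite zR zQ.
  have e01 : (0 == 1 :> Fbar) = false by rewrite eq_sym oner_eq0.
  by case: (special_x gQ zQ) (special_x gR zR) h1 => -> [] ->; rewrite ?add0r ?addFF ?eqxx ?e01.
have := special_y gR zR; have := special_y gQ zQ => e1 e2.
have : (cy R + cy Q) * (cy R + (cy Q + 1)) = 0.
  transitivity ((cy R ^+ 2 + (cy R + 1)) + (cy Q ^+ 2 + (cy Q + 1))).
    by apply: (@char2_eq (cy R * cy Q - 1)); ring.
  by rewrite e1 e2 !addFF.
by move/eqP; rewrite mulf_eq0 !addF_eq0 (negbTE h2) orbF => /eqP.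
Qed.

(** ** Descent from F_4 to F_2 *)

Lemma formX r d G n : form r d G -> form r (d * n) (G ^+ n).
Proof.
move=> fG; elim: n => [|n IH]; first by rewrite muln0; apply: form1.
by rewrite mulnS exprS; apply: formM.
Qed.

Lemma evX G n Q : ev (G ^+ n) Q = ev G Q ^+ n.
Proof. by elim: n => [|n IH]; rewrite ?ev1 // !exprS evM IH. Qed.

(** If neither denominator is nonzero at both points then their sum is, once
    powers of L have equalized the degrees. *)
Lemma fraction_two r f Q1 Q2 L (C : point -> Prop) :
  form r 1 L -> ev L Q1 != 0 -> ev L Q2 != 0 ->
  (exists d A B, [/\ form r d A, form r d B, ev B Q1 != 0 &
    forall R, C R -> f R * ev B R = ev A R]) ->
  (exists d A B, [/\ form r d A, form r d B, ev B Q2 != 0 &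
    forall R, C R -> f R * ev B R = ev A R]) ->
  exists d A B, [/\ form r d A, form r d B, ev B Q1 != 0, ev B Q2 != 0 &
    forall R, C R -> f R * ev B R = ev A R].
Proof.
move=> fL L1 L2 [d1 [A1 [B1 [fA1 fB1 BQ1 h1]]]].
move=> [d2 [A2 [B2 [fA2 fB2 BQ2 h2]]]].
have fLn n : form r n (L ^+ n) by have := formX n fL; rewrite mul1n.
pose A1' := A1 * L ^+ d2; pose B1' := B1 * L ^+ d2.
pose A2' := L ^+ d1 * A2; pose B2' := L ^+ d1 * B2.
have fA1' : form r (d1 + d2) A1' by apply: formM.
have fB1' : form r (d1 + d2) B1' by apply: formM.
have fA2' : form r (d1 + d2) A2' by apply: formM.
have fB2' : form r (d1 + d2) B2' by apply: formM.
have h1' R : C R -> f R * ev B1' R = ev A1' R by move=> CR; rewrite !evM mulrA h1.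
have h2' R : C R -> f R * ev B2' R = ev A2' R by move=> CR; rewrite !evM mulrCA h2.
have b1 : ev B1' Q1 != 0 by rewrite evM evX mulf_neq0 ?expf_neq0.
have b2 : ev B2' Q2 != 0 by rewrite evM evX mulf_neq0 ?expf_neq0.
have [b12|b12] := eqVneq (ev B1' Q2) 0; last by exists (d1 + d2)%N, A1', B1'.
have [b21|b21] := eqVneq (ev B2' Q1) 0; last by exists (d1 + d2)%N, A2', B2'.
exists (d1 + d2)%N, (A1' + A2'), (B1' + B2'); split; try exact: formD.
- by rewrite evD b21 addr0.
- by rewrite evD b12 add0r.
by move=> R CR; rewrite !evD mulrDr h1' ?h2'.
Qed.

Section Descent.
Variable alpha : Fbar.
Hypotheses (alpha4 : alpha \in GF2 2) (alpha2 : alpha \notin GF2 1).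

Lemma alpha_sq : alpha ^+ 2 = alpha + 1.
Proof. by rewrite -(alphaE alpha4 alpha2) addrCA addFF addr0. Qed.

(** A fraction A/B over F_4, valid at Q and at its conjugate, is rewritten with
    the norm of B as denominator, which is a form over F_2. The new numerator C
    agrees with its conjugate as a function but perhaps not as a form; C + alpha
    (C + conj C) is the same function and is a form over F_2. *)
Lemma regular_descent f Q : (forall R, f (Frob R) = f R ^+ 2) ->
  regular_at 2 f Q -> regular_at 2 f (Frob Q) -> regular_at 1 f Q.
Proof.
move=> fF r1 r2.
have LF : ev (chart_form Q) (Frob Q) != 0.
  by rewrite (ev_Frob1 _ (chart_formP 1 Q)) expf_neq0 // chart_formE chart_neq0.
have LQ : ev (chart_form Q) Q != 0 by rewrite chart_formE chart_neq0.
have all_rep S : regular_at 2 f S -> exists d A B, [/\ form 2 d A, form 2 d B,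
    ev B S != 0 & forall R, True -> f R * ev B R = ev A R].
  by move=> /regular_char[d [A [B [fA fB BS h]]]]; exists d, A, B.
have [d [A [B [fA fB BQ BF h]]]] :=
  fraction_two (chart_formP 2 Q) LQ LF (all_rep _ r1) (all_rep _ r2).
have {}h R := h R I.
pose N := B * conj_form B; pose C := A * conj_form B.
have fN : form 2 (d + d) N by apply: formM => //; apply: conj_formP.
have fC : form 2 (d + d) C by apply: formM => //; apply: conj_formP.
have hN R : f R * ev N R = ev C R by rewrite !evM mulrA h.
have cN : conj_form N = N.
  by rewrite /conj_form rmorphM /= -!/(conj_form _) (conj_formK fB (or_intror (erefl _))) mulrC.
have conjC R : ev (conj_form C) R = ev C R.
  rewrite (ev_conj _ fC) -hN sqrt2M -(ev_conj _ fN) cN fF sqrt2V //.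
pose C0 := C + alpha *: (C + conj_form C).
have C0E R : ev C0 R = ev C R by rewrite /C0 evD evZ [ev (C + _) R]evD conjC addFF mulr0 addr0.
have fC0 : form 2 (d + d) C0.
  by apply: formD => //; apply: formZ => //; apply: formD => //; apply: conj_formP.
have over1 G : form 2 (d + d) G -> conj_form G = G -> form 1 (d + d) G.
  move=> [hG _] cG; split=> //; apply/mpolyOverP => m.
  by rewrite inE expn1 -{2}cG mcoeff_map_mpoly /= GRing.pFrobenius_autE.
apply/regular_char; exists (d + d)%N, C0, N; split.
- apply: over1 => //; apply/mpolyP => m; have := GF4P (form_coef m fC).
  rewrite /C0 mcoeff_map_mpoly /= !mcoeffD mcoeffZ mcoeffD mcoeff_map_mpoly /=.
  rewrite !GRing.pFrobenius_autE; set c := C@_m => c4.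
  rewrite sqD exprMn sqD -exprM c4 alpha_sq.
  by apply: (@char2_eq (c ^+ 2)); ring.
- exact: over1.
- by rewrite evM mulf_neq0 // (ev_conj _ fB) sqrt2_eq0.
by move=> R; rewrite C0E.
Qed.
End Descent.

(** * Orders of rational functions *)

(** A rational function over F_4 is recorded by its values at the generic points;
    [ordge Q n F] says that its order at Q is at least n. *)
Definition ordge (Q : point) (n : int) (F : point -> Fbar) : Prop :=
  exists2 h, regular_at 2 h Q & near 2 Q [set R | generic R -> F R = h R * loc Q R ^ n].

Lemma near_generic_eq r Q (F G : point -> Fbar) : (forall R, generic R -> F R = G R) ->
  near r Q [set R | generic R -> F R = G R].
Proof. by move=> FG; apply: nearT. Qed.

Lemma ordge_near Q n F G : near 2 Q [set R | generic R -> F R = G R] ->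
  ordge Q n F -> ordge Q n G.
Proof.
move=> nFG [h rh nh]; exists h => //.
by apply: nearS (nearI nFG nh) => R /= [e1 e2] gR; rewrite -e1 // e2.
Qed.

Lemma ordge_ext Q n F G : (forall R, generic R -> F R = G R) -> ordge Q n F -> ordge Q n G.
Proof. by move=> FG; apply: ordge_near; apply: near_generic_eq. Qed.

Lemma ordge_regular Q F : regular_at 2 F Q -> ordge Q 0 F.
Proof. by move=> rF; exists F => //; apply: nearT => R _; rewrite expr0z mulr1. Qed.

Lemma ordgeD Q n F G : ordge Q n F -> ordge Q n G -> ordge Q n (fun R => F R + G R).
Proof.
move=> [h rh nh] [k rk nk]; exists (fun R => h R + k R); first exact: regularDf.
by apply: nearS (nearI nh nk) => R /= [e1 e2] gR; rewrite e1 // e2 // mulrDl.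
Qed.

Lemma ordgeM Q n m F G : ordge Q n F -> ordge Q m G ->
  ordge Q (n + m) (fun R => F R * G R).
Proof.
move=> [h rh nh] [k rk nk]; exists (fun R => h R * k R); first exact: regularMf.
apply: nearS (nearI (near_loc 2 Q) (nearI nh nk)) => R /= [l0 [e1 e2]] gR.
by rewrite e1 // e2 // expfzDr ?l0 //; ring.
Qed.

Lemma ordge_loc Q n : ordge Q n (fun R => loc Q R ^ n).
Proof. by exists (fun=> 1); [exact: regular1 | apply: nearT => R _; rewrite mul1r]. Qed.

Lemma ordgeW Q (n m : int) F : (m <= n)%R -> ordge Q n F -> ordge Q m F.
Proof.
move=> mn [h rh nh]; exists (fun R => h R * loc Q R ^ (n - m)).
  have -> : n - m = `|n - m|%N%:Z by rewrite gez0_abs // subr_ge0.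
  by apply: regularMf => //; apply: regularX; apply: regular_loc.
apply: nearS (nearI (near_loc 2 Q) nh) => R /= [l0 e1] gR.
by rewrite e1 // -mulrA -expfzDr ?l0 // subrK.
Qed.

Lemma ordge_conj Q n F : ordge (Frob Q) n F -> ordge Q n (conj F).
Proof.
move=> [h rh nh]; exists (conj h); first exact: regular_conj.
apply: nearS (near_Frob nh) => R /= e gR.
by rewrite /conj e ?sqrt2M ?sqrt2X -/(conj (loc (Frob Q)) R) ?conj_loc //; apply/generic_Frob.
Qed.

Lemma ordge_cst Q a : a \in GF2 2 -> ordge Q 0 (fun=> a).
Proof. by move=> a4; apply: ordge_regular; apply: regular_cst. Qed.

Lemma ordgeZ Q n a F : a \in GF2 2 -> ordge Q n F -> ordge Q n (fun R => a * F R).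
Proof. by move=> a4 oF; rewrite -[n]add0r; apply: ordgeM => //; apply: ordge_cst. Qed.

Lemma ordge0 Q n : ordge Q n (fun=> 0).
Proof.
by exists (fun=> 0); [exact: regular0 | apply: nearT => R _; rewrite mul0r].
Qed.

Lemma ordge_generic Q n F : generic Q -> ordge Q n F -> regular_at 2 F Q.
Proof.
move=> gQ [h rh nh]; apply: regular_near rh.
apply: nearS (nearI (near_form (special_formP 2) gQ) nh) => R /= [gR e].
by rewrite e // loc_generic // exp1rz mulr1.
Qed.

Lemma generic_ordge Q n F : generic Q -> regular_at 2 F Q -> ordge Q n F.
Proof.
by move=> gQ rF; exists F => //; apply: nearT => R _; rewrite loc_generic // exp1rz mulr1.
Qed.

(** ** Leading coefficients *)

(** The value at Q of F / t^n for the uniformizer t = [loc Q]; it does not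
    depend on the chosen h because the generic points are dense ([leadE]). *)
Definition lead (Q : point) (n : int) (F : point -> Fbar) : Fbar :=
  if pselect (ordge Q n F) is left H then projT1 (cid2 H) Q else 0.

Lemma leadE Q n F h : regular_at 2 h Q ->
  near 2 Q [set R | generic R -> F R = h R * loc Q R ^ n] -> lead Q n F = h Q.
Proof.
move=> rh nh; rewrite /lead; case: pselect => [H|]; last by case; exists h.
case: cid2 => k rk nk /=; apply: (regular_agree rk rh).
apply: nearS (nearI (near_loc 2 Q) (nearI nh nk)) => R /= [l0 [e1 e2]] gR.
apply: (mulIf (_ : loc Q R ^ n != 0)); first by rewrite expfz_neq0 ?l0.
by rewrite -e1 // -e2.
Qed.

Lemma lead_near Q n F G : near 2 Q [set R | generic R -> F R = G R] ->
  ordge Q n F -> lead Q n G = lead Q n F.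
Proof.
move=> nFG [h rh nh]; rewrite (leadE rh nh); apply: leadE => //.
by apply: nearS (nearI nFG nh) => R /= [e1 e2] gR; rewrite -e1 // e2.
Qed.

Lemma lead_ext Q n F G : (forall R, generic R -> F R = G R) -> ordge Q n F ->
  lead Q n G = lead Q n F.
Proof. by move=> FG; apply: lead_near; apply: near_generic_eq. Qed.

Lemma lead_regular Q F : regular_at 2 F Q -> lead Q 0 F = F Q.
Proof. by move=> rF; apply: leadE => //; apply: nearT => R _; rewrite expr0z mulr1. Qed.

Lemma leadD Q n F G : ordge Q n F -> ordge Q n G ->
  lead Q n (fun R => F R + G R) = lead Q n F + lead Q n G.
Proof.
move=> [h rh nh] [k rk nk]; rewrite (leadE rh nh) (leadE rk nk).
apply: (leadE (regularDf rh rk)).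
by apply: nearS (nearI nh nk) => R /= [e1 e2] gR; rewrite e1 // e2 // mulrDl.
Qed.

Lemma leadM Q n m F G : ordge Q n F -> ordge Q m G ->
  lead Q (n + m) (fun R => F R * G R) = lead Q n F * lead Q m G.
Proof.
move=> [h rh nh] [k rk nk]; rewrite (leadE rh nh) (leadE rk nk).
apply: (leadE (regularMf rh rk)).
apply: nearS (nearI (near_loc 2 Q) (nearI nh nk)) => R /= [l0 [e1 e2]] gR.
by rewrite e1 // e2 // expfzDr ?l0 //; ring.
Qed.

Lemma leadM0 Q n g F : regular_at 2 g Q -> ordge Q n F ->
  lead Q n (fun R => g R * F R) = g Q * lead Q n F.
Proof.
move=> rg oF; rewrite -(lead_regular rg) -[n in LHS]add0r.
by apply: leadM => //; apply: ordge_regular.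
Qed.

Lemma lead_conj Q n F : ordge (Frob Q) n F ->
  lead Q n (conj F) = sqrt2 (lead (Frob Q) n F).
Proof.
move=> [h rh nh]; rewrite (leadE rh nh) -/(conj h Q).
apply: (leadE (regular_conj rh)); apply: nearS (near_Frob nh) => R /= e gR.
by rewrite /conj e ?sqrt2M ?sqrt2X -/(conj (loc (Frob Q)) R) ?conj_loc //; apply/generic_Frob.
Qed.

Lemma lead_GF4 Q n F : ~ generic Q -> lead Q n F \in GF2 2.
Proof.
move=> gQ; rewrite /lead; case: pselect => [H|_]; last exact: rpred0.
by case: cid2 => h rh _ /=; have [? ?] := special_rational gQ; apply: regular_value rh.
Qed.

(** A regular function that vanishes at Q is a multiple of the uniformizer. *)
Lemma lead_eq0 Q n F : ~ generic Q -> ordge Q n F ->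
  lead Q n F = 0 <-> ordge Q (n + 1) F.
Proof.
move=> gQ [h rh nh]; rewrite (leadE rh nh); split=> [h0|[k rk nk]].
  have [xr yr] := special_rational gQ.
  have [k rk nk] := loc_divides gQ xr yr rh h0; exists k => //.
  apply: nearS (nearI (near_loc 2 Q) (nearI nh nk)) => R /= [l0 [e1 e2]] gR.
  by rewrite e1 // e2 expfzDr ?l0 // expr1z; ring.
transitivity (k Q * loc Q Q); last by rewrite loc_self // mulr0.
apply: (regular_agree rh (regularMf rk (regular_loc 2 Q))).
apply: nearS (nearI (near_loc 2 Q) (nearI nh nk)) => R /= [l0 [e1 e2]] gR.
apply: (mulIf (_ : loc Q R ^ n != 0)); first by rewrite expfz_neq0 ?l0.
by rewrite -e1 // e2 // expfzDr ?l0 // expr1z; ring.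
Qed.

(** ** Exact orders *)

(** Since 0^-1 = 0, the function 0 would have every exact order without the last
    clause. *)
Definition ordis (Q : point) (n : int) (F : point -> Fbar) : Prop :=
  [/\ ordge Q n F, ordge Q (- n) (fun R => (F R)^-1)
    & near 2 Q [set R | generic R -> F R != 0]].

Lemma ordis_neq0 Q n F : generic Q -> ordis Q n F -> F Q != 0.
Proof. by move=> gQ [_ _ /near_point]; apply. Qed.

Lemma ordisM Q n m F G : ordis Q n F -> ordis Q m G ->
  ordis Q (n + m) (fun R => F R * G R).
Proof.
move=> [f1 f2 f3] [g1 g2 g3]; split; first exact: ordgeM.
  rewrite opprD; apply: ordge_ext (ordgeM f2 g2) => R _.
  by rewrite invfM.
by apply: nearS (nearI f3 g3) => R /= [e1 e2] gR; rewrite mulf_neq0 ?e1 ?e2.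
Qed.

Lemma ordisV Q n F : ordis Q n F -> ordis Q (- n) (fun R => (F R)^-1).
Proof.
move=> [f1 f2 f3]; split=> //; first by rewrite opprK; apply: ordge_ext f1 => R _; rewrite invrK.
by apply: nearS f3 => R /= e gR; rewrite invr_eq0 e.
Qed.

Lemma ordis_near Q n F G : near 2 Q [set R | generic R -> F R = G R] ->
  ordis Q n F -> ordis Q n G.
Proof.
move=> FG [f1 f2 f3]; split; first exact: ordge_near f1.
  by apply: ordge_near f2; apply: nearS FG => R /= e gR; rewrite e.
by apply: nearS (nearI FG f3) => R /= [e1 e2] gR; rewrite -e1 ?e2.
Qed.

Lemma ordis_ext Q n F G : (forall R, generic R -> F R = G R) -> ordis Q n F -> ordis Q n G.
Proof. by move=> FG; apply: ordis_near; apply: near_generic_eq. Qed.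

Lemma ordis_unit Q F : regular_at 2 F Q -> F Q != 0 -> ordis Q 0 F.
Proof.
move=> rF FQ; split; rewrite ?oppr0.
- exact: ordge_regular.
- by apply: ordge_regular; apply: regularV.
by apply: nearS (regular_neq0 rF FQ) => R /=.
Qed.

Lemma ordis_loc Q : ordis Q 1 (loc Q).
Proof.
split; first by apply: ordge_ext (ordge_loc Q 1) => R _; rewrite expr1z.
  by apply: ordge_ext (ordge_loc Q (-1)) => R _; rewrite exprN1.
exact: near_loc.
Qed.

Lemma ordis_generic Q n F : generic Q -> regular_at 2 F Q -> F Q != 0 -> ordis Q n F.
Proof.
move=> gQ rF FQ; split.
- exact: generic_ordge.
- by apply: generic_ordge => //; apply: regularV.
by apply: nearS (regular_neq0 rF FQ) => R /=.
Qed.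

Lemma ordis_conj Q n F : ordis (Frob Q) n F -> ordis Q n (conj F).
Proof.
move=> [f1 f2 f3]; split; first exact: ordge_conj.
  by apply: ordge_ext (ordge_conj f2) => R _; rewrite conjV.
by apply: nearS (near_Frob f3) => R /= e gR; rewrite sqrt2_eq0 e //; apply/generic_Frob.
Qed.

Lemma ordis_lead Q n F : ordis Q n F -> lead Q n F != 0.
Proof.
move=> [f1 f2 f3]; apply/eqP => l0.
have : lead Q (n - n) (fun R => F R * (F R)^-1) = 1.
  rewrite subrr; transitivity (lead Q 0 (fun=> 1)).
    apply: lead_near (ordge_cst Q (rpred1 _)).
    by apply: nearS f3 => R /= e gR; rewrite mulfV ?e.
  by rewrite lead_regular //; apply: regular1.
by rewrite leadM // l0 mul0r => /eqP; rewrite eq_sym oner_eq0.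
Qed.

(** * Sheaves *)

Lemma res_irr (E : xsheaf) (U V : xopen) (h1 h2 : V `<=` U) (s : sec E U) :
  res h1 s = res h2 s.
Proof. by rewrite (Prop_irrelevance h1 h2). Qed.

Lemma res0 (E : xsheaf) (U V : xopen) (VU : V `<=` U) : res VU (0 : sec E U) = 0.
Proof. by apply: (addrI (res VU 0)); rewrite -resD !addr0. Qed.

Lemma sec_local (E : xsheaf) (U : xopen) (s t : sec E U) :
  (forall Q, oset U Q -> exists (V : xopen) (VU : V `<=` U), oset V Q /\ res VU s = res VU t) ->
  s = t.
Proof.
move=> h; pose I := {V : xopen | exists VU : V `<=` U, res VU s = res VU t}.
pose W (i : I) := proj1_sig i.
have WU (i : I) : W i `<=` U by case: i => V [].
have e (i : I) : res (WU i) s = res (WU i) t.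
  by case: (proj2_sig i) => VU e; rewrite (res_irr _ VU) e; apply: res_irr.
have cov : U `<=` \bigcup_i W i.
  move=> Q UQ; have [V [VU [VQ eV]]] := h Q UQ.
  by exists (exist _ V (ex_intro _ VU eV)).
have [i j V Vi Vj|r [hr ur]] := @res_glue E U I W WU (fun i => res (WU i) s) cov.
  by rewrite !(res_comp _ _ (subset_trans Vi (WU i))); apply: res_irr.
by rewrite -(ur s) // -(ur t).
Qed.

Section MkLinear.
Variables (A : pzRingType) (M N : lmodType A) (f : M -> N).
Hypotheses (fD : forall s t, f (s + t) = f s + f t)
  (fZ : forall a s, f (a *: s) = a *: f s).

Lemma mk_linear_subproof : linear f.
Proof. by move=> a s t; rewrite fD fZ. Qed.

Definition mk_linear : {linear M -> N} :=
  HB.pack f (GRing.isLinear.Build A M N *:%R f mk_linear_subproof).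

Lemma mk_linearE s : mk_linear s = f s.
Proof. by []. Qed.
End MkLinear.

Section Relation.
Variables (E F : xsheaf) (R : forall V : xopen, sec E V -> sec F V -> Prop).
Hypotheses
  (RD : forall V s t s' t', @R V s t -> @R V s' t' -> @R V (s + s') (t + t'))
  (RZ : forall V a s t, @R V s t -> @R V (a *: s) (a *: t))
  (Rres : forall (U V : xopen) (VU : V `<=` U) s t,
     @R U s t -> @R V (res VU s) (res VU t))
  (Rloc : forall (U : xopen) s t, (forall Q, oset U Q -> exists (V : xopen)
     (VU : V `<=` U), oset V Q /\ @R V (res VU s) (res VU t)) -> @R U s t)
  (Rfun : forall V t, @R V 0 t -> t = 0)
  (Rtot : forall (U : xopen) s Q, oset U Q -> exists (V : xopen)
     (VU : V `<=` U) t, oset V Q /\ @R V (res VU s) t).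

Lemma rel_uniq V s t t' : @R V s t -> @R V s t' -> t = t'.
Proof.
move=> h h'; apply/eqP; rewrite -subr_eq0; apply/eqP/Rfun.
by rewrite -(subrr s) -!scaleN1r; apply: RD => //; apply: RZ.
Qed.

Lemma rel_exists U s : exists t, @R U s t.
Proof.
pose I := {W : xopen & {t : sec F W | exists WU : W `<=` U, @R W (res WU s) t}}.
pose W (i : I) := projT1 i.
have WU (i : I) : W i `<=` U by case: i => V [t []].
pose ti (i : I) : sec F (W i) := proj1_sig (projT2 i).
have Rti i : @R (W i) (res (WU i) s) (ti i).
  rewrite /ti; case: (projT2 i) => t [WU' Rt] /=; by rewrite (res_irr _ WU').
have cov : U `<=` \bigcup_i W i.
  move=> Q UQ; have [V [VU [t [VQ Rt]]]] := Rtot s UQ.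
  by exists (existT _ V (exist _ t (ex_intro _ VU Rt))).
have [i j V Vi Vj|t [ht _]] := @res_glue F U I W WU ti cov.
  apply: (@rel_uniq _ (res (subset_trans Vi (WU i)) s)).
    by rewrite -(res_comp (WU i) Vi); apply: Rres.
  rewrite (res_irr _ (subset_trans Vj (WU j))) -(res_comp (WU j) Vj).
  exact: Rres.
exists t; apply: Rloc => Q UQ; have [i _ iQ] := cov Q UQ.
by exists (W i), (WU i); split=> //; rewrite ht.
Qed.

(** Solutions of the relation are unique, so the local ones glue. A morphism is
    constructed by naming the relation between a section and its image, with no
    choice of local data. *)
Lemma rel_hom : exists u : hom E F, forall V s, @R V s (u V s).
Proof.
pose f V s := projT1 (cid (rel_exists (U := V) s)).
have Rf V s : @R V s (f V s) by apply: (projT2 (cid (rel_exists (U := V) s))).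
have fD V s t : f V (s + t) = f V s + f V t.
  exact: (@rel_uniq V (s + t) _ _ (Rf V _) (RD (Rf V s) (Rf V t))).
have fZ V a s : f V (a *: s) = a *: f V s.
  exact: (@rel_uniq V (a *: s) _ _ (Rf V _) (RZ a (Rf V s))).
pose u V := mk_linear (fD V) (fZ V).
have ur (U V : xopen) (VU : V `<=` U) s : u V (res VU s) = res VU (u U s).
  rewrite !mk_linearE; exact: (@rel_uniq V (res VU s) _ _ (Rf V _) (Rres VU (Rf U s))).
by exists (@Hom E F u ur).
Qed.
End Relation.

Lemma rel_iso (E F : xsheaf) (R : forall V : xopen, sec E V -> sec F V -> Prop) :
  (forall V s t s' t', @R V s t -> @R V s' t' -> @R V (s + s') (t + t')) ->
  (forall V a s t, @R V s t -> @R V (a *: s) (a *: t)) ->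
  (forall (U V : xopen) (VU : V `<=` U) s t, @R U s t -> @R V (res VU s) (res VU t)) ->
  (forall (U : xopen) s t, (forall Q, oset U Q -> exists (V : xopen)
     (VU : V `<=` U), oset V Q /\ @R V (res VU s) (res VU t)) -> @R U s t) ->
  (forall V t, @R V 0 t -> t = 0) -> (forall V s, @R V s 0 -> s = 0) ->
  (forall (U : xopen) s Q, oset U Q -> exists (V : xopen)
     (VU : V `<=` U) t, oset V Q /\ @R V (res VU s) t) ->
  (forall (U : xopen) t Q, oset U Q -> exists (V : xopen)
     (VU : V `<=` U) s, oset V Q /\ @R V s (res VU t)) ->
  exists2 u : hom E F, is_iso u & forall V s, @R V s (u V s).
Proof.
move=> RD RZ Rres Rloc Rfun Rinj Rtot Rsur.
have [u Ru] := rel_hom RD RZ Rres Rloc Rfun Rtot.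
have RD' V s t s' t' : @R V t s -> @R V t' s' -> @R V (t + t') (s + s') by apply: RD.
have RZ' V a s t : @R V t s -> @R V (a *: t) (a *: s) by apply: RZ.
have [v Rv] := @rel_hom F E (fun V t s => @R V s t) (fun V s t s' t' => @RD' V s t s' t')
  (fun V a s t => @RZ' V a s t)
  (fun U V VU s t => @Rres U V VU t s) (fun U s t => @Rloc U t s) Rinj Rsur.
exists u => //; exists v => V; split=> s.
  exact: (rel_uniq (R := fun V t s => @R V s t) (fun V s t s' t' => @RD' V s t s' t')
     (fun V a s t => @RZ' V a s t) Rinj (Rv _ _) (Ru _ _)).
exact: (rel_uniq RD RZ Rfun (Ru _ _) (Rv _ _)).
Qed.

(** ** Composition of morphisms *)

Definition hom_id (E : xsheaf) : hom E E :=
  @Hom E E (fun U => mk_linear (f := fun s : sec E U => s) (fun _ _ => erefl)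
     (fun _ _ => erefl)) (fun _ _ _ _ => erefl).

Section Composition.
Variables (E F G : xsheaf) (v : hom F G) (u : hom E F).

Lemma hom_compD U (s t : sec E U) : v U (u U (s + t)) = v U (u U s) + v U (u U t).
Proof. by rewrite !linearD. Qed.
Lemma hom_compZ U a (s : sec E U) : v U (u U (a *: s)) = a *: v U (u U s).
Proof. by rewrite !linearZ. Qed.
Lemma hom_comp_res (U V : xopen) (VU : V `<=` U) (s : sec E U) :
  v V (u V (res VU s)) = res VU (v U (u U s)).
Proof. by rewrite !hom_res. Qed.

Definition hom_comp : hom E G :=
  @Hom E G (fun U => mk_linear (@hom_compD U) (@hom_compZ U)) hom_comp_res.
End Composition.

Lemma hom_compE E F G (v : hom F G) (u : hom E F) U s :
  hom_comp v u U s = v U (u U s).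
Proof. by []. Qed.

Lemma is_iso_inv E F (u : hom E F) (v : hom F E) :
  (forall U, cancel (u U) (v U) /\ cancel (v U) (u U)) -> is_iso v.
Proof. by move=> h; exists u => U; have [] := h U. Qed.

Lemma is_iso_comp E F G (v : hom F G) (u : hom E F) :
  is_iso u -> is_iso v -> is_iso (hom_comp v u).
Proof.
move=> [u' hu] [v' hv]; exists (hom_comp u' v') => U.
have [h1 h2] := hu U; have [h3 h4] := hv U.
by split=> s; rewrite !hom_compE; [rewrite h3 h1 | rewrite h2 h4].
Qed.

Lemma isomorphic_sym E F : isomorphic E F -> isomorphic F E.
Proof. by move=> [u [v h]]; exists v; apply: is_iso_inv h. Qed.

Lemma isomorphic_trans E F G : isomorphic E F -> isomorphic F G -> isomorphic E G.
Proof. by move=> [u hu] [v hv]; exists (hom_comp v u); apply: is_iso_comp. Qed.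

Lemma isomorphic_refl E : isomorphic E E.
Proof. by exists (hom_id E), (hom_id E). Qed.

Lemma iso_inj E F (u : hom E F) U : is_iso u -> injective (u U).
Proof. by move=> [v h]; have [c _] := h U; apply: can_inj c. Qed.

(** * Sections of divisor sheaves *)

Definition fv r D (U : xopen) (s : sec (push_O r D) U) : point -> Fbar :=
  divval (s : divsec r D U).

Lemma fvD r D U (s t : sec (push_O r D) U) R : fv (s + t) R = fv s R + fv t R.
Proof. by []. Qed.
Lemma fvZ r D (U : xopen) (a : regfun U) (s : sec (push_O r D) U) R : fv (a *: s) R = a R * fv s R.
Proof. by []. Qed.
Lemma fv0 r D U R : fv (0 : sec (push_O r D) U) R = 0.
Proof. by []. Qed.
Lemma fv_res r D (U V : xopen) (VU : V `<=` U) (s : sec (push_O r D) U) R :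
  oset V R -> fv (res VU s) R = fv s R.
Proof. exact: (divresE VU (s : div_sec r D U)). Qed.
Lemma fv_out r D U (s : sec (push_O r D) U) R : ~ oset U R \/ D R <> 0 -> fv s R = 0.
Proof. by case: (divsecP (s : divsec r D U)) => h _ _ /h. Qed.

Lemma gen_zopen : zopen 1 generic.
Proof. by move=> Q gQ; apply: nearS (near_form (special_formP 1) gQ) => R. Qed.
Definition gen_open : xopen := XOpen gen_zopen.

Lemma form_zopen d G : form 1 d G -> zopen 1 (fun Q => ev G Q != 0).
Proof. by move=> fG Q GQ; apply: nearS (near_form fG GQ). Qed.
Definition form_open d G (fG : form 1 d G) : xopen := XOpen (form_zopen fG).

Lemma fv_ext r D U (s t : sec (push_O r D) U) :
  (forall R, generic R -> oset U R -> fv s R = fv t R) -> s = t.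
Proof.
move=> h; apply: divsec_eq => Q; have [UQ|UQ] := pselect (oset U Q); last first.
  by rewrite -[LHS]/(fv s Q) -[RHS]/(fv t Q) !fv_out //; left.
have [D0|/eqP D0] := eqVneq (D Q) 0; last first.
  by rewrite -[LHS]/(fv s Q) -[RHS]/(fv t Q) !fv_out //; right.
have [_ rs _] := divsecP (s : divsec r D U).
have [_ rt _] := divsecP (t : divsec r D U).
apply: (regular_agree (rs Q UQ D0) (rt Q UQ D0)).
by apply: nearS (xopen_near r UQ) => R /= UR gR; apply: h.
Qed.

Definition special_div (D : point -> int) := forall Q, generic Q -> D Q = 0.

Section SpecialDivisor.
Variable D : point -> int.
Hypothesis spD : special_div D.

Lemma special_supp Q : D Q <> 0 -> ~ generic Q.
Proof. by move=> DQ /spD. Qed.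

Lemma fv_ordge U (s : sec (push_O 2 D) U) Q : oset U Q -> ordge Q (- D Q) (fv s).
Proof.
move=> UQ; have [_ rs ds] := divsecP (s : divsec 2 D U).
have [D0|/eqP D0] := eqVneq (D Q) 0.
  by rewrite D0 oppr0; apply: ordge_regular; apply: rs.
have gQ := special_supp D0; have [xr yr] := special_rational gQ.
have [h rh nh] := ds Q UQ D0 _ (loc_uniformizer gQ xr yr).
exists h => //; apply: nearS (nearI (near_loc 2 Q) nh) => R /= [l0 e] gR.
by rewrite -(e (spD gR)) -mulrA -expfzDr ?l0 // addrN expr0z mulr1.
Qed.

Lemma fv_regular U (s : sec (push_O 2 D) U) Q : oset U Q -> generic Q ->
  regular_at 2 (fv s) Q.
Proof. by move=> UQ gQ; apply: ordge_generic (fv_ordge s UQ). Qed.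

(** At a special point off the support of D, the value of the section is the
    leading coefficient of the rational function F. *)
Lemma fv_make (U : xopen) F : (forall Q, oset U Q -> ordge Q (- D Q) F) ->
  exists s : sec (push_O 2 D) U, forall R, generic R -> oset U R -> fv s R = F R.
Proof.
move=> oF; pose f Q := if `[< oset U Q /\ D Q = 0 >] then
  (if `[< generic Q >] then F Q else lead Q 0 F) else 0.
have fg R : generic R -> oset U R -> f R = F R.
  by move=> gR UR; rewrite /f !asboolT // spD.
suff df : `[< divisor_on 2 D U f >] by exists (DivSec df).
apply/asboolP; split=> [Q h|Q UQ D0|Q UQ D0 t ut].
- by rewrite /f asboolF // => -[UQ D0]; case: h.
- have := oF Q UQ; rewrite D0 oppr0 => -[h rh nh].
  apply: (regular_near _ rh); apply: nearS (nearI (xopen_near 2 UQ) (nearI (near_special Q) nh)).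
  move=> R /= [UR [[gR|->] e]]; first by rewrite fg // e // expr0z mulr1.
  rewrite /f asboolT //; case: asboolP => gQ; last by rewrite (leadE rh nh).
  by have := near_point nh gQ; rewrite expr0z mulr1.
have gQ := special_supp D0; have [xr yr] := special_rational gQ.
have [k [rk k0 nk]] := uniformizer_unit gQ xr yr ut.
have [h rh nh] := oF Q UQ.
exists (fun R => h R * k R ^ D Q); first by apply: regularMf => //; apply: regularXz.
apply: nearS (nearI (nearI (near_loc 2 Q) (nearI nk nh)) (nearI (xopen_near 2 UQ) (near_special Q))).
move=> R /= [[l0 [et eF]] [UR [gR|->]]] DR; last by case: D0.
rewrite fg // eF // et -mulrA; congr (_ * _).
by rewrite expfzMl mulrA -expfzDr ?l0 // addNr expr0z mul1r.
Qed.
End SpecialDivisor.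

Lemma special_div0 : special_div (fun=> 0).
Proof. by []. Qed.

Section Split.
Variable alpha : Fbar.
Hypotheses (alpha4 : alpha \in GF2 2) (alpha2 : alpha \notin GF2 1).

(** The components a0 = (alpha + 1) F + alpha conj F and a1 = F + conj F are
    fixed by conjugation, hence regular over F_2 by descent. *)
Lemma split_regular (U : xopen) F : (forall Q, oset U Q -> ordge Q 0 F) ->
  exists a0 a1 : regfun U, forall R, generic R -> oset U R ->
    F R = a0 R + a1 R * alpha /\ conj F R = a0 R + a1 R * (alpha + 1).
Proof.
move=> oF; have [s sF] := @fv_make _ special_div0 U F oF.
have [_ rs _] := divsecP (s : divsec 2 (fun=> 0) U).
pose f := fv s; have f0 Q : ~ oset U Q -> f Q = 0 by move=> UQ; apply: fv_out; left.
have rf Q : oset U Q -> regular_at 2 f Q by move=> UQ; apply: rs.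
have cK Q : conj (conj f) Q = f Q.
  have [UQ|UQ] := pselect (oset U Q); first exact: conjK (rf _ UQ).
  by rewrite /conj f0 ?sqrt2_0 ?f0 // => /open_Frob/open_Frob.
have rc Q : oset U Q -> regular_at 2 (conj f) Q.
  by move=> UQ; apply: regular_conj; apply: rf; apply/open_Frob.
have cinv g Q : conj g Q = g Q -> g (Frob Q) = g Q ^+ 2.
  by move=> <-; rewrite /conj sqrt2K.
pose g0 R := (alpha + 1) * f R + alpha * conj f R; pose g1 R := f R + conj f R.
have a4 : alpha + 1 \in GF2 2 by rewrite rpredD ?rpred1.
have as2 := alpha_sq alpha4 alpha2.
have as2' : (alpha + 1) ^+ 2 = alpha by rewrite sqD as2 expr1n -addrA addFF addr0.
have h0 : `[< regular_on U g0 >].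
  have r0 Q : oset U Q -> regular_at 2 g0 Q.
    by move=> UQ; apply: regularDf; apply: regularMf; rewrite ?rf ?rc //;
       solve [exact: regular_cst | exact: rf | exact: rc].
  apply/asboolP; split=> Q UQ; last first.
    apply: (regular_descent alpha4 alpha2); [|exact: r0|by apply: r0; apply/open_Frob].
    move=> R; apply: cinv; rewrite conjD !conjM !conj_cst // cK as2 as2'.
    by rewrite addrC.
  by rewrite /g0 /conj !f0 ?sqrt2_0 ?mulr0 ?addr0 // => /open_Frob.
have h1 : `[< regular_on U g1 >].
  have r1 Q : oset U Q -> regular_at 2 g1 Q.
    by move=> UQ; apply: regularDf; [apply: rf | apply: rc].
  apply/asboolP; split=> Q UQ; last first.
    apply: (regular_descent alpha4 alpha2); [|exact: r1|by apply: r1; apply/open_Frob].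
    by move=> R; apply: cinv; rewrite conjD cK addrC.
  by rewrite /g1 /conj !f0 ?sqrt2_0 ?addr0 // => /open_Frob.
exists (RegFun h0), (RegFun h1) => R gR UR.
have -> : conj F R = conj f R.
  by rewrite /conj /f sF //; [apply/generic_Frob | apply/open_Frob].
rewrite -(sF R gR UR) -/f /= /g0 /g1; split.
  by apply: (@char2_eq (- (alpha * (f R + conj f R)))); ring.
by apply: (@char2_eq (- (alpha * (f R + conj f R)) - f R)); ring.
Qed.

Lemma regfun_eq0 (U : xopen) (a : regfun U) :
  (forall R, generic R -> oset U R -> a R = 0) -> a = 0.
Proof.
move=> h; apply: regfun_eq => Q; have [a0 ra] := regfunP a.
have [UQ|UQ] := pselect (oset U Q); last by rewrite a0.
apply: (regular_zero (ra Q UQ)).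
by apply: nearS (xopen_near 1 UQ) => R UR gR; apply: h.
Qed.

(** Conjugating the relation replaces alpha by alpha + 1. *)
Lemma regfun_indep (U : xopen) (a b : regfun U) :
  (forall R, generic R -> oset U R -> a R + b R * alpha = 0) -> a = 0 /\ b = 0.
Proof.
move=> h; have h2 R : generic R -> oset U R -> a R = 0 /\ b R = 0.
  move=> gR UR; have e := h R gR UR.
  have e' : a R + b R * (alpha + 1) = 0.
    rewrite -(conj_regfun a) -(conj_regfun b) -(alpha_sq alpha4 alpha2).
    rewrite -(conj_cst R alpha4) -conjM -conjD /conj h ?sqrt2_0 //.
      exact/generic_Frob.
    exact/open_Frob.
  have b0 : b R = 0.
    by move: e'; rewrite mulrDr addrA e add0r mulr1.
  by move: e; rewrite b0 mul0r addr0.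
by split; apply: regfun_eq0 => R gR UR; have [] := h2 R gR UR.
Qed.
End Split.

(** * Morphisms between divisor sheaves *)

(** Over X, a morphism between sheaves pushed forward from X_2 need not be linear
    over F_4: it has a linear part u and a part v twisted by conjugation. *)
Definition tw (u v f : point -> Fbar) : point -> Fbar :=
  fun R => u R * f R + v R * conj f R.

Lemma tw_ordge D U (s : sec (push_O 2 D) U) Q n u v : special_div D -> oset U Q ->
  ordge Q (D Q + n) u -> ordge Q (D (Frob Q) + n) v -> ordge Q n (tw u v (fv s)).
Proof.
move=> spD UQ ou ov; apply: ordgeD.
  have -> : n = (D Q + n) - D Q by rewrite addrC addKr.
  by apply: ordgeM => //; apply: fv_ordge.
have -> : n = (D (Frob Q) + n) - D (Frob Q) by rewrite addrC addKr.
by apply: ordgeM => //; apply: ordge_conj; apply: fv_ordge => //; apply/open_Frob.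
Qed.

Lemma tw_on (U : xopen) u v f g R : generic R -> oset U R ->
  (forall R, generic R -> oset U R -> f R = g R) -> tw u v f R = tw u v g R.
Proof.
move=> gR UR fg; rewrite /tw /conj !fg //; first exact/generic_Frob.
exact/open_Frob.
Qed.

Lemma tw_regfun (U : xopen) (a : regfun U) u v f R :
  tw u v (fun R => a R * f R) R = a R * tw u v f R.
Proof. by rewrite /tw conjM conj_regfun; ring. Qed.

Lemma twD u v f g R : tw u v (fun R => f R + g R) R = tw u v f R + tw u v g R.
Proof. by rewrite /tw conjD; ring. Qed.

Lemma twist_hom D D' u v : special_div D -> special_div D' ->
  (forall Q, ordge Q (D Q - D' Q) u) -> (forall Q, ordge Q (D (Frob Q) - D' Q) v) ->
  exists phi : hom (push_O 2 D) (push_O 2 D'), forall U (s : sec (push_O 2 D) U) R,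
    generic R -> oset U R -> fv (phi U s) R = tw u v (fv s) R.
Proof.
move=> spD spD' ou ov.
pose S V (s : sec (push_O 2 D) V) (t : sec (push_O 2 D') V) :=
  forall R, generic R -> oset V R -> fv t R = tw u v (fv s) R.
have [||||||phi hphi] := @rel_hom _ _ S; last by exists phi.
- move=> V s t s' t' h h' R gR VR; rewrite fvD h // h' //.
  by rewrite -twD.
- by move=> V a s t h R gR VR; rewrite fvZ h // -tw_regfun.
- move=> U V VU s t h R gR VR; rewrite fv_res // h //; last exact: VU.
  by apply: (tw_on _ _ gR VR) => Q gQ VQ; rewrite fv_res.
- move=> U s t h R gR UR; have [V [VU [VR hV]]] := h R UR.
  have := hV R gR VR; rewrite fv_res // => ->.
  by apply: (tw_on _ _ gR VR) => Q gQ VQ; rewrite fv_res.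
- move=> V t h; apply: fv_ext => R gR VR; rewrite h // fv0.
  by rewrite /tw /conj fv0 sqrt2_0 !mulr0 addr0.
move=> U s Q UQ; have [R UR|t ht] := @fv_make D' spD' U (tw u v (fv s)).
  by apply: tw_ordge.
exists U, (@subset_refl _ _), t; split=> // R gR UR; rewrite ht //.
by apply: (tw_on _ _ gR UR) => P gP UP; rewrite fv_res.
Qed.

(** Local generators of the divisor sheaf of D. *)
Definition gens (D : point -> int) := forall Q, exists (U : xopen) g,
  oset U Q /\ forall R, oset U R -> ordis R (- D R) g.

Section Alpha.
Variable alpha : Fbar.
Hypotheses (alpha4 : alpha \in GF2 2) (alpha2 : alpha \notin GF2 1).

(** Over the generic points every section is a0 + alpha a1 with a0 and a1
    functions on X, so phi is determined by the images of 1 and alpha; u and v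
    solve u + v = phi(1) and alpha u + (alpha + 1) v = phi(alpha). *)
Lemma hom_twist D D' (phi : hom (push_O 2 D) (push_O 2 D')) :
  special_div D -> special_div D' ->
  exists u v, forall U (s : sec (push_O 2 D) U) R,
    generic R -> oset U R -> fv (phi U s) R = tw u v (fv s) R.
Proof.
move=> spD spD'.
have cst_ok a : a \in GF2 2 -> forall Q, oset gen_open Q -> ordge Q (- D Q) (fun=> a).
  by move=> a4 Q gQ; rewrite spD // oppr0; apply: ordge_cst.
have [s1 h1] := @fv_make D spD gen_open _ (cst_ok 1 (rpred1 _)).
have [sa ha] := @fv_make D spD gen_open _ (cst_ok alpha alpha4).
pose G1 := fv (phi gen_open s1); pose Ga := fv (phi gen_open sa).
exists (fun R => (alpha + 1) * G1 R + Ga R), (fun R => alpha * G1 R + Ga R).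
move=> U s R gR UR; pose V := meet U gen_open.
have VU : V `<=` U by move=> Q [].
have VG : V `<=` gen_open by move=> Q [].
have VR : oset V R by split.
have [|a0 [a1 ha01]] := @split_regular alpha alpha4 alpha2 V (fv s).
  by move=> Q [UQ gQ]; rewrite -oppr0 -(spD Q gQ); apply: fv_ordge.
have es : res VU s = a0 *: res VG s1 + a1 *: res VG sa.
  apply: fv_ext => Q gQ VQ; rewrite fvD !fvZ !fv_res // h1 // ha // mulr1.
  by have [] := ha01 Q gQ VQ.
have -> : fv (phi U s) R = a0 R * G1 R + a1 R * Ga R.
  rewrite -(fv_res VU) // -hom_res es linearD !linearZ fvD !fvZ.
  by rewrite !hom_res !fv_res.
have [e1 e2] := ha01 R gR VR; rewrite /tw e1 e2.
apply: (@char2_eq (- (a0 R * (alpha * G1 R + Ga R)) - a1 R * (alpha * Ga R)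
   - a1 R * (alpha ^+ 2 * G1 R + alpha * G1 R))); ring.
Qed.

(** The images of g and alpha g, for a generator g near Q, have combinations
    equal to u g and to v conj g. *)
Lemma twist_bound D D' (phi : hom (push_O 2 D) (push_O 2 D')) u v :
  special_div D -> special_div D' -> gens D ->
  (forall U (s : sec (push_O 2 D) U) R,
    generic R -> oset U R -> fv (phi U s) R = tw u v (fv s) R) ->
  forall Q, ordge Q (D Q - D' Q) u /\ ordge Q (D (Frob Q) - D' Q) v.
Proof.
move=> spD spD' gD hphi Q; have [U [g [UQ hg]]] := gD Q.
have UF : oset U (Frob Q) by apply/open_Frob.
have og c : c \in GF2 2 -> forall R, oset U R -> ordge R (- D R) (fun S => c * g S).
  by move=> c4 R UR; apply: ordgeZ => //; have [] := hg R UR.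
have [s1 h1] := @fv_make D spD U _ (og 1 (rpred1 _)).
have [sa ha] := @fv_make D spD U _ (og alpha alpha4).
have o1 := fv_ordge spD' (phi U s1) UQ; have oa := fv_ordge spD' (phi U sa) UQ.
have a14 : alpha + 1 \in GF2 2 by rewrite rpredD ?rpred1.
have e1 R : generic R -> oset U R -> fv (phi U s1) R = u R * g R + v R * conj g R.
  move=> gR UR; rewrite hphi // (tw_on _ _ gR UR h1) /tw conjM conj_cst ?rpred1 //.
  by rewrite expr1n !mul1r.
have ea R : generic R -> oset U R ->
    fv (phi U sa) R = u R * (alpha * g R) + v R * ((alpha + 1) * conj g R).
  move=> gR UR; rewrite hphi // (tw_on _ _ gR UR ha) /tw conjM conj_cst //.
  by rewrite alpha_sq.
have [_ g2 g3] := hg Q UQ; have [_ c2 c3] := ordis_conj (hg _ UF).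
split.
  have ou : ordge Q (- D' Q) (fun R => u R * g R).
    apply: ordge_near (ordgeD oa (ordgeZ a14 o1)).
    apply: nearS (xopen_near 2 UQ) => R /= UR gR; rewrite e1 // ea //.
    by apply: (@char2_eq (u R * alpha * g R + v R * (alpha + 1) * conj g R)); ring.
  have := ordgeM g2 ou; rewrite opprK; apply: ordge_near.
  by apply: nearS g3 => R /= g0 gR; rewrite mulrC mulfK // g0.
have ov : ordge Q (- D' Q) (fun R => v R * conj g R).
  apply: ordge_near (ordgeD oa (ordgeZ alpha4 o1)).
  apply: nearS (xopen_near 2 UQ) => R /= UR gR; rewrite e1 // ea //.
  by apply: (@char2_eq (u R * alpha * g R + v R * alpha * conj g R)); ring.
have := ordgeM c2 ov; rewrite opprK; apply: ordge_near.
by apply: nearS c3 => R /= g0 gR; rewrite mulrC mulfK // g0.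
Qed.

(** Since the functions on X_2 are a0 + alpha a1 with a0 and a1 functions on X,
    a local generator g gives the basis g, alpha g. *)
Lemma gens_vector_bundle D : special_div D -> gens D -> vector_bundle 2 (push_O 2 D).
Proof.
move=> spD gD P; have [U [g [UP hg]]] := gD P; exists U; split=> //.
have og c : c \in GF2 2 -> forall R, oset U R -> ordge R (- D R) (fun S => c * g S).
  by move=> c4 R UR; apply: ordgeZ => //; have [] := hg R UR.
have [s1 h1] := @fv_make D spD U _ (og 1 (rpred1 _)).
have [sa ha] := @fv_make D spD U _ (og alpha alpha4).
exists (fun i : 'I_2 => if i == 0 then s1 else sa) => V VU s.
have E (a : 'I_2 -> regfun V) R : generic R -> oset V R ->
    fv (\sum_i a i *: res VU (if i == 0 then s1 else sa) : sec (push_O 2 D) V) R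
    = (a 0 R + a 1 R * alpha) * g R.
  move=> gR VR; rewrite big_ord_recl big_ord1 fvD !fvZ !fv_res //=.
  rewrite h1 // ?ha // ?mul1r; try exact: VU.
  by rewrite (_ : lift _ _ = 1) ?mulrDl ?mulrA //; apply: val_inj.
have [|a0 [a1 ha01]] := @split_regular alpha alpha4 alpha2 V (fun R => fv s R * (g R)^-1).
  move=> Q VQ; have [_ g2 _] := hg Q (VU Q VQ).
  by have := ordgeM (fv_ordge spD s VQ) g2; rewrite opprK addNr.
exists (fun i : 'I_2 => if i == 0 then a0 else a1); split.
  apply: fv_ext => R gR VR; rewrite E //=; have [<- _] := ha01 R gR VR.
  by rewrite mulfVK // (ordis_neq0 gR (hg R (VU R VR))).
move=> b eb; have [|b0 b1] := @regfun_indep alpha alpha4 alpha2 V (a0 - b 0) (a1 - b 1).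
  move=> R gR VR; have [e _] := ha01 R gR VR; have := E b R gR VR; rewrite -eb => eb'.
  move: e; rewrite eb' mulfK ?(ordis_neq0 gR (hg R (VU R VR))) // => e.
  have -> : (a0 - b 0) R = a0 R - b 0 R by [].
  have -> : (a1 - b 1) R = a1 R - b 1 R by [].
  by rewrite mulrBl addrACA -opprD -e subrr.
apply/funext => i; case: (unliftP 0 i) => [j|] ->; last exact/subr0_eq.
have -> : lift 0 j = 1 :> 'I_2 by rewrite (ord1 j); apply: val_inj.
exact/subr0_eq.
Qed.
End Alpha.

(** * Functions with at most one simple pole *)

Lemma wt_unique n c c' F G : wt n c F -> wt n c' G ->
  (forall R, generic R -> F R = G R) -> c = c'.
Proof.
move=> hF hG FG; apply/eqP; rewrite -addF_eq0; apply/eqP.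
by apply: (wt_vanish (wtD hF hG)) => R gR; rewrite FG // addFF.
Qed.

Lemma coef_even (p : {poly Fbar}) i : odd i -> (p \Po 'X^2)`_i = 0.
Proof. by move=> oi; rewrite coef_comp_poly_Xn // dvdn2 oi. Qed.
Lemma coef_odd (p : {poly Fbar}) i : ~~ odd i -> ('X^3 * (p \Po 'X^2))`_i = 0.
Proof.
move=> oi; rewrite mulrC coefMXn; case: ltnP => // i3; apply: coef_even.
by rewrite oddB // (negbTE oi).
Qed.
Lemma coef_double (p : {poly Fbar}) i : (p \Po 'X^2)`_(i.*2) = p`_i.
Proof. by rewrite coef_comp_poly_Xn // -muln2 dvdn_mull // mulnK. Qed.
Lemma coef_double3 (p : {poly Fbar}) i : ('X^3 * (p \Po 'X^2))`_(i.*2.+3) = p`_i.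
Proof. by rewrite mulrC coefMXn /= subSS subSS subSS subn0 coef_double. Qed.

(** The two parts of a(x) + b(x) y have poles of different parities at infinity,
    so they cannot cancel. *)
Lemma wt_exact a b : a != 0 \/ b != 0 ->
  exists n c, [/\ c != 0, wt n c (affine_poly a b),
    forall i, (n < i.*2)%N -> a`_i = 0 & forall i, (n < i.*2.+3)%N -> b`_i = 0].
Proof.
move=> ab; set A := a \Po 'X^2; set B := 'X^3 * (b \Po 'X^2).
pose p := A + B; have p0 : p != 0.
  apply/eqP => p0; have hp i : p`_i = 0 by rewrite p0 coef0.
  case: ab => /eqP[]; apply/polyP => i; rewrite coef0.
    rewrite -coef_double -[RHS](hp i.*2) /p coefD.
    by rewrite [X in _ = _ + X]coef_odd ?odd_double // addr0.
  rewrite -coef_double3 -[RHS](hp i.*2.+3) /p coefD.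
  by rewrite [X in _ = X + _]coef_even ?add0r //= odd_double.
pose n := (size p).-1; have hn i : (n < i)%N -> p`_i = 0.
  by move=> ni; apply: nth_default; rewrite -(prednK (_ : 0 < size p)%N) // size_poly_gt0.
have hA : dle n A.
  move=> i ni; have [oi|oi] := boolP (odd i); first exact: coef_even.
  by have := hn i ni; rewrite /p coefD [X in _ + X]coef_odd // addr0.
have hB : dle n B.
  move=> i ni; have [oi|oi] := boolP (odd i); last exact: coef_odd.
  by have := hn i ni; rewrite /p coefD [X in X + _]coef_even // add0r.
exists n, p`_n; split.
- by rewrite -lead_coefE lead_coef_eq0.
- by exists a, b; split=> //; rewrite /p coefD.
- by move=> i ni; rewrite -coef_double hA.
by move=> i ni; rewrite -coef_double3 hB.
Qed.

(** Otherwise the leading coefficients on the left would have a nonzero product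
    in a weight that T does not reach. *)
Lemma wt_quotient a b s c S t d T N : wt s c S -> c != 0 -> wt t d T ->
  (forall R, generic R -> affine_poly a b R * S R = T R) -> (t <= s + N)%N ->
  forall i, ((N < i.*2)%N -> a`_i = 0) /\ ((N < i.*2.+3)%N -> b`_i = 0).
Proof.
move=> hS c0 hT e tN i.
have [/andP[/eqP -> /eqP ->]|ab] := boolP ((a == 0) && (b == 0)); first by rewrite !coef0.
have [|n [c' [c'0 hn ha hb]]] := @wt_exact a b.
  by move: ab; rewrite negb_and => /orP.
suff nN : (n <= N)%N by split=> h; [apply: ha | apply: hb]; apply: leq_ltn_trans h.
rewrite leqNgt; apply/negP => Nn.
have h1 := wtM hn hS; have h2 : wt (n + s) 0 T by apply: wt_lift hT; lia.
have := wt_unique h1 h2 e; move/eqP; rewrite mulf_eq0 (negbTE c'0) /=.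
by rewrite (negbTE c0).
Qed.

Lemma ordge_fraction Q n F : ordge Q n F ->
  exists d A B, [/\ form 2 d A, form 2 d B, ev B Q != 0 &
    forall R, generic R -> F R * loc Q R ^ (- n) * ev B R = ev A R].
Proof.
move=> [h /regular_char[d [A [B [fA fB BQ hAB]]]]].
move=> nh; have := nearI (near_loc 2 Q) nh; move=> [e [G [fG GQ hG]]].
exists (d + e)%N, (A * G), (B * G); split; try exact: formM.
  by rewrite evM mulf_neq0.
move=> R gR; rewrite !evM; have [->|GR] := eqVneq (ev G R) 0; first by rewrite !mulr0.
have [l0 /(_ gR) ->] := hG R GR.
by rewrite -(mulrA (h R)) -expfzDr ?l0 // addrN expr0z mulr1 mulrA hAB.
Qed.

Lemma ordge0_fraction Q F : ordge Q 0 F ->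
  exists d A B, [/\ form 2 d A, form 2 d B, ev B Q != 0 &
    forall R, generic R -> F R * ev B R = ev A R].
Proof.
move=> /ordge_fraction[d [A [B [? ? ? h]]]]; exists d, A, B; split=> // R gR.
by rewrite -h // oppr0 expr0z mulr1.
Qed.

(** A function regular on the affine curve is a polynomial: the denominators in
    x form an ideal of [Fbar[x]], and the norm of a local denominator valid at
    both points above c shows that c is not a common zero. *)
Lemma affine_regular F : (forall Q, cz Q = 1 -> ordge Q 0 F) ->
  exists a b, forall R, generic R -> F R = affine_poly a b R.
Proof.
move=> oF.
pose I (p : {poly Fbar}) := exists a b, forall R, generic R ->
  p.[cx R] * F R = affine_poly a b R.
have IM p q : I p -> I (q * p).
  move=> [a [b h]]; exists (q * a), (q * b) => R gR.
  by rewrite hornerM -mulrA h // /affine_poly !hornerM; ring.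
have ID p q : I p -> I q -> I (p + q).
  move=> [a [b h]] [a' [b' h']]; exists (a + a'), (b + b') => R gR.
  by rewrite hornerD mulrDl h // h' // /affine_poly !hornerD; ring.
have Iloc c : exists2 n, n.[c] != 0 & I n.
  have [Q [xQ zQ]] := points_over c; have [S [xS yS zS]] := opposite_exists zQ.
  have [||d [A [B [fA fB BQ BS h]]]] := fraction_two (form_coord 2 2) _ _
    (ordge0_fraction (oF Q zQ)) (ordge0_fraction (oF S zS)).
  - by rewrite evX2 zQ oner_neq0.
  - by rewrite evX2 zS oner_neq0.
  have [a [b [hA _ _ _]]] := wt_form fA; have [b0 [b1 [hB _ _ _]]] := wt_form fB.
  have hN R : cz R = 1 -> affine_poly b0 b1 R * affine_poly (b0 + b1) b1 R =
      (b0 * (b0 + b1) + b1 * b1 * ('X^3 + 'X + 1)).[cx R].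
    move=> zR; rewrite affine_polyM // /affine_poly.
    rewrite (_ : b0 * b1 + _ + _ = 0); first by rewrite horner0 mul0r addr0.
    have FF (p : {poly Fbar}) : p + p = 0 by apply/polyP => i; rewrite coefD coef0; exact: addFF.
    by rewrite -[RHS](FF (b0 * b1 + b1 * b1)); ring.
  exists (b0 * (b0 + b1) + b1 * b1 * ('X^3 + 'X + 1)).
    rewrite -xQ -hN // mulf_neq0 //; first by rewrite -hB.
    move: BS; rewrite hB // /affine_poly xS yS xQ !hornerD.
    by congr (_ != 0); ring.
  exists (a * (b0 + b1) + b * b1 * ('X^3 + 'X + 1)), (a * b1 + (b0 + b1) * b + b * b1).
  move=> R gR; have zR := generic_z gR.
  by rewrite -affine_polyM // -hN // -hA // -h // hB //; ring.
have I1 n : forall p : {poly Fbar}, (size p <= n)%N -> p != 0 -> I p -> I 1.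
  elim: n => [|n IH] p; first by rewrite leqn0 size_poly_eq0 => /eqP ->; rewrite eqxx.
  move=> sp p0 Ip; have [s1|s1] := eqVneq (size p) 1%N.
    have [c c0 ec] : exists2 c, c != 0 & p = c%:P by apply/size_poly1P; apply/eqP.
    have := IM p (c^-1)%:P Ip; rewrite ec -polyCM mulVf //.
  have [c /factor_theorem[q eq]] := closed_rootP p s1.
  have [m mc Im] := Iloc c.
  have [k ek] : exists k, m - (m.[c])%:P = k * ('X - c%:P).
    by apply/factor_theorem; rewrite rootE !hornerE subrr.
  have q0 : q != 0 by apply: contra p0 => /eqP q0; rewrite eq q0 mul0r.
  apply: (IH q) => //.
    by move: sp; rewrite eq size_Mmonic ?monicXsubC // size_XsubC addn2 /=.
  set e := m.[c] in mc ek.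
  have -> : q = (e^-1)%:P * (q * m) + (- ((e^-1)%:P * k)) * p.
    have -> : m = e%:P + k * ('X - c%:P) by rewrite -ek addrC subrK.
    transitivity ((e^-1 * e)%:P * q); last by rewrite polyCM eq; ring.
    by rewrite mulVf // polyC1 mul1r.
  by apply: ID; [exact: (IM _ _ (IM _ _ Im)) | exact: (IM _ _ Ip)].
have [m m0 Im] := Iloc 0.
have mn0 : m != 0 by apply: contra m0 => /eqP ->; rewrite horner0.
have [a [b h]] := I1 _ m (leqnn _) mn0 Im.
by exists a, b => R gR; rewrite -h // hornerC mul1r.
Qed.

Lemma near_sub0 r Q A : near r Q A -> near 0 Q A.
Proof. by move=> [d [G [fG ? ?]]]; exists d, G; split=> //; apply: form_sub0 fG. Qed.

Lemma regular_sub0 r f Q : regular_at r f Q -> regular_at 0 f Q.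
Proof.
move=> [d [G [H [fG fH n]]]]; exists d, G, H.
by split; [apply: form_sub0 fG | apply: form_sub0 fH | apply: near_sub0 n].
Qed.

(** The affine functions have poles of order 0, 2, 3, ... at infinity, never of
    order one. If the pole is at another special point P, multiplication by x -
    x(P) moves it to infinity, where it has order at most two; the result is a_0
    + a_1 x, and it vanishes where x = x(P), because it does at the conjugate of
    P, where w has no pole. *)
Lemma simple_pole_cst P w : ~ generic P ->
  (forall Q, Q <> P -> ordge Q 0 w) -> ordge P (-1) w ->
  exists2 c, c \in GF2 2 & forall R, generic R -> w R = c.
Proof.
move=> gP o0 o1.
suff [c hc] : exists c, forall R, generic R -> w R = c.
  exists c => //; have [S [gS SP]] : exists S, ~ generic S /\ S <> P.
    have [P0|P0] := pselect (P = x0); last by exists x0; split; [exact: gen_x0 | exact: nesym].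
    have [S [xS zS]] := points_over 0; exists S; split.
      by move=> /genericP[_]; rewrite xS eqxx.
    by move=> SP; move: zS; rewrite SP P0 cz_x0 => /eqP; rewrite eq_sym oner_eq0.
  have [h rh nh] := o0 S SP; have [xr yr] := special_rational gS.
  rewrite -(_ : h S = c); first exact: regular_value xr yr rh.
  apply: (regular_agree (regular_sub0 rh) (regular_cst S (GF20 c))).
  by apply: near_sub0; apply: nearS nh => R /= e gR; rewrite -(hc R gR) e // expr0z mulr1.
have [P0|zP] := affineP P.
  have [|a [b h]] := @affine_regular w.
    move=> Q zQ; apply: o0 => QP.
    by move: zQ; rewrite QP P0 cz_x0 => /eqP; rewrite eq_sym oner_eq0.
  have [d [A [B [fA fB B0 e]]]] := ordge_fraction o1; rewrite P0 in B0 e.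
  have := @wt_quotient a b _ _ _ _ _ _ 1 (wtM (wtM wt_x (wt_form fB)) wt_y) _
    (wtM (wtM (wt_form fA) wt_y) wt_y).
  rewrite mul1r mulr1 => /(_ B0) hq.
  have {}hq : forall i, ((1 < i.*2)%N -> a`_i = 0) /\ ((1 < i.*2.+3)%N -> b`_i = 0).
    apply: hq => [R gR|]; last lia.
    have := e R gR; rewrite opprK expr1z loc_x0 -h // => e'.
    have [->|y0] := eqVneq (cy R) 0; first by rewrite !mulr0.
    rewrite -e'; transitivity (w R * (cx R * (cy R / cy R)) * ev B R * cy R); last by ring.
    by rewrite mulfV // mulr1; ring.
  have b0 : b = 0 by apply/polyP => i; rewrite coef0; apply: (hq i).2; lia.
  exists a`_0 => R gR; rewrite h // b0 /affine_poly horner0 mul0r addr0.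
  have -> : a = (a`_0)%:P; last by rewrite hornerC coefC.
  apply/polyP => -[|i]; rewrite coefC //=; apply: (hq i.+1).1; lia.
pose t R := cx R + cx P.
have rt Q : cz Q = 1 -> regular_at 2 t Q.
  move=> zQ; apply: regularDf; first exact: regular_x.
  by apply: regular_cst; have [] := special_rational gP.
have [|a [b h]] := @affine_regular (fun R => t R * w R).
  move=> Q zQ; have [->|QP] := pselect (Q = P).
    rewrite -[0](addrN 1); apply: ordgeM => //.
    have [oL _ _] := ordis_loc P; apply: ordge_ext oL => R gR.
    by rewrite loc_affine.
  rewrite -[0]addr0; apply: ordgeM; last exact: o0.
  by apply: ordge_regular; apply: rt.
have x0P : x0 <> P by move=> e; move: zP; rewrite -e cz_x0 => /eqP; rewrite eq_sym oner_eq0.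
have [d [A [B [fA fB B0 e]]]] := ordge0_fraction (o0 _ x0P).
have wt_t : wt 2 1 t.
  rewrite -[1]addr0; apply: wtD wt_x _; exact: wt_lift (wt_cst _).
have hq : forall i, ((2 < i.*2)%N -> a`_i = 0) /\ ((2 < i.*2.+3)%N -> b`_i = 0).
  apply: (wt_quotient (wt_form fB) B0 (wtM (wt_form fA) wt_t)); last lia.
  by move=> R gR; rewrite -h // -e //; ring.
have b0 : b = 0 by apply/polyP => i; rewrite coef0; apply: (hq i).2; lia.
have aE c : a.[c] = a`_0 + a`_1 * c.
  suff {1}-> : a = (a`_0)%:P + (a`_1)%:P * 'X by rewrite hornerD hornerM !hornerC hornerX.
  apply/polyP => -[|[|i]]; rewrite coefD coefC coefCM coefX /= ?mulr0 ?mulr1 ?addr0 ?add0r //.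
  by apply: (hq i.+2).1; lia.
have {}h R : generic R -> t R * w R = a`_0 + a`_1 * cx R.
  by move=> gR; rewrite h // /affine_poly b0 horner0 mul0r addr0 aE.
have [xF yF] := Frob_special gP zP; have zF : cz (Frob P) = 1 by rewrite cz_Frob zP expr1n.
have gF : ~ generic (Frob P) by move=> /generic_Frob.
have FP : Frob P <> P.
  by move=> FP; move: yF; rewrite FP -[X in X = _]addr0 => /addrI/eqP; rewrite eq_sym oner_eq0.
have r1 : regular_at 2 t (Frob P) by apply: rt.
have r0 := o0 _ FP.
have tF : t (Frob P) = 0 by rewrite /t xF addFF.
have ga : a`_0 + a`_1 * cx P = 0.
  have rx0 : regular_at 0 (fun R => a`_0 + a`_1 * cx R) (Frob P).
    apply: regularDf; first exact/regular_cst/GF20.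
    by apply: regularMf; [exact/regular_cst/GF20 | exact: regular_x].
  have [k rk nk] := r0.
  rewrite -xF -[LHS]/((fun R => a`_0 + a`_1 * cx R) (Frob P)).
  transitivity (t (Frob P) * k (Frob P)); last by rewrite tF mul0r.
  apply: (regular_agree rx0 (regular_sub0 (regularMf r1 rk))).
  apply: near_sub0; apply: nearS nk => R /= e' gR.
  by rewrite -h // e' // expr0z mulr1.
exists a`_1 => R gR; have t0 : t R != 0.
  rewrite /t addF_eq0; have [_ x0 x1] := (genericP R).1 gR.
  by case: (special_x gP zP) => ->.
apply: (mulfI t0); rewrite h //.
transitivity (a`_0 + a`_1 * cx P + t R * a`_1); last by rewrite ga add0r.
by rewrite /t; apply: (@char2_eq (- (a`_1 * cx P))); ring.
Qed.

(** * The five special points *)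

Lemma ordis_intro Q n F h : regular_at 2 h Q -> h Q != 0 ->
  near 2 Q [set R | generic R -> F R = h R * loc Q R ^ n] -> ordis Q n F.
Proof.
move=> rh h0 nh; split; first by exists h.
  exists (fun R => (h R)^-1); first exact: regularV.
  by apply: nearS nh => R /= e gR; rewrite e // invfM invr_expz.
apply: nearS (nearI (near_loc 2 Q) (nearI nh (regular_neq0 rh h0))) => R /= [l0 [e hR]] gR.
by rewrite e // mulf_neq0 // expfz_neq0 // l0.
Qed.

Lemma ordisD Q n F G : ~ generic Q -> ordis Q n F -> ordge Q (n + 1) G ->
  ordis Q n (fun R => F R + G R).
Proof.
move=> gQ oF [k rk nk]; have l0 := ordis_lead oF; have [[h rh nh] _ _] := oF.
rewrite (leadE rh nh) in l0.
apply: (@ordis_intro _ _ _ (fun R => h R + k R * loc Q R)).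
- apply: regularDf => //; apply: regularMf => //; exact: regular_loc.
- by rewrite loc_self // mulr0 addr0.
apply: nearS (nearI (near_loc 2 Q) (nearI nh nk)) => R /= [lR [e1 e2]] gR.
by rewrite e1 // e2 // expfzDr ?lR // expr1z; ring.
Qed.

Section Special.
Variable alpha : Fbar.
Hypotheses (alpha4 : alpha \in GF2 2) (alpha2 : alpha \notin GF2 1).

Let asq : alpha ^+ 2 = alpha + 1. Proof. exact: alpha_sq. Qed.

Notation P := (px alpha4 alpha2).
Notation Y := (py alpha4 alpha2).
Notation P' := (Frob P).
Notation Y' := (Frob Y).

Lemma px_coord : [/\ cx P = 0, cy P = alpha & cz P = 1]. Proof. by []. Qed.
Lemma py_coord : [/\ cx Y = 1, cy Y = alpha & cz Y = 1]. Proof. by []. Qed.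
Lemma px'_coord : [/\ cx P' = 0, cy P' = alpha + 1 & cz P' = 1].
Proof.
have [e1 e2 e3] := px_coord; rewrite cx_Frob cy_Frob cz_Frob e1 e2 e3.
by rewrite expr0n expr1n asq.
Qed.
Lemma py'_coord : [/\ cx Y' = 1, cy Y' = alpha + 1 & cz Y' = 1].
Proof.
have [e1 e2 e3] := py_coord; rewrite cx_Frob cy_Frob cz_Frob e1 e2 e3.
by rewrite !expr1n asq.
Qed.

Lemma gen_px : ~ generic P.
Proof. by move=> /genericP[_]; have [-> _ _] := px_coord; rewrite eqxx. Qed.
Lemma gen_py : ~ generic Y.
Proof. by move=> /genericP[_ _]; have [-> _ _] := py_coord; rewrite eqxx. Qed.
Lemma gen_px' : ~ generic P'. Proof. by move=> /generic_Frob/gen_px. Qed.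
Lemma gen_py' : ~ generic Y'. Proof. by move=> /generic_Frob/gen_py. Qed.

Lemma special_cases Q : [\/ generic Q, Q = x0, Q = P \/ Q = P' | Q = Y \/ Q = Y'].
Proof.
have [gQ|gQ] := pselect (generic Q); first by constructor 1.
have [->|zQ] := affineP Q; first by constructor 2.
have hy : cy Q = alpha \/ cy Q = alpha + 1.
  have : (cy Q + alpha) * (cy Q + (alpha + 1)) = 0.
    transitivity (cy Q ^+ 2 + cy Q + (alpha ^+ 2 + alpha)).
      by apply: (@char2_eq (cy Q * alpha)); ring.
    by rewrite (special_y gQ zQ) asq; apply: (@char2_eq (cy Q + alpha + 1)); ring.
  by move/eqP; rewrite mulf_eq0 !addF_eq0 => /orP[] /eqP; [left | right].
have [a1 a2 a3] := px_coord; have [b1 b2 b3] := px'_coord.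
have [c1 c2 c3] := py_coord; have [d1 d2 d3] := py'_coord.
case: (special_x gQ zQ) => ex; [constructor 3 | constructor 4];
by case: hy => ey; [left | right]; apply: point_ext; rewrite ?ex ?ey ?zQ.
Qed.

Lemma alpha_neq : [/\ alpha != 0, alpha != 1, alpha + 1 != 0 & alpha + 1 != 1].
Proof.
have a0 : alpha != 0 by apply: contra alpha2 => /eqP ->; rewrite rpred0.
have a1 : alpha != 1 by apply: contra alpha2 => /eqP ->; rewrite rpred1.
by split=> //; rewrite ?addF_eq0 // -subr_eq0 addrK.
Qed.

Lemma special_neq : [/\ x0 == P = false, x0 == P' = false, x0 == Y = false & x0 == Y' = false] /\
  [/\ P == P' = false, P == Y = false, P == Y' = false, P' == Y = false & P' == Y' = false] /\
  Y == Y' = false.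
Proof.
have [a1 a2 a3] := px_coord; have [b1 b2 b3] := px'_coord.
have [c1 c2 c3] := py_coord; have [d1 d2 d3] := py'_coord.
have nx Q R : cx Q = 0 -> cx R = 1 -> (Q == R) = false.
  by move=> q r; apply/eqP => e; move: r; rewrite -e q => /eqP; rewrite eq_sym oner_eq0.
have nz Q R : cz Q = 0 -> cz R = 1 -> (Q == R) = false.
  by move=> q r; apply/eqP => e; move: r; rewrite -e q => /eqP; rewrite eq_sym oner_eq0.
have ny Q R : cy Q = alpha -> cy R = alpha + 1 -> (Q == R) = false.
  move=> q r; apply/eqP => e; move: r; rewrite -e q -[X in X = _]addr0 => /addrI/eqP.
  by rewrite eq_sym oner_eq0.
by do !split; try (exact: nx); try (exact: nz); exact: ny.
Qed.

(** The divisor n0 x0 + n1 P + n1' P' + n2 Y + n2' Y'. *)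
Definition dv (n0 n1 n1' n2 n2' : int) : point -> int := fun Q =>
  if Q == x0 then n0 else if Q == P then n1 else if Q == P' then n1'
  else if Q == Y then n2 else if Q == Y' then n2' else 0.

Lemma dvE n0 n1 n1' n2 n2' : let D := dv n0 n1 n1' n2 n2' in
  (D x0 = n0) * (D P = n1) * (D P' = n1') * (D Y = n2) * (D Y' = n2').
Proof.
have [[e1 e2 e3 e4] [[f1 f2 f3 f4 f5] g]] := special_neq.
rewrite /dv !eqxx !(eq_sym _ x0) !e1 !e2 !e3 !e4 !(eq_sym _ P) !f1 !f2 !f3.
by rewrite !(eq_sym _ P') !f4 !f5 (eq_sym _ Y) g.
Qed.

Lemma dv_special n0 n1 n1' n2 n2' : special_div (dv n0 n1 n1' n2 n2').
Proof.
move=> Q gQ; rewrite /dv; have h S : ~ generic S -> (Q == S) = false.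
  by move=> gS; apply/eqP => QS; case: gS; rewrite -QS.
by rewrite !h //; [exact: gen_py' | exact: gen_py | exact: gen_px' | exact: gen_px
  | exact: gen_x0].
Qed.

Lemma FrobFrob_px : Frob P' = P. Proof. exact: FrobK_special gen_px. Qed.
Lemma FrobFrob_py : Frob Y' = Y. Proof. exact: FrobK_special gen_py. Qed.

Lemma dv_ind (K : point -> int -> Prop) n0 n1 n1' n2 n2' :
  (forall Q, generic Q -> K Q 0) -> K x0 n0 -> K P n1 -> K P' n1' -> K Y n2 -> K Y' n2' ->
  forall Q, K Q (dv n0 n1 n1' n2 n2' Q).
Proof.
move=> kg k0 k1 k1' k2 k2' Q.
by case: (special_cases Q) => [gQ|->|[]->|[]->]; rewrite ?dvE // dv_special //; apply: kg.
Qed.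

Lemma dv_le n0 n1 n1' n2 n2' m0 m1 m1' m2 m2' :
  [&& n0 <= m0, n1 <= m1, n1' <= m1', n2 <= m2 & n2' <= m2'] ->
  forall Q, dv n0 n1 n1' n2 n2' Q <= dv m0 m1 m1' m2 m2' Q.
Proof.
move=> /and5P[h0 h1 h1' h2 h2'].
by apply: (@dv_ind (fun Q n => n <= _)) => [Q gQ|||||]; rewrite ?dvE // dv_special.
Qed.

Lemma dvD n0 n1 n1' n2 n2' m0 m1 m1' m2 m2' Q :
  dv n0 n1 n1' n2 n2' Q + dv m0 m1 m1' m2 m2' Q
  = dv (n0 + m0) (n1 + m1) (n1' + m1') (n2 + m2) (n2' + m2') Q.
Proof.
by case: (special_cases Q) => [gQ|->|[]->|[]->]; rewrite ?dvE // !dv_special // addr0.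
Qed.

Lemma dvN n0 n1 n1' n2 n2' Q :
  - dv n0 n1 n1' n2 n2' Q = dv (- n0) (- n1) (- n1') (- n2) (- n2') Q.
Proof.
by case: (special_cases Q) => [gQ|->|[]->|[]->]; rewrite ?dvE // !dv_special // oppr0.
Qed.

Lemma dv_Frob n0 n1 n1' n2 n2' Q :
  dv n0 n1 n1' n2 n2' (Frob Q) = dv n0 n1' n1 n2' n2 Q.
Proof.
case: (special_cases Q) => [gQ|->|[]->|[]->];
  rewrite ?Frob_x0 ?FrobFrob_px ?FrobFrob_py ?dvE // !dv_special //.
exact/generic_Frob.
Qed.

(** ** Orders of the coordinate functions and of some lines *)

Definition fx1 : point -> Fbar := fun R => cx R + 1.
Definition fL : point -> Fbar := fun R => cy R + cx R + alpha.
Definition fL' : point -> Fbar := fun R => cy R + cx R + (alpha + 1).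
Definition fM : point -> Fbar := fun R => cy R + alpha.
Definition fM' : point -> Fbar := fun R => cy R + (alpha + 1).

Lemma conj_fL R : conj fL R = fL' R.
Proof. by rewrite !conjD conj_cx conj_cy conj_cst // asq. Qed.
Lemma conj_fL' R : conj fL' R = fL R.
Proof.
rewrite !conjD conj_cx conj_cy !conj_cst ?rpred1 // asq expr1n.
by rewrite /fL -[alpha + 1 + 1]addrA addFF addr0.
Qed.
Lemma conj_fM R : conj fM R = fM' R.
Proof. by rewrite !conjD conj_cy conj_cst // asq. Qed.
Lemma conj_fM' R : conj fM' R = fM R.
Proof.
rewrite !conjD conj_cy !conj_cst ?rpred1 // asq expr1n.
by rewrite /fM -[alpha + 1 + 1]addrA addFF addr0.
Qed.

(** The norm of a line is a product of vertical lines, by the equation of the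
    curve. A line and its conjugate differ by 1, so they have no common zero and
    the divisor of each can be read off. *)
Lemma fLL R : cz R = 1 -> fL R * fL' R = cx R ^+ 2 * fx1 R.
Proof.
move=> /curveE e; rewrite /fL /fL' /fx1.
transitivity (cy R ^+ 2 + cy R + cx R ^+ 2 + cx R + (alpha ^+ 2 + alpha)).
  by apply: (@char2_eq (cy R * cx R + alpha * cy R + alpha * cx R)); ring.
by rewrite e asq; apply: (@char2_eq (cx R + 1 + alpha)); ring.
Qed.

Lemma fMM R : cz R = 1 -> fM R * fM' R = cx R * fx1 R ^+ 2.
Proof.
move=> /curveE e; rewrite /fM /fM' /fx1.
transitivity (cy R ^+ 2 + cy R + (alpha ^+ 2 + alpha)).
  by apply: (@char2_eq (alpha * cy R)); ring.
by rewrite e asq; apply: (@char2_eq (1 + alpha - cx R ^+ 2)); ring.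
Qed.

Lemma generic_x R : generic R -> cx R != 0. Proof. by case/genericP. Qed.
Lemma generic_x1 R : generic R -> fx1 R != 0.
Proof. by case/genericP => _ _; rewrite /fx1 addF_eq0. Qed.
Lemma generic_L R : generic R -> fL R != 0 /\ fL' R != 0.
Proof.
move=> gR; have := fLL (generic_z gR) => /eqP.
have := mulf_neq0 (expf_neq0 2 (generic_x gR)) (generic_x1 gR).
by move=> n0 /eqP e; rewrite -e mulf_eq0 negb_or in n0; apply/andP.
Qed.
Lemma generic_M R : generic R -> fM R != 0 /\ fM' R != 0.
Proof.
move=> gR; have := fMM (generic_z gR) => /eqP.
have := mulf_neq0 (generic_x gR) (expf_neq0 2 (generic_x1 gR)).
by move=> n0 /eqP e; rewrite -e mulf_eq0 negb_or in n0; apply/andP.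
Qed.

Lemma reg_c a Q : a \in GF2 2 -> regular_at 2 (fun=> a) Q.
Proof. exact: regular_cst. Qed.
Let a14 : alpha + 1 \in GF2 2. Proof. by rewrite rpredD ?rpred1. Qed.

Lemma regular_fx1 Q : cz Q = 1 -> regular_at 2 fx1 Q.
Proof. by move=> zQ; apply: regularDf; [exact: regular_x | exact: reg_c (rpred1 _)]. Qed.
Lemma regular_fL Q : cz Q = 1 -> regular_at 2 fL Q.
Proof.
move=> zQ; apply: regularDf; last exact: reg_c.
by apply: regularDf; [exact: regular_y | exact: regular_x].
Qed.
Lemma regular_fL' Q : cz Q = 1 -> regular_at 2 fL' Q.
Proof.
move=> zQ; apply: regularDf; last exact: reg_c.
by apply: regularDf; [exact: regular_y | exact: regular_x].
Qed.
Lemma regular_fM Q : cz Q = 1 -> regular_at 2 fM Q.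
Proof. by move=> zQ; apply: regularDf; [exact: regular_y | exact: reg_c]. Qed.
Lemma regular_fM' Q : cz Q = 1 -> regular_at 2 fM' Q.
Proof. by move=> zQ; apply: regularDf; [exact: regular_y | exact: reg_c]. Qed.

(** The equation of the curve divided by y^2 reads x^3 / y^2 = 1 + w + s w + w^2
    with w = Z/Y and s = X/Y, and w vanishes at x0. The orders of x and y at
    infinity follow. *)
Lemma infinity_unit : exists k, [/\ regular_at 2 k x0, k x0 != 0 &
  near 2 x0 [set R | generic R -> cy R != 0 /\ cx R ^+ 3 = k R * cy R ^+ 2]].
Proof.
pose w R := cz R / cy R; pose s R := cx R / cy R.
have rw : regular_at 2 w x0 by exact: regular_zy.
have rs : regular_at 2 s x0 by exact: regular_xy.
exists (fun R => 1 + w R + s R * w R + w R ^+ 2); split.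
- apply: regularDf; last exact: regularX.
  apply: regularDf; last exact: regularMf.
  by apply: regularDf => //; exact: regular1.
- by rewrite /w cz_x0 !mul0r mulr0 expr0n !addr0 oner_neq0.
apply: nearS (near_chart 2 x0) => R /=; rewrite chart_x0 => y0 gR; split=> //.
have zR := generic_z gR; rewrite /w /s zR.
have c := curveE zR.
transitivity (cy R ^+ 2 + cy R + cx R + 1).
  by rewrite c; apply: (@char2_eq (- cx R - 1)); ring.
have ey : (1 / cy R) * cy R = 1 by rewrite div1r mulVf.
transitivity (cy R ^+ 2 + (1 / cy R * cy R) * cy R + cx R * (1 / cy R * cy R) * (1 / cy R * cy R) + (1 / cy R * cy R) ^+ 2).
  by rewrite !ey expr1n !mulr1 mul1r.
by ring.
Qed.

Lemma ordis_x_inf : ordis x0 (-2) cx.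
Proof.
have [k [rk k0 nk]] := infinity_unit; apply: (ordis_intro rk k0).
apply: nearS nk => R /= h gR; have [y0 e] := h gR; have x0' := generic_x gR.
rewrite loc_x0 -[-2]/(- (2%:Z)) -exprnN -exprVn invf_div expr_div_n mulrA -e.
by rewrite exprS mulfK // expf_neq0.
Qed.

Lemma ordis_y_inf : ordis x0 (-3) cy.
Proof.
have [k [rk k0 nk]] := infinity_unit; apply: (ordis_intro rk k0).
apply: nearS nk => R /= h gR; have [y0 e] := h gR; have x0' := generic_x gR.
rewrite loc_x0 -[-3]/(- (3%:Z)) -exprnN -exprVn invf_div expr_div_n.
by rewrite [cy R ^+ 3]exprSr mulrA [k R * (_ * _)]mulrA -e mulrAC mulfV ?mul1r // expf_neq0.
Qed.

Lemma cst_inf n a : (n <= 0) -> a \in GF2 2 -> ordge x0 n (fun=> a).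
Proof. by move=> n0 a4; apply: ordgeW n0 _; apply: ordge_cst. Qed.

Lemma ordis_x : forall Q, ordis Q (dv (-2) 1 1 0 0 Q) cx.
Proof.
have hx Q : ~ generic Q -> cz Q = 1 -> cx Q = 0 -> ordis Q 1 cx.
  by move=> gQ zQ xQ; apply: ordis_ext (ordis_loc Q) => R _; rewrite loc_affine // xQ addr0.
have hu Q : cz Q = 1 -> cx Q = 1 -> ordis Q 0 cx.
  by move=> zQ xQ; apply: ordis_unit; [exact: regular_x | rewrite xQ oner_neq0].
have [a1 a2 a3] := px_coord; have [b1 b2 b3] := px'_coord.
have [c1 c2 c3] := py_coord; have [d1 d2 d3] := py'_coord.
apply: (@dv_ind (fun Q n => ordis Q n cx)) => [Q gQ|||||].
- by apply: ordis_generic; [| apply: regular_x; apply: generic_z|apply: generic_x].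
- exact: ordis_x_inf.
- by apply: hx => //; apply: gen_px.
- by apply: hx => //; apply: gen_px'.
- exact: hu.
- exact: hu.
Qed.

Lemma ordis_x1 : forall Q, ordis Q (dv (-2) 0 0 1 1 Q) fx1.
Proof.
have hx Q : ~ generic Q -> cz Q = 1 -> cx Q = 1 -> ordis Q 1 fx1.
  by move=> gQ zQ xQ; apply: ordis_ext (ordis_loc Q) => R _; rewrite loc_affine // xQ.
have hu Q : cz Q = 1 -> cx Q = 0 -> ordis Q 0 fx1.
  by move=> zQ xQ; apply: ordis_unit; [exact: regular_fx1 | rewrite /fx1 xQ add0r oner_neq0].
have [a1 a2 a3] := px_coord; have [b1 b2 b3] := px'_coord.
have [c1 c2 c3] := py_coord; have [d1 d2 d3] := py'_coord.
apply: (@dv_ind (fun Q n => ordis Q n fx1)) => [Q gQ|||||].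
- by apply: ordis_generic; [| apply: regular_fx1; apply: generic_z|apply: generic_x1].
- by apply: ordisD; [exact: gen_x0 | exact: ordis_x_inf | apply: cst_inf; rewrite ?rpred1].
- exact: hu.
- exact: hu.
- by apply: hx => //; apply: gen_py.
- by apply: hx => //; apply: gen_py'.
Qed.

Lemma ordis_div n m F G H : (forall Q, ordis Q (n Q) F) ->
  (forall R, generic R -> F R = G R * H R) -> forall Q, ordis Q m H ->
  ordis Q (n Q - m) G.
Proof.
move=> hF e Q hH; have [_ _ h0] := hH.
apply: ordis_near (ordisM (hF Q) (ordisV hH)).
by apply: nearS h0 => R /= H0 gR; rewrite e // mulfK // H0.
Qed.

Lemma ordis_M : forall Q, ordis Q (dv (-3) 1 0 2 0 Q) fM.
Proof.
have [n0 n1 n2 n3] := alpha_neq.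
have hF Q := ordisM (ordis_x Q) (ordisM (ordis_x1 Q) (ordis_x1 Q)).
have e R : generic R -> cx R * (fx1 R * fx1 R) = fM R * fM' R.
  by move=> gR; rewrite fMM ?expr2 //; apply: generic_z.
have hd Q : cz Q = 1 -> fM' Q != 0 -> ordis Q
    (dv (-2) 1 1 0 0 Q + (dv (-2) 0 0 1 1 Q + dv (-2) 0 0 1 1 Q) - 0) fM.
  move=> zQ u0; apply: (ordis_div hF e); apply: ordis_unit => //; exact: regular_fM'.
have hu Q : cz Q = 1 -> fM Q != 0 -> ordis Q 0 fM.
  by move=> zQ u0; apply: ordis_unit => //; exact: regular_fM.
have [a1 a2 a3] := px_coord; have [b1 b2 b3] := px'_coord.
have [c1 c2 c3] := py_coord; have [d1 d2 d3] := py'_coord.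
have v1 : alpha + (alpha + 1) != 0 by rewrite addKF oner_neq0.
have v2 : alpha + 1 + alpha != 0 by rewrite addrC addKF oner_neq0.
apply: (@dv_ind (fun Q n => ordis Q n fM)) => [Q gQ|||||].
- by apply: ordis_generic; [| apply: regular_fM; apply: generic_z|have [] := generic_M gQ].
- by apply: ordisD; [exact: gen_x0 | exact: ordis_y_inf | exact: cst_inf].
- by have := hd P a3; rewrite !dvE /fM' a2; apply.
- by apply: hu => //; rewrite /fM b2.
- by have := hd Y c3; rewrite !dvE /fM' c2; apply.
- by apply: hu => //; rewrite /fM d2.
Qed.

Lemma ordis_L : forall Q, ordis Q (dv (-3) 2 0 0 1 Q) fL.
Proof.
have [n0 n1 n2 n3] := alpha_neq.
have hF Q := ordisM (ordisM (ordis_x Q) (ordis_x Q)) (ordis_x1 Q).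
have e R : generic R -> cx R * cx R * fx1 R = fL R * fL' R.
  by move=> gR; rewrite fLL ?expr2 //; apply: generic_z.
have hd Q : cz Q = 1 -> fL' Q != 0 -> ordis Q
    (dv (-2) 1 1 0 0 Q + dv (-2) 1 1 0 0 Q + dv (-2) 0 0 1 1 Q - 0) fL.
  move=> zQ u0; apply: (ordis_div hF e); apply: ordis_unit => //; exact: regular_fL'.
have hu Q : cz Q = 1 -> fL Q != 0 -> ordis Q 0 fL.
  by move=> zQ u0; apply: ordis_unit => //; exact: regular_fL.
have [a1 a2 a3] := px_coord; have [b1 b2 b3] := px'_coord.
have [c1 c2 c3] := py_coord; have [d1 d2 d3] := py'_coord.
have v1 : alpha + 0 + (alpha + 1) != 0 by rewrite addr0 addKF oner_neq0.
have v2 : alpha + 1 + 0 + alpha != 0 by rewrite addr0 addrC addKF oner_neq0.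
have v3 : alpha + 1 + alpha != 0 by rewrite addrC addKF oner_neq0.
have v4 : alpha + 1 + 1 + (alpha + 1) != 0.
  by rewrite -[alpha + 1 + 1]addrA addFF addr0 addKF oner_neq0.
apply: (@dv_ind (fun Q n => ordis Q n fL)) => [Q gQ|||||].
- by apply: ordis_generic; [| apply: regular_fL; apply: generic_z|have [] := generic_L gQ].
- apply: ordisD; [exact: gen_x0 | | exact: cst_inf].
  by apply: ordisD; [exact: gen_x0 | exact: ordis_y_inf | have [] := ordis_x_inf].
- by have := hd P a3; rewrite !dvE /fL' a2 a1; apply.
- by apply: hu => //; rewrite /fL b2 b1.
- by apply: hu => //; rewrite /fL c2 c1.
- by have := hd Y' d3; rewrite !dvE /fL' d2 d1; apply.
Qed.

Lemma ordis_L' : forall Q, ordis Q (dv (-3) 0 2 1 0 Q) fL'.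
Proof.
move=> Q; rewrite -dv_Frob; apply: ordis_ext (ordis_conj (ordis_L (Frob Q))) => R _.
exact: conj_fL.
Qed.

Lemma ordis_M' : forall Q, ordis Q (dv (-3) 0 1 0 2 Q) fM'.
Proof.
move=> Q; rewrite -dv_Frob; apply: ordis_ext (ordis_conj (ordis_M (Frob Q))) => R _.
exact: conj_fM.
Qed.
End Special.

(** * The bundles of the theorem *)

Section Bundles.
Variable alpha : Fbar.
Hypotheses (alpha4 : alpha \in GF2 2) (alpha2 : alpha \notin GF2 1).

Notation P := (px alpha4 alpha2).
Notation Y := (py alpha4 alpha2).
Notation P' := (Frob P).
Notation Y' := (Frob Y).
Notation dv := (dv alpha4 alpha2).
Notation fL := (fL alpha).
Notation fL' := (fL' alpha).
Notation fM := (fM alpha).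
Notation fM' := (fM' alpha).

Lemma E20E : E20 P = push_O 2 (dv (-1) 1 0 0 0).
Proof.
congr push_O; apply/funext => Q; rewrite /dv /pt_div.
have [[e1 _ _ _] _] := special_neq alpha4 alpha2.
have [->|_] := eqVneq Q x0; first by rewrite e1.
by have [_|_] := eqVneq Q P; rewrite ?subr0 //; do !case: ifP.
Qed.

Lemma E22E0 : E22 x0 = push_O 2 (dv 1 0 0 0 0).
Proof.
congr push_O; apply/funext => Q; rewrite /dv /pt_div.
by have [_|_] := eqVneq Q x0 => //; do !case: ifP.
Qed.

Lemma E22EP : E22 P = push_O 2 (dv 0 1 0 0 0).
Proof.
congr push_O; apply/funext => Q; rewrite /dv /pt_div.
have [[e1 _ _ _] _] := special_neq alpha4 alpha2.
have [->|_] := eqVneq Q x0; first by rewrite e1.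
by have [_|_] := eqVneq Q P; rewrite ?subr0 //; do !case: ifP.
Qed.

Lemma E22EY : E22 Y = push_O 2 (dv 0 0 0 1 0).
Proof.
congr push_O; apply/funext => Q; rewrite /dv /pt_div.
have [[_ _ e1 _] [[_ e2 _ e3 _] _]] := special_neq alpha4 alpha2.
have [->|_] := eqVneq Q x0; first by rewrite e1.
have [->|_] := eqVneq Q P; first by rewrite e2.
have [->|_] := eqVneq Q P'; first by rewrite e3.
by have [_|_] := eqVneq Q Y; rewrite ?subr0 //; do !case: ifP.
Qed.

Definition no1_form : {mpoly Fbar[3]} := 'X_2 * ('X_0 + 'X_2).
Definition no0_form : {mpoly Fbar[3]} := 'X_2 * 'X_0.
Lemma no1_formP : form 1 (1 + 1) no1_form.
Proof. by apply: formM; [|apply: formD]; apply: form_coord. Qed.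
Lemma no0_formP : form 1 (1 + 1) no0_form.
Proof. by apply: formM; apply: form_coord. Qed.

(** F_2-open sets that isolate, among the special points, the origin, the two
    points with x = 0 and the two points with x = 1. *)
Definition open_inf : xopen := form_open (far_formP 1).
Definition open_P : xopen := form_open no1_formP.
Definition open_Y : xopen := form_open no0_formP.

Lemma open_infP Q : oset open_inf Q -> generic Q \/ Q = x0.
Proof.
move=> fQ; have [gQ|gQ] := pselect (generic Q); [by left | right].
exact: far_form_special.
Qed.
Lemma open_inf_x0 : oset open_inf x0. Proof. exact: far_form_x0. Qed.

Lemma open_PE Q : oset open_P Q = (cz Q * (cx Q + cz Q) != 0) :> Prop.
Proof. by rewrite /= /no1_form !evC. Qed.
Lemma open_YE Q : oset open_Y Q = (cz Q * cx Q != 0) :> Prop.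
Proof. by rewrite /= /no0_form !evC. Qed.

Lemma open_PP Q : oset open_P Q -> generic Q \/ (Q = P \/ Q = P').
Proof.
rewrite open_PE; have [c1 c2 c3] := py_coord alpha4 alpha2.
have [d1 d2 d3] := py'_coord alpha4 alpha2.
case: (special_cases alpha4 alpha2 Q) => [gQ|->|h|[]->]; [by left | | by right | |].
- by rewrite cz_x0 mul0r eqxx.
- by rewrite c1 c3 addFF mulr0 eqxx.
- by rewrite d1 d3 addFF mulr0 eqxx.
Qed.

Lemma open_YP Q : oset open_Y Q -> generic Q \/ (Q = Y \/ Q = Y').
Proof.
rewrite open_YE; have [c1 c2 c3] := px_coord alpha4 alpha2.
have [d1 d2 d3] := px'_coord alpha4 alpha2.
case: (special_cases alpha4 alpha2 Q) => [gQ|->|[]->|h]; [by left | | | |by right].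
- by rewrite cz_x0 mul0r eqxx.
- by rewrite c1 mulr0 eqxx.
- by rewrite d1 mulr0 eqxx.
Qed.

Lemma open_P_in Q : Q = P \/ Q = P' -> oset open_P Q.
Proof.
have [c1 c2 c3] := px_coord alpha4 alpha2; have [d1 d2 d3] := px'_coord alpha4 alpha2.
by rewrite open_PE => -[]->; rewrite ?c1 ?c3 ?d1 ?d3 add0r mulr1 oner_neq0.
Qed.
Lemma open_Y_in Q : Q = Y \/ Q = Y' -> oset open_Y Q.
Proof.
have [c1 c2 c3] := py_coord alpha4 alpha2; have [d1 d2 d3] := py'_coord alpha4 alpha2.
by rewrite open_YE => -[]->; rewrite ?c1 ?c3 ?d1 ?d3 mulr1 oner_neq0.
Qed.

Lemma ordis_generic_dv a0 a1 a1' a2 a2' f R n : generic R ->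
  (forall Q, ordis Q (dv a0 a1 a1' a2 a2' Q) f) -> n = 0 -> ordis R n f.
Proof. by move=> gR h ->; have := h R; rewrite dv_special. Qed.

(** The generators are used near the origin, near the points with x = 0 and near
    those with x = 1 respectively. *)
Lemma gens_dv n0 n1 n1' n2 n2' a0 a1 a1' a2 a2' b0 b1 b1' b2 b2' c0 c1 c1' c2 c2'
    finf f0 f1 :
  (forall Q, ordis Q (dv a0 a1 a1' a2 a2' Q) finf) ->
  (forall Q, ordis Q (dv b0 b1 b1' b2 b2' Q) f0) ->
  (forall Q, ordis Q (dv c0 c1 c1' c2 c2' Q) f1) ->
  [&& a0 == - n0, b1 == - n1, b1' == - n1', c2 == - n2 & c2' == - n2'] ->
  gens (dv n0 n1 n1' n2 n2').
Proof.
move=> hinf h0 h1 /and5P[/eqP ea /eqP eb /eqP eb' /eqP ec /eqP ec'] Q.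
have hg R : generic R -> - dv n0 n1 n1' n2 n2' R = 0 by move=> gR; rewrite dv_special ?oppr0.
case: (special_cases alpha4 alpha2 Q) => [gQ|->|hQ|hQ].
- exists gen_open, finf; split=> // R gR; apply: ordis_generic_dv hinf _ => //; exact: hg.
- exists open_inf, finf; split; first exact: open_inf_x0.
  move=> R /open_infP[gR|->]; first by apply: ordis_generic_dv hinf _ => //; exact: hg.
  by have := hinf x0; rewrite !dvE ea.
- exists open_P, f0; split; first exact: open_P_in.
  move=> R /open_PP[gR|hR]; first by apply: ordis_generic_dv h0 _ => //; exact: hg.
  by have := h0 R; case: hR => ->; rewrite !dvE ?eb ?eb'.
exists open_Y, f1; split; first exact: open_Y_in.
move=> R /open_YP[gR|hR]; first by apply: ordis_generic_dv h1 _ => //; exact: hg.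
by have := h1 R; case: hR => ->; rewrite !dvE ?ec ?ec'.
Qed.

Lemma ordis_one : forall Q, ordis Q (dv 0 0 0 0 0 Q) (fun=> 1).
Proof.
move=> Q; rewrite (_ : dv 0 0 0 0 0 Q = 0).
  by apply: ordis_unit; [exact: regular1 | exact: oner_neq0].
by rewrite /dv; do !case: ifP.
Qed.

Lemma ordisMdv n0 n1 n1' n2 n2' m0 m1 m1' m2 m2' F G :
  (forall Q, ordis Q (dv n0 n1 n1' n2 n2' Q) F) ->
  (forall Q, ordis Q (dv m0 m1 m1' m2 m2' Q) G) ->
  forall Q, ordis Q (dv (n0 + m0) (n1 + m1) (n1' + m1') (n2 + m2) (n2' + m2') Q)
    (fun R => F R * G R).
Proof. by move=> hF hG Q; rewrite -dvD; apply: ordisM. Qed.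

Lemma ordisVdv n0 n1 n1' n2 n2' F : (forall Q, ordis Q (dv n0 n1 n1' n2 n2' Q) F) ->
  forall Q, ordis Q (dv (- n0) (- n1) (- n1') (- n2) (- n2') Q) (fun R => (F R)^-1).
Proof. by move=> hF Q; rewrite -dvN; apply: ordisV. Qed.

Let oMV := ordisVdv (ordis_M alpha4 alpha2).
(* x / (y + alpha) has a simple zero at the origin. *)
Let oinf := ordisMdv (ordis_x alpha4 alpha2) oMV.

Lemma gens20 : gens (dv (-1) 1 0 0 0).
Proof. by apply: (gens_dv oinf oMV ordis_one). Qed.
Lemma gens22_x0 : gens (dv 1 0 0 0 0).
Proof. by apply: (gens_dv (ordisVdv oinf) ordis_one ordis_one). Qed.
Lemma gens22_P : gens (dv 0 1 0 0 0).
Proof. by apply: (gens_dv ordis_one oMV ordis_one). Qed.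
Lemma gens22_Y : gens (dv 0 0 0 1 0).
Proof.
by apply: (gens_dv ordis_one ordis_one (ordisVdv (ordis_L' alpha4 alpha2))).
Qed.

(** ** The split bundle *)

Lemma sec1_make (U : xopen) (a : regfun U) : ~ oset U x0 ->
  exists s : sec E11 U, forall R, fv s R = a R.
Proof.
move=> Ux; have [a0 ra] := regfunP a.
have h : `[< divisor_on 1 (pt_div x0) U a >].
  apply/asboolP; split=> [R [UR|]|R UR _|R UR]; [exact: a0 | | exact: ra |].
    by rewrite /pt_div; case: eqP => // -> _; apply: a0.
  by rewrite /pt_div; case: eqP UR => // ->.
by exists (DivSec h).
Qed.

(** The function y / x has a simple pole at the origin. *)
Lemma sec1_make_inf (U : xopen) (a : regfun U) : U `<=` open_inf ->
  exists s : sec E11 U, forall R, fv s R = a R * (cy R / cx R).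
Proof.
move=> Uinf; have [a0 ra] := regfunP a.
have h : `[< divisor_on 1 (pt_div x0) U (fun R => a R * (cy R / cx R)) >].
  apply/asboolP; split=> [R [UR|]|R UR DR|R UR DR t ut].
  - by rewrite a0 ?mul0r.
  - by rewrite /pt_div; case: eqP => // -> _; rewrite cx_x0 invr0 !mulr0.
  - have gR : generic R.
      case: (open_infP (Uinf R UR)) => // R0; move: DR; rewrite R0 /pt_div eqxx.
      by move=> /eqP; rewrite oner_eq0.
    apply: regularMf; first exact: ra.
    have zR := generic_z gR; apply: regularMf; first exact: regular_y.
    by apply: regularV; [exact: regular_x | exact: generic_x].
  have R0 : R = x0 by apply/eqP; apply: contraT => R0; case: DR; rewrite /pt_div (negbTE R0).
  rewrite {}R0 in UR DR ut *; rewrite /pt_div eqxx.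
  have xr : cx x0 \in GF2 1 by rewrite cx_x0 rpred0.
  have yr : cy x0 \in GF2 1 by rewrite cy_x0 rpred1.
  have [k [rk k0 nk]] := uniformizer_unit gen_x0 xr yr ut.
  exists (fun R => a R * k R); first by apply: regularMf => //; apply: ra.
  apply: nearS (nearI (near_chart 1 x0) (nearI (xopen_near 1 UR) nk)) => S /=.
  rewrite chart_x0 => -[y0 [US et]] DS; rewrite expr1z et loc_x0.
  have gS : generic S.
    case: (open_infP (Uinf S US)) => // S0; move: DS; rewrite S0 eqxx.
    by move=> /eqP; rewrite oner_eq0.
  have x0' := generic_x gS.
  transitivity (a S * ((cy S / cy S) * (cx S / cx S)) * k S); first by ring.
  by rewrite !mulfV // !mulr1.
by exists (DivSec h).
Qed.

Lemma sec1_conj (U : xopen) (s : sec E11 U) R : generic R -> oset U R ->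
  conj (fv s) R = fv s R.
Proof.
move=> gR UR; have [_ rs _] := divsecP (s : divsec 1 (pt_div x0) U).
apply: conj_regular1; apply: rs => //; rewrite /pt_div; case: eqP => // R0.
by case: gen_x0; rewrite -R0.
Qed.

Lemma sec1_ordge (U : xopen) (s : sec E11 U) Q : oset U Q ->
  ordge Q (- dv 1 0 0 0 0 Q) (fv s).
Proof.
move=> UQ; have [_ rs ds] := divsecP (s : divsec 1 (pt_div x0) U).
have -> : dv 1 0 0 0 0 Q = pt_div x0 Q.
  by rewrite /dv /pt_div; have [_|_] := eqVneq Q x0 => //; do !case: ifP.
have [D0|/eqP D0] := eqVneq (pt_div x0 Q) 0.
  by rewrite D0 oppr0; apply: ordge_regular; apply: regular_sub1; apply: rs.
have Q0 : Q = x0 by apply/eqP; apply: contraT => Q0; case: D0; rewrite /pt_div (negbTE Q0).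
have u0 : uniformizer 1 x0 (loc x0).
  by apply: loc_uniformizer; rewrite ?cx_x0 ?cy_x0 ?rpred0 ?rpred1 //; apply: gen_x0.
rewrite {}Q0 in UQ D0 *; have [h rh nh] := ds x0 UQ D0 _ u0.
rewrite {1}/pt_div eqxx; exists h; first exact: regular_sub1.
apply: nearS (nearI (near_loc 2 x0) (near_sub1 2 nh)) => R /= [l0 e] gR.
have DR : pt_div x0 R = 0.
  by rewrite /pt_div; case: eqP => // R0; case: gen_x0; rewrite -R0.
move: (e DR); rewrite /pt_div eqxx expr1z => <-.
by rewrite exprN1 mulfK // l0.
Qed.

(** The isomorphism is s1 + alpha s2, since x0 is rational over F_2: the local
    generators 1 and y / x of O(x0) are functions on X. *)
Lemma dsum_iso : isomorphic (dsum E11 E11) (E22 x0).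
Proof.
rewrite E22E0.
pose S V (s : sec (dsum E11 E11) V) (t : sec (push_O 2 (dv 1 0 0 0 0)) V) :=
  forall R, generic R -> oset V R ->
    fv t R = fv (s.1 : sec E11 V) R + fv (s.2 : sec E11 V) R * alpha.
have spD := dv_special alpha4 alpha2 1 0 0 0 0.
have [||||||||u iu _] := @rel_iso _ _ S; last by exists u.
- by move=> V s t s' t' h h' R gR VR; rewrite fvD h // h' // !fvD; ring.
- by move=> V a s t h R gR VR; rewrite fvZ h // !fvZ; ring.
- by move=> U V VU s t h R gR VR; rewrite !fv_res // h //; apply: VU.
- move=> U s t h R gR UR; have [V [VU [VR hV]]] := h R UR.
  by have := hV R gR VR; rewrite !fv_res.
- by move=> V t h; apply: fv_ext => R gR VR; rewrite h // !fv0 mul0r addr0.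
- move=> V [s1 s2] h.
  have h12 R : generic R -> oset V R -> fv s1 R = 0 /\ fv s2 R = 0.
    move=> gR VR; have e : 0 = fv s1 R + fv s2 R * alpha := h R gR VR.
    have gF : generic (Frob R) by apply/generic_Frob.
    have VF : oset V (Frob R) by apply/open_Frob.
    have e' : 0 = fv s1 (Frob R) + fv s2 (Frob R) * alpha := h _ gF VF.
    have {}e' : fv s1 R + fv s2 R * (alpha + 1) = 0.
      rewrite -(sec1_conj s1 gR VR) -(sec1_conj s2 gR VR) -(alpha_sq alpha4 alpha2).
      by rewrite -(conj_cst R alpha4) -conjM -conjD /conj -e' sqrt2_0.
    have b0 : fv s2 R = 0.
      by move: e'; rewrite mulrDr addrA -e add0r mulr1.
    by move: e; rewrite b0 mul0r addr0.
  have -> : s1 = 0 by apply: fv_ext => R gR VR; rewrite fv0; have [] := h12 R gR VR.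
  have -> : s2 = 0 by apply: fv_ext => R gR VR; rewrite fv0; have [] := h12 R gR VR.
  by [].
- move=> U [s1 s2] Q UQ.
  have [R UR|t ht] := @fv_make _ spD U (fun R => fv s1 R + alpha * fv s2 R).
    by apply: ordgeD; [|apply: ordgeZ => //]; apply: sec1_ordge.
  exists U, (@subset_refl _ _), t; split=> // R gR UR.
  rewrite ht // [alpha * _]mulrC.
  by congr (_ + _ * _); apply/esym; apply: (@fv_res 1 (pt_div x0)).
move=> U t Q UQ; have [Q0|zQ] := affineP Q.
  pose W := form_open (formM (form_coord 1 1) (far_formP 1)).
  have Winf : W `<=` open_inf by move=> R /=; rewrite evM mulf_eq0 negb_or => /andP[].
  have Wy R : oset W R -> cy R != 0 by move=> /=; rewrite evM evX1 mulf_eq0 negb_or => /andP[].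
  pose V := meet U W; have VU : V `<=` U by move=> R [].
  have VI : V `<=` open_inf by move=> R [_ /Winf].
  have VQ : oset V Q.
    by split=> //=; rewrite Q0 evM evX1 cy_x0 mul1r; exact: far_form_x0.
  have [|a0 [a1 h]] := @split_regular alpha alpha4 alpha2 V (fun R => (cx R / cy R) * fv t R).
    move=> R [UR WR]; case: (open_infP (Winf _ WR)) => [gR|R0].
      have := fv_ordge spD t UR; rewrite spD // oppr0 => ot.
      have zR := generic_z gR.
      have rxy : regular_at 2 (fun S' => cx S' / cy S') R.
        apply: regularMf; first exact: regular_x.
        by apply: regularV; [exact: regular_y | exact: Wy].
      by have := ordgeM (ordge_regular rxy) ot; rewrite addr0.
    rewrite R0 in UR *; have := fv_ordge spD t UR; rewrite dvE => ot.
    have [oL _ _] := ordis_loc x0.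
    have {}oL : ordge x0 1 (fun S' => cx S' / cy S').
      by apply: ordge_ext oL => S' _; rewrite loc_x0.
    exact: ordgeM oL ot.
  have [s1 h1] := sec1_make_inf a0 VI; have [s2 h2] := sec1_make_inf a1 VI.
  exists V, VU, (s1, s2); split=> // R gR VR; rewrite fv_res //= h1 h2.
  have [e _] := h R gR VR; have y0 : cy R != 0 by case: VR => _ /Wy.
  have x0' := generic_x gR.
  transitivity (cx R / cy R * fv t R * (cy R / cx R)); last by rewrite e; ring.
  transitivity (fv t R * ((cx R / cx R) * (cy R / cy R))); last by ring.
  by rewrite !mulfV // !mulr1.
pose W := form_open (form_coord 1 2).
have Wz R : oset W R -> cz R = 1.
  by rewrite /= evX2; have [->|//] := affineP R; rewrite cz_x0 eqxx.
pose V := meet U W; have VU : V `<=` U by move=> R [].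
have VQ : oset V Q by split=> //=; rewrite evX2 zQ oner_neq0.
have Vx : ~ oset V x0 by move=> [_ /Wz/eqP]; rewrite cz_x0 eq_sym oner_eq0.
have [|a0 [a1 h]] := @split_regular alpha alpha4 alpha2 V (fv t).
  move=> R VR; have e : dv 1 0 0 0 0 R = 0.
    rewrite /dv; case: eqP => [R0|_]; first by rewrite R0 in VR.
    by do !case: ifP.
  by have := fv_ordge spD t (VU R VR); rewrite e oppr0.
have [s1 h1] := sec1_make a0 Vx; have [s2 h2] := sec1_make a1 Vx.
exists V, VU, (s1, s2); split=> // R gR VR; rewrite fv_res //= h1 h2.
by have [] := h R gR VR.
Qed.
End Bundles.

(** * Hecke modifications *)

(** ** Generalities on exact sequences *)

(** The local preimages are unique by injectivity, so they glue. *)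
Lemma image_glue (E F : xsheaf) (i : hom E F) (U : xopen) (s : sec F U) :
  (forall V, injective (i V)) -> in_image i s -> exists t, i U t = s.
Proof.
move=> inj im.
pose I := {W : xopen & {t : sec E W | exists WU : W `<=` U, i W t = res WU s}}.
pose W (j : I) := projT1 j.
have WU (j : I) : W j `<=` U by case: j => V [t []].
pose tj (j : I) : sec E (W j) := proj1_sig (projT2 j).
have ht j : i (W j) (tj j) = res (WU j) s.
  by rewrite /tj; case: (projT2 j) => t [WU' e] /=; rewrite e; apply: res_irr.
have cov : U `<=` \bigcup_j W j.
  move=> Q UQ; have [V [VU [t [VQ e]]]] := im Q UQ.
  by exists (existT _ V (exist _ t (ex_intro _ VU e))).
have [j k V Vj Vk|t [et _]] := @res_glue E U I W WU tj cov.
  apply: inj; rewrite !hom_res !ht !(res_comp _ _ (subset_trans Vj (WU j))).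
  exact: res_irr.
exists t; apply: sec_local => Q UQ; have [j _ jQ] := cov Q UQ.
by exists (W j), (WU j); rewrite -hom_res et ht.
Qed.

Definition sv P (U : xopen) (c : sec (sky P) U) : Fbar := skyval (c : skysec P U).

Lemma svD P U (c d : sec (sky P) U) : sv (c + d) = sv c + sv d. Proof. by []. Qed.
Lemma svZ P (U : xopen) (a : regfun U) (c : sec (sky P) U) : sv (a *: c) = a P * sv c.
Proof. by []. Qed.
Lemma sv0 P U : sv (0 : sec (sky P) U) = 0. Proof. by []. Qed.
Lemma sv_res P (U V : xopen) (VU : V `<=` U) (c : sec (sky P) U) :
  oset V P -> sv (res VU c) = sv c.
Proof. exact: (@skyresE P U V VU c). Qed.
Lemma sv_ext P (U : xopen) (c d : sec (sky P) U) : (oset U P -> sv c = sv d) -> c = d.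
Proof. exact: sky_eq_on. Qed.
Lemma sv_residue P (U : xopen) (c : sec (sky P) U) : residue P (sv c).
Proof. by case: (skysecP (c : skysec P U)). Qed.
Lemma sv_make P (U : xopen) a : residue P a -> oset U P ->
  exists c : sec (sky P) U, sv c = a.
Proof.
move=> ra UP; have h : `[< sky_on P U a >] by apply/asboolP; split.
by exists (SkySec h).
Qed.

Lemma regfun_make (U : xopen) f : (forall Q, oset U Q -> regular_at 1 f Q) ->
  exists a : regfun U, forall R, oset U R -> a R = f R.
Proof.
move=> rf; have h : `[< regular_on U (cut U f) >].
  apply/asboolP; split=> Q UQ; first exact: cut_out.
  apply: regular_near (rf Q UQ); apply: near_cut; exact: xopen_near.
by exists (RegFun h) => R UR /=; rewrite cut_in.
Qed.

Lemma regfun_local P g : regular_at 1 g P -> exists (U : xopen) (a : regfun U),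
  oset U P /\ forall R, oset U R -> a R = g R.
Proof.
move=> /regular_char[d [A [B [fA fB BP h]]]].
have [|a ha] := @regfun_make (form_open fB) g; last by exists (form_open fB), a.
by move=> Q BQ; apply/regular_char; exists d, A, B.
Qed.

Lemma res_sum (E : xsheaf) (U V : xopen) (VU : V `<=` U) I (r : seq I) (F : I -> sec E U) :
  res VU (\sum_(j <- r) F j) = \sum_(j <- r) res VU (F j).
Proof. by elim/big_rec2: _ => [|j y x _ <-]; rewrite ?res0 // resD. Qed.

(** The coordinates in a local basis vanish at the generic points, hence
    everywhere. *)
Lemma torsion_free n E (U : xopen) (s : sec E U) : vector_bundle n E ->
  (forall h : meet U gen_open `<=` U, res h s = 0) -> s = 0.
Proof.
move=> vb h0; apply: sec_local => Q UQ; have [W [WQ [e he]]] := vb Q.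
pose V := meet U W; have VU : V `<=` U by move=> R [].
have VW : V `<=` W by move=> R [].
exists V, VU; split=> //; rewrite res0.
have [a [ea _]] := he V VW (res VU s).
pose G := meet V gen_open; have GV : G `<=` V by move=> R [].
have GU : G `<=` meet U gen_open by move=> R [[]].
have UG : meet U gen_open `<=` U by move=> R [].
have GW : G `<=` W by move=> R [[]].
have r0 : res GV (res VU s) = 0.
  by rewrite (res_comp _ _ (subset_trans GV VU)) -(res_comp UG GU) h0 res0.
have [b [_ ub]] := he G GW 0.
have e0 : b = fun=> 0.
  by apply: ub; rewrite big1 // => j _; rewrite scale0r.
have ea' : b = fun j => restr GV (a j).
  apply: ub; transitivity (res GV (res VU s)); first by rewrite r0.
  rewrite ea res_sum; apply: eq_bigr => j _; rewrite resZ; congr (_ *: _).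
  exact: res_comp.
rewrite ea big1 // => j _; rewrite (_ : a j = 0) ?scale0r //.
apply: regfun_eq0 => R gR VR; have := congr1 (fun c : 'I_n -> regfun G => c j R) ea'.
by rewrite e0 /= cut_in.
Qed.

Lemma in_image_iso E F G (u : hom E F) (w : hom F G) (w' : hom G F) U (s : sec F U) :
  (forall U, cancel (w U) (w' U)) -> in_image (hom_comp w u) (w U s) <-> in_image u s.
Proof.
move=> k; split=> h Q UQ; have [V [VU [t [VQ e]]]] := h Q UQ; exists V, VU, t; split=> //.
  by apply: (can_inj (k V)); rewrite -hom_compE e hom_res.
by rewrite hom_compE e hom_res.
Qed.

Lemma exact_iso_mid E E1 F G (i : hom E F) (p : hom F G) (w : hom F E1) (w' : hom E1 F) :
  (forall U, cancel (w U) (w' U) /\ cancel (w' U) (w U)) ->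
  short_exact i p -> short_exact (hom_comp w i) (hom_comp p w').
Proof.
move=> ww [e1 e2 e3]; have k U : cancel (w U) (w' U) by case: (ww U).
have k' U : cancel (w' U) (w U) by case: (ww U).
split=> [U|U s|U s].
- by apply: inj_comp (e1 U); apply: can_inj (k U).
- by rewrite hom_compE e2 -[in X in _ <-> X](k' U s) (in_image_iso _ _ k).
move=> Q UQ; have [V [VU [t [VQ e]]]] := e3 U s Q UQ.
by exists V, VU, (w V t); split=> //; rewrite hom_compE k.
Qed.

Lemma exact_iso_sub E E1 F G (i : hom E F) (p : hom F G) (w : hom E1 E) (w' : hom E E1) :
  (forall U, cancel (w U) (w' U) /\ cancel (w' U) (w U)) ->
  short_exact i p -> short_exact (hom_comp i w) p.
Proof.
move=> ww [e1 e2 e3]; have k U : cancel (w U) (w' U) by case: (ww U).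
have k' U : cancel (w' U) (w U) by case: (ww U).
split=> // [U|U s]; first by apply: inj_comp (can_inj (k U)); apply: e1.
rewrite e2; split=> h Q UQ; have [V [VU [t [VQ e]]]] := h Q UQ.
  by exists V, VU, (w' V t); split=> //; rewrite hom_compE k'.
by exists V, VU, (w V t).
Qed.

Lemma vector_bundle_iso n E F : isomorphic E F -> vector_bundle n E -> vector_bundle n F.
Proof.
move=> [w [w' ww]] vb Q; have [U [UQ [e he]]] := vb Q; exists U; split=> //.
exists (fun j => w U (e j)) => V VU s; have [a [ea ua]] := he V VU (w' V s).
have [k k'] := ww V.
have sumE b : w V (\sum_j b j *: res VU (e j)) = \sum_j b j *: res VU (w U (e j)).
  by rewrite linear_sum; apply: eq_bigr => j _; rewrite linearZ -hom_res.
exists a; split; first by rewrite -sumE -ea k'.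
by move=> b eb; apply: ua; rewrite eb -sumE k.
Qed.

Lemma hecke_modification_iso n P E' E F : isomorphic E F ->
  hecke_modification n P E' E -> hecke_modification n P E' F.
Proof.
move=> EF [v1 v2 [i [p ip]]]; split=> //; first exact: vector_bundle_iso v2.
have [w [w' ww]] := EF.
by exists (hom_comp w i), (hom_comp p w'); apply: exact_iso_mid.
Qed.

(** The left terms are both the common kernel. The automorphism of K_x sends the
    image of s under one quotient map to its image under the other, which is
    well defined because the kernels agree. *)
Lemma iso_of_kernel P E (S T : hecke_seq P E) :
  (forall U s, hs_quo S U s = 0 <-> hs_quo T U s = 0) -> hecke_seq_iso S T.
Proof.
move=> ker; have [iS eS sS] := hs_exact S; have [iT eT sT] := hs_exact T.
pose A V s t := hs_inj T V t = hs_inj S V s.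
have [||||||||u iu hu] := @rel_iso (hs_sub S) (hs_sub T) A.
- by move=> V s t s' t' h h'; rewrite /A !linearD h h'.
- by move=> V a s t h; rewrite /A !linearZ h.
- by move=> U V VU s t h; rewrite /A !hom_res h.
- move=> U s t h; apply: sec_local => Q /h[V [VU [VQ e]]].
  by exists V, VU; split=> //; rewrite -!hom_res.
- by move=> V t h; apply: iT; rewrite h !linear0.
- by move=> V t h; apply: iS; rewrite -h !linear0.
- move=> U s Q UQ; have /eT : hs_quo T U (hs_inj S U s) = 0.
    apply/ker/eS => R UR; exists U, (@subset_refl _ _), s; split=> //.
    by rewrite res_id.
  move=> /(_ Q UQ)[V [VU [t [VQ e]]]].
  by exists V, VU, t; split=> //; rewrite /A e hom_res.
- move=> U s Q UQ; have /eS : hs_quo S U (hs_inj T U s) = 0.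
    apply/ker/eT => R UR; exists U, (@subset_refl _ _), s; split=> //.
    by rewrite res_id.
  move=> /(_ Q UQ)[V [VU [t [VQ e]]]].
  by exists V, VU, t; split=> //; rewrite /A e hom_res.
pose B V (c d : sec (sky P) V) := forall Q, oset V Q -> exists (W : xopen) (WV : W `<=` V) s,
  [/\ oset W Q, hs_quo S W s = res WV c & hs_quo T W s = res WV d].
have BD V c d c' d' : B V c d -> B V c' d' -> B V (c + c') (d + d').
  move=> h h' Q VQ; have [W [WV [s [WQ e1 e2]]]] := h Q VQ.
  have [W' [WV' [s' [WQ' e1' e2']]]] := h' Q VQ.
  have m1 : meet W W' `<=` W by move=> R [].
  have m2 : meet W W' `<=` W' by move=> R [].
  exists (meet W W'), (subset_trans m1 WV), (res m1 s + res m2 s'); split=> //.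
    rewrite linearD !hom_res e1 e1' resD !(res_comp _ _ (subset_trans m1 WV)) //.
  by rewrite linearD !hom_res e2 e2' resD !(res_comp _ _ (subset_trans m1 WV)).
have BZ V a c d : B V c d -> B V (a *: c) (a *: d).
  move=> h Q VQ; have [W [WV [s [WQ e1 e2]]]] := h Q VQ.
  by exists W, WV, (restr WV a *: s); rewrite !linearZ e1 e2 !resZ.
have Bres (U V : xopen) (VU : V `<=` U) c d : B U c d -> B V (res VU c) (res VU d).
  move=> h Q VQ; have [W [WU [s [WQ e1 e2]]]] := h Q (VU Q VQ).
  have m1 : meet W V `<=` W by move=> R [].
  have m2 : meet W V `<=` V by move=> R [].
  exists (meet W V), m2, (res m1 s); split=> //.
    by rewrite hom_res e1 !(res_comp _ _ (subset_trans m1 WU)).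
  by rewrite hom_res e2 !(res_comp _ _ (subset_trans m1 WU)).
have Bloc (U : xopen) c d : (forall Q, oset U Q -> exists (V : xopen) (VU : V `<=` U),
    oset V Q /\ B V (res VU c) (res VU d)) -> B U c d.
  move=> h Q UQ; have [V [VU [VQ hV]]] := h Q UQ.
  have [W [WV [s [WQ e1 e2]]]] := hV Q VQ.
  exists W, (subset_trans WV VU), s; split=> //.
    by rewrite e1 (res_comp _ _ (subset_trans WV VU)).
  by rewrite e2 (res_comp _ _ (subset_trans WV VU)).
have Bf V d : B V 0 d -> d = 0.
  move=> h; apply: sec_local => Q /h[W [WV [s [WQ e1 e2]]]].
  by exists W, WV; rewrite -e2 res0; split=> //; apply/ker; rewrite e1 res0.
have Bi V c : B V c 0 -> c = 0.
  move=> h; apply: sec_local => Q /h[W [WV [s [WQ e1 e2]]]].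
  by exists W, WV; rewrite -e1 res0; split=> //; apply/ker; rewrite e2 res0.
have Bex U s : B U (hs_quo S U s) (hs_quo T U s).
  move=> Q UQ; exists U, (@subset_refl _ _), s; split=> //; by rewrite res_id.
have [||v iv hv] := rel_iso BD BZ Bres Bloc Bf Bi.
- move=> U c Q UQ; have [V [VU [t [VQ e]]]] := sS U c Q UQ.
  by exists V, VU, (hs_quo T V t); rewrite -e.
- move=> U c Q UQ; have [V [VU [t [VQ e]]]] := sT U c Q UQ.
  by exists V, VU, (hs_quo S V t); rewrite -e.
exists u, v; split=> // U s.
exact: (rel_uniq BD BZ Bf (Bex U s) (hv U _)).
Qed.

Lemma hecke_seq_iso_kernel P E (S T : hecke_seq P E) U s : hecke_seq_iso S T ->
  hs_quo S U s = 0 <-> hs_quo T U s = 0.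
Proof.
move=> [u [v [_ iv _ hv]]]; rewrite hv; split=> [->|h]; first by rewrite linear0.
by apply: (iso_inj (U := U) iv); rewrite h linear0.
Qed.

Lemma hecke_seq_iso_sym P E (S T : hecke_seq P E) : hecke_seq_iso S T -> hecke_seq_iso T S.
Proof. by move=> h; apply: iso_of_kernel => U s; rewrite (hecke_seq_iso_kernel s h). Qed.

Lemma has_multiplicity_iso P E' E F m : isomorphic E F ->
  has_multiplicity P E' E m -> has_multiplicity P E' F m.
Proof.
move=> [w [w' ww]] [S [h1 h2 h3]].
have ww' U : cancel (w' U) (w U) /\ cancel (w U) (w' U) by case: (ww U).
pose tr (X : hecke_seq P E) := HeckeSeq (exact_iso_mid ww (hs_exact X)).
pose tr' (X : hecke_seq P F) := HeckeSeq (exact_iso_mid ww' (hs_exact X)).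
exists (fun j => tr (S j)); split=> [j|j k h|T iT].
- exact: h1.
- apply: h2; apply: iso_of_kernel => U s.
  have : hs_quo (S j) U (w' U (w U s)) = 0 <-> hs_quo (S k) U (w' U (w U s)) = 0.
    exact: (hecke_seq_iso_kernel (w U s) h).
  by have [k1 _] := ww U; rewrite k1.
have [j hj] := h3 (tr' T) iT; exists j; apply: iso_of_kernel => U s.
have : hs_quo T U (w U (w' U s)) = 0 <-> hs_quo (S j) U (w' U s) = 0.
  exact: (hecke_seq_iso_kernel (w' U s) hj).
by have [_ k1] := ww U; rewrite k1.
Qed.

(** ** The class of an extension of E' *)

Section Class.
Variable alpha : Fbar.
Hypotheses (alpha4 : alpha \in GF2 2) (alpha2 : alpha \notin GF2 1).

Notation P := (px alpha4 alpha2).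
Notation Y := (py alpha4 alpha2).
Notation P' := (Frob P).
Notation Y' := (Frob Y).
Notation dv := (dv alpha4 alpha2).
Notation D20 := (dv (-1) 1 0 0 0).
Notation E20 := (push_O 2 D20).

Let spD : special_div D20. Proof. exact: dv_special. Qed.
Let gP : ~ generic P. Proof. exact: gen_px. Qed.
Let gP' : ~ generic P'. Proof. exact: gen_px'. Qed.

Definition gcut (U : xopen) : xopen := meet U gen_open.
Lemma gcutS U : gcut U `<=` U. Proof. by move=> R []. Qed.
Lemma gcutP U R : generic R -> oset U R -> oset (gcut U) R. Proof. by []. Qed.

Lemma open_conj_P (U : xopen) : oset U P' -> oset U P. Proof. by move/open_Frob. Qed.

Lemma avoid_P Q : Q <> P -> Q <> P' -> exists U : xopen, oset U Q /\ ~ oset U P.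
Proof.
move=> QP QP'; have [[_ _ e1 e2] [[_ f1 f2 _ _] _]] := special_neq alpha4 alpha2.
case: (special_cases alpha4 alpha2 Q) => [gQ|->|[]//|hQ].
- by exists gen_open.
- exists open_inf; split; first exact: open_inf_x0.
  by move=> /open_infP[//|/eqP]; have [[+ _ _ _] _] := special_neq alpha4 alpha2;
    rewrite eq_sym => ->.
exists open_Y; split; first exact: (open_Y_in hQ).
by move=> /(open_YP alpha4 alpha2)[//|[/eqP|/eqP]]; rewrite ?f1 ?f2.
Qed.

(** The function y takes the value alpha at P, so b + r y with b and r in F_2
    takes every value in F_4. *)
Lemma residue_GF4 a : a \in GF2 2 -> residue P a.
Proof.
move=> a4; have [c1 c2 c3] := px_coord alpha4 alpha2.
pose r := (a + a ^+ 2); have as2 := alpha_sq alpha4 alpha2.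
have r1 : r \in GF2 1.
  by rewrite inE expn1 sqD -exprM (GF4P a4) addrC.
pose b := a + r * alpha; have b1 : b \in GF2 1.
  move: r1; rewrite !inE !expn1 => /eqP r1; rewrite /b sqD exprMn r1 as2; apply/eqP.
  transitivity (a ^+ 2 + (a + a ^+ 2) + r * alpha); first by rewrite -/r; ring.
  by apply: (@char2_eq (a ^+ 2)); ring.
exists (fun R => b + r * cy R).
  apply: regularDf; first exact: regular_cst.
  by apply: regularMf; [exact: regular_cst | exact: regular_y].
by rewrite c2 /b -addrA addFF addr0.
Qed.

Lemma sv_GF4 (U : xopen) (c : sec (sky P) U) : sv c \in GF2 2.
Proof.
have [f rf <-] := sv_residue c; have [xr yr] := special_rational gP.
exact: regular_value xr yr (regular_sub1 2 rf).
Qed.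

(** *** Polar parts *)

(** A section of a sheaf that contains E' with a quotient supported at x may have
    a further simple pole at P and at its conjugate. *)
Definition polar (U : xopen) (F : point -> Fbar) : Prop :=
  (forall Q, oset U Q -> Q <> P -> Q <> P' -> ordge Q (- D20 Q) F) /\
  (oset U P -> ordge P (-2) F /\ ordge P' (-1) F).

(** The two coordinates of the polar part. The pole at P' is read at P after
    conjugation, so that a function on X multiplies both coordinates by its
    value at P ([polZ]). *)
Definition pol1 F := lead P (-2) F.
Definition pol2 F := lead P (-1) (conj F).

Lemma polar_generic U F R : polar U F -> generic R -> oset U R -> regular_at 2 F R.
Proof.
move=> [h _] gR UR; apply: (ordge_generic gR (h R UR _ _)) => e.
  by case: gP; rewrite -e.
by case: (gP'); rewrite -e.
Qed.

Lemma polarD U F G : polar U F -> polar U G -> polar U (fun R => F R + G R).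
Proof.
move=> [f1 f2] [g1 g2]; split=> [Q UQ q q'|UP].
  by apply: ordgeD; [apply: f1 | apply: g1].
by have [? ?] := f2 UP; have [? ?] := g2 UP; split; apply: ordgeD.
Qed.

Lemma ordge_regfun (U : xopen) (a : regfun U) Q n F : oset U Q -> ordge Q n F ->
  ordge Q n (fun R => a R * F R).
Proof.
move=> UQ oF; rewrite -[n]add0r; apply: ordgeM => //; apply: ordge_regular.
by apply: regular_sub1; have [_] := regfunP a; apply.
Qed.

Lemma polarZ (U : xopen) (a : regfun U) F : polar U F -> polar U (fun R => a R * F R).
Proof.
move=> [f1 f2]; split=> [Q UQ q q'|UP]; first by apply: ordge_regfun => //; apply: f1.
have [? ?] := f2 UP; have UP' : oset U P' by apply/open_Frob.
by split; apply: ordge_regfun.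
Qed.

Lemma polar_sec (U : xopen) (f : sec E20 U) : polar U (fv f).
Proof.
split=> [Q UQ _ _|UP]; first exact: fv_ordge.
have UP' : oset U P' by apply/open_Frob.
have := fv_ordge spD f UP; have := fv_ordge spD f UP'; rewrite !dvE => o1 o2.
by split; [apply: ordgeW o2 | apply: ordgeW o1].
Qed.

Lemma pol_sec (U : xopen) (f : sec E20 U) : oset U P -> pol1 (fv f) = 0 /\ pol2 (fv f) = 0.
Proof.
move=> UP; have UP' : oset U P' by apply/open_Frob.
have [_ /(_ UP)[p1 p2]] := polar_sec f.
have := fv_ordge spD f UP; have := fv_ordge spD f UP'; rewrite !dvE => o1 o2.
split; first by apply/(lead_eq0 gP p1).
apply/(lead_eq0 gP (ordge_conj p2)).
exact: ordge_conj o1.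
Qed.

Lemma pol_ext (U : xopen) F G : (forall R, generic R -> oset U R -> F R = G R) ->
  polar U F -> oset U P -> pol1 F = pol1 G /\ pol2 F = pol2 G.
Proof.
move=> FG pF UP; have [_ /(_ UP)[p1 p2]] := pF; split; apply/esym.
  by apply: lead_near p1; apply: nearS (xopen_near 2 UP) => R UR gR; apply: FG.
apply: lead_near (ordge_conj p2); apply: nearS (xopen_near 2 UP) => R UR gR.
by rewrite /conj FG //; [apply/generic_Frob | apply/open_Frob].
Qed.

Lemma polD U F G : polar U F -> polar U G -> oset U P ->
  pol1 (fun R => F R + G R) = pol1 F + pol1 G /\
  pol2 (fun R => F R + G R) = pol2 F + pol2 G.
Proof.
move=> pF pG UP; have [_ /(_ UP)[f1 f2]] := pF; have [_ /(_ UP)[g1 g2]] := pG.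
split; first exact: leadD.
rewrite /pol2 -(leadD (ordge_conj f2) (ordge_conj g2)).
have -> : conj (fun R => F R + G R) = fun R => conj F R + conj G R.
  by apply/funext => R; rewrite conjD.
by [].
Qed.

Lemma polZ (U : xopen) (a : regfun U) F : polar U F -> oset U P ->
  pol1 (fun R => a R * F R) = a P * pol1 F /\ pol2 (fun R => a R * F R) = a P * pol2 F.
Proof.
move=> pF UP; have [_ /(_ UP)[f1 f2]] := pF.
have ra : regular_at 2 a P by apply: regular_sub1; have [_] := regfunP a; apply.
split; first exact: leadM0.
rewrite /pol2 -(leadM0 ra (ordge_conj f2)).
have -> // : conj (fun R => a R * F R) = fun R => a R * conj F R.
by apply/funext => R; rewrite conjM conj_regfun.
Qed.

Lemma pol_GF4 F : pol1 F \in GF2 2 /\ pol2 F \in GF2 2.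
Proof. by split; apply: lead_GF4; apply: gen_px. Qed.

(** If the first coordinate is zero there is no double pole at P, and if the
    second is zero the conjugate has no pole at P, so that F has none at P'. *)
Lemma polar_E20 (U : xopen) F : polar U F ->
  (oset U P -> pol1 F = 0 /\ pol2 F = 0) ->
  exists f : sec E20 U, forall R, generic R -> oset U R -> fv f R = F R.
Proof.
move=> pF h; have [f1 f2] := pF; apply: fv_make => // Q UQ.
have [QP|QP] := pselect (Q = P).
  rewrite QP in UQ *; rewrite dvE; have [o1 _] := f2 UQ; have [l1 _] := h UQ.
  exact: (iffLR (lead_eq0 gP o1) l1).
have [QP'|QP'] := pselect (Q = P'); last exact: f1.
rewrite QP' in UQ *; rewrite dvE; have UP := open_conj_P UQ.
have [_ o2] := f2 UP; have [_ l2] := h UP.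
have o3 : ordge P 0 (conj F) := iffLR (lead_eq0 gP (ordge_conj o2)) l2.
have o4 : ordge P' 0 (conj (conj F)).
  by apply: ordge_conj; rewrite FrobFrob_px.
apply: ordge_near o4; apply: nearS (xopen_near 2 UQ) => R UR gR.
exact: conjK (polar_generic pF gR UR).
Qed.

(** *** Rational functions attached to sections *)

Section Extension.
Variables (E : xsheaf) (i : hom E20 E) (p : hom E (sky P)).
Hypotheses (vbE : vector_bundle 2 E) (ip : short_exact i p).

Lemma ext_inj U : injective (i U). Proof. by case: ip. Qed.

Lemma ext_image U s : p U s = 0 -> exists f, i U f = s.
Proof.
by case: ip => h1 h2 _ /h2 h; apply: image_glue h => V; apply: ext_inj.
Qed.

Lemma ext_image0 U f : p U (i U f) = 0.
Proof.
case: ip => _ h2 _; apply/h2 => Q UQ; exists U, (@subset_refl _ _), f.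
by rewrite res_id.
Qed.

Lemma ext_avoid U s : ~ oset U P -> exists f, i U f = s.
Proof. by move=> UP; apply: ext_image; apply: sv_ext. Qed.

(** E agrees with E' away from x, so a section of E is given by a rational
    function. *)
Definition rep U (s : sec E U) (F : point -> Fbar) : Prop :=
  exists2 f : sec E20 (gcut U), i (gcut U) f = res (@gcutS U) s &
    forall R, generic R -> oset U R -> fv f R = F R.

Lemma rep_exists U s : exists F, @rep U s F.
Proof.
have [|f ef] := @ext_avoid (gcut U) (res (@gcutS U) s).
  by move=> [_ /gen_px].
by exists (fv f), f.
Qed.

Lemma rep_uniq U s F G : @rep U s F -> @rep U s G ->
  forall R, generic R -> oset U R -> F R = G R.
Proof.
move=> [f ef hf] [g eg hg] R gR UR; rewrite -hf // -hg //.
by have -> : f = g by apply: ext_inj; rewrite ef eg.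
Qed.

Lemma rep_ext U s F G : (forall R, generic R -> oset U R -> F R = G R) ->
  @rep U s F -> @rep U s G.
Proof. by move=> FG [f ef hf]; exists f => // R gR UR; rewrite hf ?FG. Qed.

Lemma rep_i U f : @rep U (i U f) (fv f).
Proof. by exists (res (@gcutS U) f); [rewrite hom_res | move=> R gR UR; rewrite fv_res]. Qed.

Lemma repD U s t F G : @rep U s F -> @rep U t G -> @rep U (s + t) (fun R => F R + G R).
Proof.
move=> [f ef hf] [g eg hg]; exists (f + g); first by rewrite linearD ef eg resD.
by move=> R gR UR; rewrite fvD hf ?hg.
Qed.

Lemma repZ (U : xopen) (a : regfun U) s F : @rep U s F -> @rep U (a *: s) (fun R => a R * F R).
Proof.
move=> [f ef hf]; exists (restr (@gcutS U) a *: f); first by rewrite linearZ ef resZ.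
by move=> R gR UR; rewrite fvZ hf //= cut_in.
Qed.

Lemma rep_res (U V : xopen) (VU : V `<=` U) s F : @rep U s F -> @rep V (res VU s) F.
Proof.
move=> [f ef hf]; have S : gcut V `<=` gcut U by move=> R [/VU].
exists (res S f); last by move=> R gR VR; rewrite fv_res // hf //; apply: VU.
by rewrite hom_res ef !(res_comp _ _ (subset_trans S (@gcutS U))).
Qed.

Lemma rep_0 U s F : @rep U s F -> (forall R, generic R -> oset U R -> F R = 0) -> s = 0.
Proof.
move=> [f ef hf] F0; apply: torsion_free vbE _ => h; rewrite (res_irr h (@gcutS U)) -ef.
rewrite (_ : f = 0) ?linear0 //; apply: fv_ext => R gR [UR _].
by rewrite hf // F0.
Qed.

Lemma rep_inj U s t F : @rep U s F -> @rep U t F -> s = t.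
Proof.
move=> hs ht; apply/subr0_eq; apply: (rep_0 (F := fun R => F R + (- 1 : regfun U) R * F R)).
  by rewrite -scaleN1r; apply: repD => //; apply: repZ.
by move=> R gR UR; rewrite -[(- 1 : regfun U) R]/(- ((1 : regfun U) R)) regfun1 // mulN1r addrN.
Qed.

Lemma rep_section U s F (f : sec E20 U) : @rep U s F ->
  (forall R, generic R -> oset U R -> fv f R = F R) -> i U f = s.
Proof.
by move=> hs hf; apply: rep_inj hs; apply: rep_ext hf _; apply: rep_i.
Qed.

Lemma rep_polar U s F : @rep U s F -> polar U F.
Proof.
move=> hs; split=> [Q UQ QP QP'|UP].
  have [W [WQ WP]] := avoid_P QP QP'.
  have VU : meet U W `<=` U by move=> R [].
  have [|f ef] := @ext_avoid (meet U W) (res VU s); first by move=> [_].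
  have VQ : oset (meet U W) Q by [].
  have h := rep_uniq (rep_res VU hs); apply: ordge_near (fv_ordge spD f VQ).
  apply: nearS (xopen_near 2 VQ) => R VR gR; apply/esym; apply: h => //.
  by rewrite -ef; apply: rep_i.
(* The function x vanishes at P and at P', so it multiplies s into E'. *)
pose V := meet U (form_open (form_coord 1 2)).
have VU : V `<=` U by move=> R [].
have Vz R : oset V R -> cz R = 1.
  by move=> [_] /=; rewrite evX2; have [->|//] := affineP R; rewrite cz_x0 eqxx.
have [a ha] := @regfun_make V cx (fun Q VQ => regular_x 1 (Vz Q VQ)).
have [c1 c2 c3] := px_coord alpha4 alpha2.
have VP : oset V P by split=> //=; rewrite evX2 c3 oner_neq0.
have VP' : oset V P' by apply/open_Frob.
have [|f ef] := @ext_image V (a *: res VU s).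
  by rewrite linearZ; apply: sv_ext => _; rewrite svZ ha // c1 mul0r.
have hF R : generic R -> oset V R -> fv f R = cx R * F R.
  move=> gR VR; rewrite -ha //.
  apply: (rep_uniq _ (repZ a (rep_res VU hs))) => //; rewrite -ef; exact: rep_i.
have key Q n : oset V Q -> ordis Q 1 cx -> - D20 Q = n + 1 -> ordge Q n F.
  move=> VQ [_ o2 o3] eD; have := ordgeM o2 (fv_ordge spD f VQ).
  rewrite eD addrCA addNr addr0; apply: ordge_near.
  apply: nearS (nearI o3 (xopen_near 2 VQ)) => R /= [x0' VR] gR.
  by rewrite hF // mulrA mulVf ?mul1r // x0'.
have ox := ordis_x alpha4 alpha2.
by split; apply: key => //; rewrite ?dvE //; have := ox P; have := ox P'; rewrite !dvE.
Qed.

(** E' is the kernel of p, and it consists of the functions without polar part.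
    *)
Lemma rep_kernel U s F : @rep U s F -> oset U P ->
  p U s = 0 <-> pol1 F = 0 /\ pol2 F = 0.
Proof.
move=> hs UP; have pF := rep_polar hs; split=> [/ext_image[f ef]|h].
  have [<- <-] := pol_ext (rep_uniq (rep_i f) (eq_rect_r (fun t => rep t F) hs ef)) (polar_sec f) UP.
  exact: pol_sec.
have [f hf] := polar_E20 pF (fun _ => h).
by rewrite -(rep_section hs hf) ext_image0.
Qed.

(** The vector (c1, c2) depends on p only up to a scalar; its line is the
    invariant of the extension. *)
Definition has_class (c1 c2 : Fbar) : Prop := forall U s F, @rep U s F -> oset U P ->
  pol1 F = sv (p U s) * c1 /\ pol2 F = sv (p U s) * c2.

Lemma residue_lift a : a \in GF2 2 -> exists (U : xopen) (s : sec E U),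
  oset U P /\ sv (p U s) = a.
Proof.
move=> a4; have [c1 c2 c3] := px_coord alpha4 alpha2.
pose W := form_open (form_coord 1 2).
have WP : oset W P by rewrite /= evX2 c3 oner_neq0.
have [c hc] := sv_make (residue_GF4 a4) WP; case: ip => _ _ sp.
have [V [VW [t [VP e]]]] := sp W c P WP; exists V, t; split=> //.
by rewrite e sv_res.
Qed.

(** The polar part is linear over the functions on X and has the same kernel as
    the quotient map onto K_x; hence it is a fixed multiple of it. *)
Lemma class_exists : exists c1 c2, [/\ c1 \in GF2 2, c2 \in GF2 2,
  ~~ ((c1 == 0) && (c2 == 0)) & has_class c1 c2].
Proof.
have [W [e [WP he]]] := residue_lift (rpred1 _); have [Fe re] := rep_exists e.
have [g1 g2] := pol_GF4 Fe.
exists (pol1 Fe), (pol2 Fe); split=> //.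
  apply/negP => /andP[/eqP z1 /eqP z2].
  have : p W e = 0 by apply/(rep_kernel re WP).
  by move=> h; move: he; rewrite h sv0 => /eqP; rewrite eq_sym oner_eq0.
move=> U s F hs UP; have [g rg eg] := sv_residue (p U s).
have [G [a [GP ha]]] := regfun_local rg.
pose V := meet (meet U W) G.
have VU : V `<=` U by move=> R [[]]. have VW : V `<=` W by move=> R [[]].
have VG : V `<=` G by move=> R [].
have VP : oset V P by [].
pose b := restr VG a; have bP : b P = sv (p U s) by rewrite /b /= cut_in // ha.
have h1 := rep_res VU hs; have h2 := repZ b (rep_res VW re).
have h3 := repD h1 h2.
have : p V (res VU s + b *: res VW e) = 0.
  rewrite linearD linearZ !hom_res; apply: sv_ext => _.
  by rewrite svD svZ !sv_res // he bP mulr1 addFF.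
move=> /(rep_kernel h3 VP).
have pe := rep_polar (rep_res VW re).
have [-> ->] := polD (rep_polar h1) (polarZ b pe) VP.
have [-> ->] := polZ b pe VP; rewrite bP => -[/eqP + /eqP].
by rewrite !addF_eq0 => /eqP -> /eqP ->.
Qed.
End Extension.

(** An extension is recovered from its class, as the sheaf of the rational
    functions whose polar part is a multiple of the class; proportional vectors
    define the same sheaf. *)
Lemma class_iso E1 E2 (i1 : hom E20 E1) (p1 : hom E1 (sky P)) (i2 : hom E20 E2)
    (p2 : hom E2 (sky P)) c1 c2 m :
  vector_bundle 2 E1 -> vector_bundle 2 E2 -> short_exact i1 p1 -> short_exact i2 p2 ->
  m \in GF2 2 -> m != 0 ->
  has_class i1 p1 (m * c1) (m * c2) -> has_class i2 p2 c1 c2 -> isomorphic E1 E2.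
Proof.
move=> v1 v2 ip1 ip2 m4 m0 h1 h2.
pose S V s t := exists F, rep i1 (U := V) s F /\ rep i2 (U := V) t F.
have total F1 F2 (j1 : hom E20 F1) (q1 : hom F1 (sky P)) (j2 : hom E20 F2)
    (q2 : hom F2 (sky P)) d1 d2 l : vector_bundle 2 F1 -> vector_bundle 2 F2 ->
    short_exact j1 q1 -> short_exact j2 q2 ->
    l \in GF2 2 -> has_class j1 q1 (l * d1) (l * d2) -> has_class j2 q2 d1 d2 ->
    forall (U : xopen) s Q, oset U Q -> exists (V : xopen) (VU : V `<=` U) t, oset V Q /\
      exists F, rep j1 (U := V) (res VU s) F /\ rep j2 (U := V) t F.
  move=> w1 w2 jq1 jq2 l4 k1 k2 U s Q UQ.
  have [QPP|] := pselect (Q = P \/ Q = P'); last first.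
    move=> /not_orP[QP QP']; have [W [WQ WP]] := avoid_P QP QP'.
    have VU : meet U W `<=` U by move=> R [].
    have [|f ef] := ext_avoid jq1 (U := meet U W) (res VU s); first by move=> [_].
    exists (meet U W), VU, (j2 _ f); split=> //; exists (fv f); split; last exact: rep_i.
    by rewrite -ef; apply: rep_i.
  have UP : oset U P by case: QPP UQ => -> // /open_conj_P.
  have [F rF] := rep_exists jq1 s; have [e1 e2] := k1 _ _ _ rF UP.
  have [W [t [WP ht]]] := residue_lift jq2 (rpredM l4 (sv_GF4 (q1 U s))).
  have [G rG] := rep_exists jq2 t; have [g1 g2] := k2 _ _ _ rG WP.
  pose V := meet U W; have VU : V `<=` U by move=> R []. have VW : V `<=` W by move=> R [].
  have VP : oset V P by []. have VP' : oset V P' by apply/open_Frob.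
  have pF := rep_polar jq1 (rep_res VU rF); have pG := rep_polar jq2 (rep_res VW rG).
  have [|f hf] := polar_E20 (polarD pF pG).
    move=> _; have [-> ->] := polD pF pG VP; rewrite e1 e2 g1 g2 ht.
    by split; rewrite mulrA [_ * l]mulrC addFF.
  exists V, VU, (res VW t + j2 V f); split; first by case: QPP => ->.
  exists F; split; first exact: rep_res.
  have := repD (rep_res VW rG) (rep_i j2 f); apply: rep_ext => R gR VR.
  by rewrite hf // addrCA addFF addr0.
have [||||||||u iu _] := @rel_iso E1 E2 S; last by exists u.
- move=> V s t s' t' [F [r1 r2]] [F' [r1' r2']]; exists (fun R => F R + F' R).
  by split; apply: repD.
- by move=> V a s t [F [r1 r2]]; exists (fun R => a R * F R); split; apply: repZ.
- by move=> U V VU s t [F [r1 r2]]; exists F; split; apply: rep_res.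
- move=> U s t h; have [F rF] := rep_exists ip1 s; have [G rG] := rep_exists ip2 t.
  exists F; split=> //; apply: (rep_ext _ rG) => R gR UR.
  have [V [VU [VR [H [r1 r2]]]]] := h R UR.
  rewrite (rep_uniq ip1 (rep_res VU rF) r1 gR VR).
  exact: (rep_uniq ip2 (rep_res VU rG) r2 gR VR).
- move=> V t [F [r1 r2]]; apply: (rep_0 v2 r2) => R gR VR.
  have z := rep_i i1 (0 : sec E20 V); rewrite linear0 in z.
  by rewrite (rep_uniq ip1 r1 z gR VR) fv0.
- move=> V t [F [r1 r2]]; apply: (rep_0 v1 r1) => R gR VR.
  have z := rep_i i2 (0 : sec E20 V); rewrite linear0 in z.
  by rewrite (rep_uniq ip2 r2 z gR VR) fv0.
- exact: (@total _ _ _ _ _ _ c1 c2 m v1 v2 ip1 ip2 m4 h1 h2).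
move=> U t Q UQ.
have h2' : has_class i2 p2 (m^-1 * (m * c1)) (m^-1 * (m * c2)) by rewrite !mulKf.
have [V [VU [s [VQ [F [r2 r1]]]]]] := @total _ _ _ _ _ _ (m * c1) (m * c2) m^-1 v2 v1 ip2 ip1 (GF4V m4) h2' h1 U t Q UQ.
by exists V, VU, s; split=> //; exists F.
Qed.
End Class.

(** ** Explicit extensions of E' *)

(** The map [tw u v] embeds E' in O(D), and [tw A B], inverse to it over the
    generic points, turns a section of O(D) into a rational function with poles
    as in an extension of E'. If these functions have polar parts on the line of
    (c1, c2), not all zero, then the coordinate along that line is a quotient
    map onto K_x with kernel E'. *)
Section Build.
Variable alpha : Fbar.
Hypotheses (alpha4 : alpha \in GF2 2) (alpha2 : alpha \notin GF2 1).

Notation P := (px alpha4 alpha2).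
Notation P' := (Frob P).
Notation dv := (dv alpha4 alpha2).
Notation D20 := (dv (-1) 1 0 0 0).
Notation E20 := (push_O 2 D20).
Notation polar := (polar alpha4 alpha2).
Notation pol1 := (pol1 alpha4 alpha2).
Notation pol2 := (pol2 alpha4 alpha2).

Let sp20 : special_div D20. Proof. exact: dv_special. Qed.

Variables (D : point -> int) (u v A B : point -> Fbar) (c1 c2 : Fbar).
Hypotheses (spD : special_div D)
  (ou : forall Q, ordge Q (D20 Q - D Q) u)
  (ov : forall Q, ordge Q (D20 (Frob Q) - D Q) v)
  (oA : forall Q, ordge Q (D Q - dv (-1) 2 1 0 0 Q) A)
  (oB : forall Q, ordge Q (D (Frob Q) - dv (-1) 2 1 0 0 Q) B)
  (AB1 : forall R, generic R -> A R * u R + B R * conj v R = 1)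
  (AB2 : forall R, generic R -> A R * v R + B R * conj u R = 0)
  (uv1 : forall R, generic R -> u R * A R + v R * conj B R = 1)
  (uv2 : forall R, generic R -> u R * B R + v R * conj A R = 0)
  (c_neq0 : ~~ ((c1 == 0) && (c2 == 0))) (c14 : c1 \in GF2 2) (c24 : c2 \in GF2 2)
  (hpol : forall U (s : sec (push_O 2 D) U), oset U P ->
     c2 * pol1 (tw A B (fv s)) = c1 * pol2 (tw A B (fv s)))
  (hsur : exists U (s : sec (push_O 2 D) U), oset U P /\
     ~~ ((pol1 (tw A B (fv s)) == 0) && (pol2 (tw A B (fv s)) == 0))).

Notation E := (push_O 2 D).
Let Psi U (s : sec E U) := tw A B (fv s).

Lemma Psi_ordge U (s : sec E U) Q : oset U Q -> ordge Q (- dv (-1) 2 1 0 0 Q) (Psi s).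
Proof. by move=> UQ; apply: tw_ordge. Qed.

Lemma Psi_polar U (s : sec E U) : polar U (Psi s).
Proof.
split=> [Q UQ QP QP'|UP].
  have := Psi_ordge s UQ; congr (ordge Q (- _) _); rewrite /dv.
  by case: eqP => // _; case: eqP => // _; case: eqP.
have UP' : oset U P' by apply/open_Frob.
by have := Psi_ordge s UP; have := Psi_ordge s UP'; rewrite !dvE.
Qed.

Lemma PsiD U (s t : sec E U) : Psi (s + t) = fun R => Psi s R + Psi t R.
Proof. by apply/funext => R; rewrite /Psi -twD. Qed.
Lemma PsiZ (U : xopen) (a : regfun U) (s : sec E U) : Psi (a *: s) = fun R => a R * Psi s R.
Proof. by apply/funext => R; rewrite /Psi -tw_regfun. Qed.

(** The coordinate of the polar part along (c1, c2). *)
Definition kap F := if c1 != 0 then pol1 F / c1 else pol2 F / c2.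

Lemma kapE U (s : sec E U) : oset U P ->
  pol1 (Psi s) = kap (Psi s) * c1 /\ pol2 (Psi s) = kap (Psi s) * c2.
Proof.
move=> UP; have := hpol s UP; rewrite -/(Psi s) /kap.
have [c10|c10] := eqVneq c1 0 => /=.
  have c20 : c2 != 0 by move: c_neq0; rewrite c10 eqxx.
  rewrite c10 mul0r mulr0 => /eqP; rewrite mulf_eq0 (negbTE c20) /= => /eqP ->.
  by rewrite divfK.
move=> e; rewrite divfK //; split=> //; apply: (mulfI c10).
by rewrite -e mulrA [c1 * (_ / _)]mulrC divfK // mulrC.
Qed.

Lemma kapD U (s t : sec E U) : oset U P -> kap (Psi (s + t)) = kap (Psi s) + kap (Psi t).
Proof.
move=> UP; rewrite /kap PsiD; have [-> ->] := polD (Psi_polar s) (Psi_polar t) UP.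
by case: ifP => _; rewrite mulrDl.
Qed.
Lemma kapZ (U : xopen) (a : regfun U) (s : sec E U) : oset U P ->
  kap (Psi (a *: s)) = a P * kap (Psi s).
Proof.
move=> UP; rewrite /kap PsiZ; have [-> ->] := polZ a (Psi_polar s) UP.
by case: ifP => _; rewrite mulrA.
Qed.

Lemma kap_residue U (s : sec E U) : residue P (kap (Psi s)).
Proof.
have [h1 h2] := pol_GF4 alpha4 alpha2 (Psi s).
by apply: residue_GF4; rewrite /kap; case: ifP => _; rewrite rpredM // GF4V.
Qed.

Lemma quo_subproof U (s : sec E U) :
  `[< sky_on P U (if `[< oset U P >] then kap (Psi s) else 0) >].
Proof.
apply/asboolP; split=> [|UP]; last by rewrite asboolF.
by case: ifP => _; [exact: kap_residue | exact: residue0].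
Qed.
Definition quo_fun U (s : sec E U) : sec (sky P) U := SkySec (quo_subproof s).

Lemma sv_quo U (s : sec E U) : oset U P -> sv (quo_fun s) = kap (Psi s).
Proof. by move=> UP; rewrite /sv /= asboolT. Qed.

Lemma quo_funD U (s t : sec E U) : quo_fun (s + t) = quo_fun s + quo_fun t.
Proof. by apply: sv_ext => UP; rewrite svD !sv_quo // kapD. Qed.
Lemma quo_funZ (U : xopen) (a : regfun U) (s : sec E U) :
  quo_fun (a *: s) = a *: quo_fun s.
Proof. by apply: sv_ext => UP; rewrite svZ !sv_quo // kapZ. Qed.
Lemma quo_fun_res (U V : xopen) (VU : V `<=` U) (s : sec E U) :
  quo_fun (res VU s) = res VU (quo_fun s).
Proof.
apply: sv_ext => VP; rewrite sv_res // !sv_quo //; last exact: VU.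
have [|||e1 e2] := @pol_ext alpha alpha4 alpha2 V (Psi (res VU s)) (Psi s).
- by move=> R gR VR; apply: (tw_on _ _ gR VR) => S gS VS; rewrite fv_res.
- exact: Psi_polar.
- exact: VP.
by rewrite /kap e1 ?e2.
Qed.

Definition quo_hom : hom E (sky P) :=
  @Hom E (sky P) (fun U => mk_linear (@quo_funD U) (@quo_funZ U)) quo_fun_res.

Lemma quo_homE U (s : sec E U) : quo_hom U s = quo_fun s. Proof. by []. Qed.

Lemma Psi_Phi f R : generic R -> (forall S, generic S -> S = R -> regular_at 2 f S) ->
  tw A B (tw u v f) R = f R.
Proof.
move=> gR rf; rewrite /tw conjD !conjM conjK; last exact: rf.
transitivity ((A R * u R + B R * conj v R) * f R + (A R * v R + B R * conj u R) * conj f R).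
  by ring.
by rewrite AB1 // AB2 // mul1r mul0r addr0.
Qed.

Lemma Phi_Psi f R : generic R -> regular_at 2 f R -> tw u v (tw A B f) R = f R.
Proof.
move=> gR rf; rewrite /tw conjD !conjM conjK //.
transitivity ((u R * A R + v R * conj B R) * f R + (u R * B R + v R * conj A R) * conj f R).
  by ring.
by rewrite uv1 // uv2 // mul1r mul0r addr0.
Qed.

Lemma build_extension : exists (i : hom E20 E) (p : hom E (sky P)),
  [/\ short_exact i p, has_class i p c1 c2,
      forall U (f : sec E20 U) R, generic R -> oset U R -> fv (i U f) R = tw u v (fv f) R
    & forall U (s : sec E U), rep i s (tw A B (fv s))].
Proof.
have [i hi] := twist_hom sp20 spD ou ov.
have hK U (f : sec E20 U) R : generic R -> oset U R -> Psi (i U f) R = fv f R.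
  move=> gR UR; rewrite /Psi (tw_on _ _ gR UR (hi U f)) Psi_Phi // => S _ ->.
  exact: fv_regular.
have hrep U (s : sec E U) : rep i s (Psi s).
  have [Q [UQ gQ]|f hf] := @fv_make _ sp20 (gcut U) (Psi s).
    by have := Psi_ordge s UQ; rewrite !dv_special.
  exists f; last by move=> R gR UR; apply: hf.
  apply: fv_ext => R gR [UR _]; rewrite hi // fv_res //.
  rewrite (tw_on _ _ gR (gcutP gR UR) hf) Phi_Psi //; exact: fv_regular.
have inj U : injective (i U).
  by move=> f g fg; apply: fv_ext => R gR UR; rewrite -hK // fg hK.
exists i, quo_hom; split=> //; last first.
  move=> U s F hs UP; have pS := Psi_polar s.
  have FG : forall R, generic R -> oset U R -> Psi s R = F R.
    have [f1 e1 h1] := hrep U s; have [f2 e2 h2] := hs.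
    by move=> R gR UR; rewrite -h1 // -h2 // (inj _ f1 f2) // e1 e2.
  have [<- <-] := pol_ext FG pS UP; rewrite quo_homE sv_quo //.
  exact: kapE.
split=> // U s; last first.
  move=> Q UQ; have [QPP|/not_orP[QP QP']] := pselect (Q = P \/ Q = P'); last first.
    have [W [WQ WP]] := avoid_P QP QP'; have VU : meet U W `<=` U by move=> R [].
    exists (meet U W), VU, 0; split=> //; rewrite linear0.
    by apply: sv_ext => -[_ /WP].
  have UP : oset U P by case: QPP UQ => -> // /open_conj_P.
  have [W [s0 [WP ns0]]] := hsur.
  have k0 : kap (Psi s0) != 0.
    apply: contra ns0 => /eqP k0; have [e1 e2] := kapE s0 WP.
    by rewrite -/(Psi s0) e1 e2 k0 !mul0r eqxx.
  have k4 : kap (Psi s0) \in GF2 2.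
    by have := sv_GF4 (quo_fun s0); rewrite sv_quo.
  have [g rg eg] := residue_GF4 alpha4 alpha2 (rpredM (sv_GF4 s) (GF4V k4)).
  have [G [a [GP ha]]] := regfun_local rg.
  pose V := meet (meet U W) G.
  have VU : V `<=` U by move=> R [[]]. have VW : V `<=` W by move=> R [[]].
  have VG : V `<=` G by move=> R [].
  have VP : oset V P by []. have VP' : oset V P' by apply/open_Frob.
  exists V, VU, (restr VG a *: res VW s0); split; first by case: QPP => ->.
  rewrite linearZ hom_res; apply: sv_ext => _; rewrite svZ !sv_res // quo_homE sv_quo //.
  by rewrite /= cut_in // ha // eg divfK.
split=> [q0|im].
  have [UP|UP] := pselect (oset U P); last first.
    have [//|f hf] := polar_E20 (Psi_polar s).
    move=> Q UQ; exists U, (@subset_refl _ _), f; split=> //.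
    rewrite res_id; apply: fv_ext => R gR UR; rewrite hi //.
    by rewrite (tw_on _ _ gR UR hf) Phi_Psi //; apply: fv_regular.
  have k0 : kap (Psi s) = 0 by rewrite -sv_quo // -quo_homE q0 sv0.
  have [_|f hf] := polar_E20 (Psi_polar s).
    by have [-> ->] := kapE s UP; rewrite k0 !mul0r.
  move=> Q UQ; exists U, (@subset_refl _ _), f; split=> //.
  rewrite res_id; apply: fv_ext => R gR UR; rewrite hi //.
  by rewrite (tw_on _ _ gR UR hf) Phi_Psi //; apply: fv_regular.
apply: sv_ext => UP; have [V [VU [f [VP e]]]] := im P UP.
rewrite sv0 -(sv_res VU) // -hom_res -e quo_homE sv_quo //.
have [e1 e2] := pol_ext (hK V f) (Psi_polar _) VP.
have [z1 z2] := pol_sec f VP.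
by rewrite /kap e1 e2 z1 z2 !mul0r; case: ifP.
Qed.
End Build.

(** ** The five classes *)

Section Explicit.
Variable alpha : Fbar.
Hypotheses (alpha4 : alpha \in GF2 2) (alpha2 : alpha \notin GF2 1).

Notation P := (px alpha4 alpha2).
Notation Y := (py alpha4 alpha2).
Notation P' := (Frob P).
Notation Y' := (Frob Y).
Notation dv := (dv alpha4 alpha2).
Notation D20 := (dv (-1) 1 0 0 0).
Notation E20 := (push_O 2 D20).
Notation fL := (fL alpha).
Notation fL' := (fL' alpha).
Notation fM := (fM alpha).
Notation fM' := (fM' alpha).
Notation pol1 := (pol1 alpha4 alpha2).
Notation pol2 := (pol2 alpha4 alpha2).

Let gP : ~ generic P. Proof. exact: gen_px. Qed.

Lemma dv_bound n0 n1 n1' n2 n2' m0 m1 m1' m2 m2' k0 k1 k1' k2 k2' g :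
  (forall Q, ordis Q (dv k0 k1 k1' k2 k2' Q) g) ->
  [&& n0 - m0 <= k0, n1 - m1 <= k1, n1' - m1' <= k1', n2 - m2 <= k2 & n2' - m2' <= k2'] ->
  forall Q, ordge Q (dv n0 n1 n1' n2 n2' Q - dv m0 m1 m1' m2 m2' Q) g.
Proof.
move=> og le Q; have [oQ _ _] := og Q; apply: ordgeW oQ.
by rewrite dvN dvD; apply: dv_le.
Qed.

Lemma dv_bound_Frob n0 n1 n1' n2 n2' m0 m1 m1' m2 m2' k0 k1 k1' k2 k2' g :
  (forall Q, ordis Q (dv k0 k1 k1' k2 k2' Q) g) ->
  [&& n0 - m0 <= k0, n1' - m1 <= k1, n1 - m1' <= k1', n2' - m2 <= k2 & n2 - m2' <= k2'] ->
  forall Q, ordge Q (dv n0 n1 n1' n2 n2' (Frob Q) - dv m0 m1 m1' m2 m2' Q) g.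
Proof. by move=> og le Q; rewrite dv_Frob; apply: (dv_bound og le). Qed.

(** These functions witness the linear equivalences of 2 P with Y + x0, of P' +
    Y with P + x0 and of P' + Y' with Y + x0. *)
Definition g1 R := fL R / fx1 R.
Definition g2 R := fL' R / cx R.
Definition g3 R := fM' R / fx1 R.

Lemma ordis_g1 : forall Q, ordis Q (dv (-1) 2 0 (-1) 0 Q) g1.
Proof. exact: (ordisMdv (ordis_L alpha4 alpha2) (ordisVdv (ordis_x1 alpha4 alpha2))). Qed.
Lemma ordis_g2 : forall Q, ordis Q (dv (-1) (-1) 1 1 0 Q) g2.
Proof. exact: (ordisMdv (ordis_L' alpha4 alpha2) (ordisVdv (ordis_x alpha4 alpha2))). Qed.
Lemma ordis_g3 : forall Q, ordis Q (dv (-1) 0 1 (-1) 1 Q) g3.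
Proof. exact: (ordisMdv (ordis_M' alpha4 alpha2) (ordisVdv (ordis_x1 alpha4 alpha2))). Qed.

Lemma ordis_cst a : a \in GF2 2 -> a != 0 -> forall Q, ordis Q (dv 0 0 0 0 0 Q) (fun=> a).
Proof.
move=> a4 a0 Q; rewrite (_ : dv 0 0 0 0 0 Q = 0).
  by apply: ordis_unit; [exact: regular_cst | exact: a0].
by rewrite /dv; do !case: ifP.
Qed.

Lemma conj_g2 R : conj g2 R = fL R / cx R.
Proof. by rewrite conjM conjV conj_cx conj_fL'. Qed.

Lemma g2_norm R : generic R -> g2 R * conj g2 R = fx1 R.
Proof.
move=> gR; rewrite conj_g2 /g2 mulrACA [fL' R * _]mulrC.
rewrite (fLL alpha4 alpha2 (generic_z gR)) -invfM -expr2 mulrC mulKf //.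
by rewrite expf_neq0 // generic_x.
Qed.

(** The polar part of this section shows below that the quotient maps are onto.
    *)
Lemma one_section n0 n1 n1' n2 n2' : (0 <= n1) && (0 <= n1') ->
  exists s : sec (push_O 2 (dv n0 n1 n1' n2 n2')) open_P,
    forall R, generic R -> oset open_P R -> fv s R = 1.
Proof.
move=> /andP[h1 h1']; apply: fv_make; first exact: dv_special.
move=> Q hQ; case: (open_PP alpha4 alpha2 hQ) => [gQ|[]->] {hQ}.
- by rewrite dv_special // oppr0; apply: ordge_cst; rewrite rpred1.
- by rewrite dvE; apply: ordgeW (ordge_cst _ (rpred1 _)); rewrite oppr_le0.
by rewrite dvE; apply: ordgeW (ordge_cst _ (rpred1 _)); rewrite oppr_le0.
Qed.

Lemma open_P_P : oset open_P P.
Proof. by apply: (@open_P_in alpha alpha4 alpha2); left. Qed.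

Lemma tw_linear u f R : tw u (fun=> 0) f R = u R * f R.
Proof. by rewrite /tw mul0r addr0. Qed.
Lemma tw_semilinear v f R : tw (fun=> 0) v f R = v R * conj f R.
Proof. by rewrite /tw mul0r add0r. Qed.

Lemma lead_below Q n F : ~ generic Q -> ordge Q (n + 1) F -> lead Q n F = 0.
Proof.
move=> gQ oF; apply/(lead_eq0 gQ) => //; apply: ordgeW oF.
by rewrite lerDl.
Qed.

Lemma ordis_x_inv : forall Q, ordis Q (dv 2 (-1) (-1) 0 0 Q) (fun R => (cx R)^-1).
Proof. exact: (ordisVdv (ordis_x alpha4 alpha2)). Qed.

(** The map E' -> O(D) and its inverse are kept in explicit form along with the
    class: the multiplicities require them. *)
Definition extension D (u v A B : point -> Fbar) (c1 c2 : Fbar) (i : hom E20 (push_O 2 D))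
    (p : hom (push_O 2 D) (sky P)) :=
  [/\ short_exact i p, has_class i p c1 c2,
      forall U (f : sec E20 U) R, generic R -> oset U R -> fv (i U f) R = tw u v (fv f) R
    & forall U (s : sec (push_O 2 D) U), rep i s (tw A B (fv s))].

Lemma ordge_0 (n : point -> int) : forall Q, ordge Q (n Q) (fun=> 0).
Proof. by move=> Q; apply: ordge0. Qed.

(** Multiplication by g1 identifies O(2 P - x0) with O(Y). *)
Lemma extension_Y : exists i p,
  @extension (dv 0 0 0 1 0) g1 (fun=> 0) (fun R => (g1 R)^-1) (fun=> 0) 1 0 i p.
Proof.
have oV : forall Q, ordis Q (dv 1 (-2) 0 1 0 Q) (fun R => (g1 R)^-1).
  exact: (ordisVdv ordis_g1).
have n1 R : generic R -> g1 R != 0 by move=> gR; apply: ordis_neq0 gR (ordis_g1 R).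
apply: build_extension.
- exact: dv_special.
- by apply: dv_bound; [exact: ordis_g1 | done].
- exact: ordge_0.
- by apply: dv_bound; [exact: oV | done].
- exact: ordge_0.
- by move=> R gR; rewrite mulVf ?n1 // mul0r addr0.
- by move=> R gR; rewrite mulr0 mul0r addr0.
- by move=> R gR; rewrite mulfV ?n1 // mul0r addr0.
- by move=> R gR; rewrite mulr0 mul0r addr0.
- by rewrite oner_eq0.
- exact: rpred1.
- exact: rpred0.
- move=> U s UP; rewrite mul0r mul1r; apply/esym/lead_below => //.
  rewrite addNr; apply: ordge_conj; have UP' : oset U P' by apply/open_Frob.
  have [o1 _ _] := oV P'; have := ordgeM o1 (fv_ordge (dv_special _ _ _ _ _ _ _) s UP').
  by rewrite !dvE; apply: ordge_ext => R _; rewrite tw_linear.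
have [s hs] := @one_section 0 0 0 1 0 isT.
exists open_P, s; split; first exact: open_P_P.
rewrite negb_and; apply/orP; left.
have := oV P; rewrite dvE => oP.
suff -> : pol1 (tw (fun R => (g1 R)^-1) (fun=> 0) (fv s)) = lead P (-2) (fun R => (g1 R)^-1).
  exact: ordis_lead.
have [o1 _ _] := oP; apply: lead_near o1.
apply: nearS (xopen_near 2 open_P_P) => R PR gR.
by rewrite tw_linear hs // mulr1.
Qed.

(** Multiplication by x identifies O(P + P' - x0) with O(x0). *)
Lemma extension_x0 : exists i p,
  @extension (dv 1 0 0 0 0) cx (fun=> 0) (fun R => (cx R)^-1) (fun=> 0) 0 1 i p.
Proof.
have n1 R : generic R -> cx R != 0 by exact: generic_x.
apply: build_extension.
- exact: dv_special.
- by apply: dv_bound; [exact: (ordis_x alpha4 alpha2) | done].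
- exact: ordge_0.
- by apply: dv_bound; [exact: ordis_x_inv | done].
- exact: ordge_0.
- by move=> R gR; rewrite mulVf ?n1 // mul0r addr0.
- by move=> R gR; rewrite mulr0 mul0r addr0.
- by move=> R gR; rewrite mulfV ?n1 // mul0r addr0.
- by move=> R gR; rewrite mulr0 mul0r addr0.
- by rewrite oner_eq0 andbF.
- exact: rpred0.
- exact: rpred1.
- move=> U s UP; rewrite mul0r mul1r; apply/lead_below => //.
  have [o1 _ _] := ordis_x_inv P; have := ordgeM o1 (fv_ordge (dv_special _ _ _ _ _ _ _) s UP).
  by rewrite !dvE; apply: ordge_ext => R _; rewrite tw_linear.
have [s hs] := @one_section 1 0 0 0 0 isT.
exists open_P, s; split; first exact: open_P_P.
rewrite negb_and; apply/orP; right.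
have := ordis_x_inv P; rewrite dvE => oP.
suff -> : pol2 (tw (fun R => (cx R)^-1) (fun=> 0) (fv s)) = lead P (-1) (fun R => (cx R)^-1).
  exact: ordis_lead.
have [o1 _ _] := oP; apply: lead_near o1.
apply: nearS (xopen_near 2 open_P_P) => R PR gR; rewrite -[in LHS]conj_cx -conjV.
rewrite /conj tw_linear hs ?mulr1 //; first exact/generic_Frob.
exact/open_Frob.
Qed.

(** The divisor P + P' - x0 is stable under conjugation, so E' also embeds
    through its conjugate. The class is the same as before but the modification
    is a different one. *)
Lemma extension_x0_conj : exists i p,
  @extension (dv 1 0 0 0 0) (fun=> 0) cx (fun=> 0) (fun R => (cx R)^-1) 0 1 i p.
Proof.
have n1 R : generic R -> cx R != 0 by exact: generic_x.
apply: build_extension.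
- exact: dv_special.
- exact: ordge_0.
- by apply: dv_bound_Frob; [exact: (ordis_x alpha4 alpha2) | done].
- exact: ordge_0.
- by apply: dv_bound_Frob; [exact: ordis_x_inv | done].
- by move=> R gR; rewrite conj_cx mulVf ?n1 // mul0r add0r.
- by move=> R gR; rewrite /conj sqrt2_0 mulr0 mul0r addr0.
- by move=> R gR; rewrite conjV conj_cx mulfV ?n1 // mul0r add0r.
- by move=> R gR; rewrite /conj sqrt2_0 mulr0 mul0r addr0.
- by rewrite oner_eq0 andbF.
- exact: rpred0.
- exact: rpred1.
- move=> U s UP; rewrite mul0r mul1r; apply/lead_below => //.
  have UP' : oset U P' by apply/open_Frob.
  have [o1 _ _] := ordis_x_inv P.
  have := ordgeM o1 (ordge_conj (fv_ordge (dv_special _ _ _ _ _ _ _) s UP')).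
  by rewrite !dvE; apply: ordge_ext => R _; rewrite tw_semilinear.
have [s hs] := @one_section 1 0 0 0 0 isT.
exists open_P, s; split; first exact: open_P_P.
rewrite negb_and; apply/orP; right.
have := ordis_x_inv P; rewrite dvE => oP.
suff -> : pol2 (tw (fun=> 0) (fun R => (cx R)^-1) (fv s)) = lead P (-1) (fun R => (cx R)^-1).
  exact: ordis_lead.
have [o1 _ _] := oP; apply: lead_near o1.
apply: nearS (xopen_near 2 open_P_P) => R PR gR; rewrite -[in LHS]conj_cx -conjV.
have gF : generic (Frob R) by apply/generic_Frob.
have PF : oset open_P (Frob R) by apply/open_Frob.
have gFF : generic (Frob (Frob R)) by apply/generic_Frob.
have PFF : oset open_P (Frob (Frob R)) by apply/open_Frob.
by rewrite /conj tw_semilinear /conj hs // sqrt2_1 mulr1.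
Qed.

Section FamilyP.
Variable a : Fbar.
Hypotheses (a4 : a \in GF2 2) (a0 : a != 0).

Let a24 : a ^+ 2 \in GF2 2. Proof. exact: GF4_sq. Qed.
Let aa : a ^+ 2 * a = 1. Proof. by rewrite -exprSr GF4_cube. Qed.

Lemma lead_x_inv : lead P (-1) (fun R => (cx R)^-1) = 1.
Proof.
apply: (@leadE P (-1) _ (fun=> 1) (regular1 2 P)).
apply: nearT => R /= gR; have [e1 _ e3] := px_coord alpha4 alpha2.
by rewrite loc_affine // e1 addr0 mul1r exprN1.
Qed.

(** L' takes the value 1 at P. *)
Lemma lead_g2 : lead P (-1) g2 = 1.
Proof.
have [e1 e2 e3] := px_coord alpha4 alpha2; have rL := regular_fL' alpha4 e3.
have [oi _ _] := ordis_g2 P.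
have [ox _ _] := ordis_x_inv P; rewrite dvE in ox.
rewrite (leadM0 rL ox) lead_x_inv mulr1 /fL' e1 e2 addr0 addKF //.
Qed.

Lemma ordge_conj_g2 : ordge P 1 (conj g2).
Proof. by have [+ _ _] := ordis_conj (ordis_g2 P'); rewrite dvE. Qed.

(** The product of g2 and its conjugate is x + 1, of value 1 at P. *)
Lemma lead_conj_g2 : lead P 1 (conj g2) = 1.
Proof.
have [oi _ _] := ordis_g2 P; rewrite dvE in oi.
have := leadM oi ordge_conj_g2; rewrite lead_g2 mul1r addNr => <-.
have [e1 e2 e3] := px_coord alpha4 alpha2; have r1 := regular_fx1 e3.
rewrite (lead_ext (F := fx1)); last exact: ordge_regular.
  by rewrite lead_regular // /fx1 e1 add0r.
by move=> R gR; rewrite g2_norm.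
Qed.

Notation AA := (fun R => a ^+ 2 / cx R).
Notation BB := (fun R => g2 R / cx R).

(** With s = c/x + ... at P and value d at P', the relation between the two polar
    parts reads (a^2 c + d, c + a d) = (a^2 c + d) (1, a). *)
Lemma polP U (s : sec (push_O 2 (dv 0 1 0 0 0)) U) : oset U P ->
  pol2 (tw AA BB (fv s)) = a * pol1 (tw AA BB (fv s)).
Proof.
move=> UP; have UP' : oset U P' by apply/open_Frob.
have sp := dv_special alpha4 alpha2 0 1 0 0 0.
have os := fv_ordge sp s UP; rewrite dvE in os.
have os' : ordge P 0 (conj (fv s)).
  by apply: ordge_conj; have := fv_ordge sp s UP'; rewrite dvE.
have [ox _ _] := ordis_x_inv P; rewrite dvE in ox.
have [og _ _] := ordis_g2 P; rewrite dvE in og.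
set c := lead P (-1) (fv s); set d := lead P 0 (conj (fv s)).
have e1 : pol1 (tw AA BB (fv s)) = a ^+ 2 * c + d.
  have o1 : ordge P (-2) (fun R => AA R * fv s R).
    by have := ordgeM (ordgeZ a24 ox) os.
  have o2 : ordge P (-2) (fun R => BB R * conj (fv s) R).
    by have := ordgeM (ordgeM og ox) os'.
  rewrite -[LHS]/(lead P (-2) _) (leadD o1 o2); congr (_ + _).
    transitivity (lead P (-1 + -1) (fun R => (a ^+ 2 * (cx R)^-1) * fv s R)) => //.
    rewrite (leadM (ordgeZ a24 ox) os); congr (_ * _).
    by rewrite (leadM0 (regular_cst P a24) ox) lead_x_inv mulr1.
  transitivity (lead P (-1 + -1 + 0) (fun R => (g2 R * (cx R)^-1) * conj (fv s) R)) => //.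
  by rewrite (leadM (ordgeM og ox) os') (leadM og ox) lead_g2 lead_x_inv !mul1r.
have cE R : generic R -> oset U R -> conj (tw AA BB (fv s)) R =
    (a * (cx R)^-1) * conj (fv s) R + conj g2 R * (cx R)^-1 * fv s R.
  move=> gR UR; rewrite /tw conjD !conjM conjV conj_cx conj_cst // conjK.
    by rewrite -exprD GF4P.
  exact: fv_regular.
have e2 : pol2 (tw AA BB (fv s)) = a * d + c.
  have o1 : ordge P (-1) (fun R => (a * (cx R)^-1) * conj (fv s) R).
    by have := ordgeM (ordgeZ a4 ox) os'.
  have o2 : ordge P (-1) (fun R => conj g2 R * (cx R)^-1 * fv s R).
    by have := ordgeM (ordgeM ordge_conj_g2 ox) os.
  rewrite -[LHS]/(lead P (-1) _).
  have -> : lead P (-1) (conj (tw AA BB (fv s))) = lead P (-1) (fun R =>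
      (a * (cx R)^-1) * conj (fv s) R + conj g2 R * (cx R)^-1 * fv s R).
    apply: lead_near (ordgeD o1 o2); apply: nearS (xopen_near 2 UP) => R UR gR.
    by rewrite cE.
  rewrite (leadD o1 o2); congr (_ + _).
    transitivity (lead P (-1 + 0) (fun R => (a * (cx R)^-1) * conj (fv s) R)) => //.
    rewrite (leadM (ordgeZ a4 ox) os'); congr (_ * _).
    by rewrite (leadM0 (regular_cst P a4) ox) lead_x_inv mulr1.
  transitivity (lead P (1 + -1 + -1) (fun R => (conj g2 R * (cx R)^-1) * fv s R)) => //.
  rewrite (leadM (ordgeM ordge_conj_g2 ox) os) (leadM ordge_conj_g2 ox).
  by rewrite lead_conj_g2 lead_x_inv !mul1r.
rewrite e1 e2; transitivity (a ^+ 2 * a * c + a * d); last by ring.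
by rewrite aa; ring.
Qed.

(** The twisted matrix of (a, g2) has determinant a^3 + g2 conj g2 = 1 + (x + 1)
    = x, which accounts for the division by x in the inverse. *)
Lemma extension_P : exists i p,
  @extension (dv 0 1 0 0 0) (fun=> a) g2 AA BB 1 a i p.
Proof.
have oA := ordisMdv (ordis_cst a24 (expf_neq0 2 a0)) ordis_x_inv.
have oB := ordisMdv ordis_g2 ordis_x_inv.
have cC R : conj (fun=> a) R = a ^+ 2 by rewrite conj_cst.
have key R : generic R -> (1 + fx1 R) / cx R = 1.
  move=> gR; rewrite /fx1 [cx R + 1]addrC addKF mulfV //; exact: generic_x.
apply: build_extension.
- exact: dv_special.
- by apply: dv_bound; [exact: (ordis_cst a4 a0) | done].
- by apply: dv_bound_Frob; [exact: ordis_g2 | done].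
- by apply: dv_bound; [exact: oA | done].
- by apply: dv_bound_Frob; [exact: oB | done].
- move=> R gR; rewrite mulrAC aa [g2 R / _ * _]mulrAC g2_norm // -mulrDl; exact: key.
- by move=> R gR; rewrite cC mulrAC [g2 R / _ * _]mulrAC [g2 R * _]mulrC addFF.
- move=> R gR; rewrite conjM conjV conj_cx mulrA [a * _]mulrC aa mulrA g2_norm // -mulrDl.
  exact: key.
- move=> R gR; have -> : conj AA R = a * (cx R)^-1.
    by rewrite conjM conjV conj_cx conj_cst // -exprM GF4P.
  by rewrite -[RHS](addFF (a * (g2 R / cx R))); ring.
- by rewrite oner_eq0.
- exact: rpred1.
- exact: a4.
- by move=> U s UP; rewrite mul1r polP.
have [s hs] := @one_section 0 1 0 0 0 isT.
exists open_P, s; split; first exact: open_P_P.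
rewrite negb_and; apply/orP; left.
have := oB P; rewrite dvE => oBP; have := oA P; rewrite dvE => oAP.
have o12 : ordis P (-2) (fun R => BB R + AA R).
  by apply: ordisD => //; case: oAP.
suff -> : pol1 (tw AA BB (fv s)) = lead P (-2) (fun R => BB R + AA R).
  exact: ordis_lead.
have [o1 _ _] := o12; apply: lead_near o1.
apply: nearS (xopen_near 2 open_P_P) => R PR gR.
rewrite /tw /conj !hs // ?sqrt2_1 ?mulr1; first by rewrite addrC.
  exact/generic_Frob.
exact/open_Frob.
Qed.
End FamilyP.
End Explicit.

(** * Multiplicities *)

Section Multiplicity.
Variable alpha : Fbar.
Hypotheses (alpha4 : alpha \in GF2 2) (alpha2 : alpha \notin GF2 1).

Notation P := (px alpha4 alpha2).
Notation Y := (py alpha4 alpha2).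
Notation P' := (Frob P).
Notation Y' := (Frob Y).
Notation dv := (dv alpha4 alpha2).
Notation D20 := (dv (-1) 1 0 0 0).
Notation E20 := (push_O 2 D20).
Notation fM := (fM alpha).
Notation fM' := (fM' alpha).
Notation g1 := (g1 alpha).
Notation g2 := (g2 alpha).
Notation g3 := (g3 alpha).
Notation pol1 := (pol1 alpha4 alpha2).
Notation pol2 := (pol2 alpha4 alpha2).

Let gP : ~ generic P. Proof. exact: gen_px. Qed.
Let sp20 : special_div D20. Proof. exact: dv_special. Qed.

Lemma seq_hom D (T : hecke_seq P (push_O 2 D)) : special_div D ->
  isomorphic (hs_sub T) E20 ->
  exists (i : hom E20 (push_O 2 D)) u v, [/\ short_exact i (hs_quo T),
    forall U (f : sec E20 U) R, generic R -> oset U R -> fv (i U f) R = tw u v (fv f) R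
  & forall Q, ordge Q (D20 Q - D Q) u /\ ordge Q (D20 (Frob Q) - D Q) v].
Proof.
move=> spD [w [w' ww]].
have ww' U : cancel (w' U) (w U) /\ cancel (w U) (w' U) by case: (ww U).
have ex := exact_iso_sub ww' (hs_exact T).
have [u [v huv]] := hom_twist alpha4 alpha2 (hom_comp (hs_inj T) w') sp20 spD.
exists (hom_comp (hs_inj T) w'), u, v; split=> //.
exact: (twist_bound alpha4 alpha2 sp20 spD (gens20 alpha4 alpha2) huv).
Qed.

(** The function u / g has no pole outside S and at most a simple one there. *)
Lemma quotient_cst n m S u g : ~ generic S ->
  (forall Q, ordge Q (n Q) u) -> (forall Q, ordis Q (m Q) g) ->
  (forall Q, Q <> S -> 0 <= n Q - m Q) -> n S - m S = -1 ->
  exists2 c, c \in GF2 2 & forall R, generic R -> u R = c * g R.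
Proof.
move=> gS ou og hle hS.
have ow Q : ordge Q (n Q - m Q) (fun R => u R * (g R)^-1).
  by apply: ordgeM => //; case: (og Q).
have [Q QS||c c4 hc] := @simple_pole_cst S (fun R => u R * (g R)^-1) gS.
- exact: ordgeW (hle Q QS) (ow Q).
- by rewrite -hS.
by exists c => // R gR; rewrite -(hc R gR) mulfVK // (ordis_neq0 gR (og R)).
Qed.

Lemma quotient_dv n0 n1 n1' n2 n2' m0 m1 m1' m2 m2' S u g : ~ generic S ->
  (forall Q, ordge Q (dv n0 n1 n1' n2 n2' Q) u) ->
  (forall Q, ordis Q (dv m0 m1 m1' m2 m2' Q) g) ->
  (let d := dv (n0 - m0) (n1 - m1) (n1' - m1') (n2 - m2) (n2' - m2') in
   d S = -1 /\ forall Q, Q <> S -> 0 <= d Q) ->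
  exists2 c, c \in GF2 2 & forall R, generic R -> u R = c * g R.
Proof.
move=> gS ou og [h1 h2]; apply: (quotient_cst gS ou og) => [Q QS|].
  by rewrite dvN dvD h2.
by rewrite dvN dvD h1.
Qed.

Lemma pole_cases n0 n1 n1' n2 n2' S :
  (x0 <> S -> 0 <= n0) -> (P <> S -> 0 <= n1) -> (P' <> S -> 0 <= n1') ->
  (Y <> S -> 0 <= n2) -> (Y' <> S -> 0 <= n2') ->
  forall Q, Q <> S -> 0 <= dv n0 n1 n1' n2 n2' Q.
Proof.
by move=> h0 h1 h1' h2 h2'; apply: (@dv_ind _ _ _ (fun Q n => Q <> S -> 0 <= n)).
Qed.

(** The first map is the second composed with the scalar automorphism e of E';
    the square appears because conj (e f) = e^2 conj f. *)
Lemma kernel_sub D (i i' : hom E20 (push_O 2 D)) (p p' : hom (push_O 2 D) (sky P))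
    u v u' v' e :
  short_exact i p -> short_exact i' p' ->
  (forall U (f : sec E20 U) R, generic R -> oset U R -> fv (i U f) R = tw u v (fv f) R) ->
  (forall U (f : sec E20 U) R, generic R -> oset U R -> fv (i' U f) R = tw u' v' (fv f) R) ->
  e \in GF2 2 ->
  (forall R, generic R -> u R = u' R * e /\ v R = v' R * e ^+ 2) ->
  forall U (s : sec (push_O 2 D) U), p U s = 0 -> p' U s = 0.
Proof.
move=> ip ip' hi hi' e4 huv U s /(ext_image ip)[f ef].
have [Q UQ|g hg] := @fv_make _ sp20 U (fun R => e * fv f R).
  by apply: ordgeZ => //; apply: fv_ordge.
have <- : i' U g = s; last exact: ext_image0.
rewrite -ef; apply: fv_ext => R gR UR; rewrite hi // hi' //.
rewrite (tw_on _ _ gR UR hg) /tw conjM conj_cst //.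
by have [-> ->] := huv R gR; ring.
Qed.

Lemma kernel_eq D (i i' : hom E20 (push_O 2 D)) (p p' : hom (push_O 2 D) (sky P))
    u v u' v' e :
  short_exact i p -> short_exact i' p' ->
  (forall U (f : sec E20 U) R, generic R -> oset U R -> fv (i U f) R = tw u v (fv f) R) ->
  (forall U (f : sec E20 U) R, generic R -> oset U R -> fv (i' U f) R = tw u' v' (fv f) R) ->
  e \in GF2 2 -> e != 0 ->
  (forall R, generic R -> u R = u' R * e /\ v R = v' R * e ^+ 2) ->
  forall U (s : sec (push_O 2 D) U), p U s = 0 <-> p' U s = 0.
Proof.
move=> ip ip' hi hi' e4 e0 huv U s; split; first exact: (kernel_sub ip ip' hi hi' e4 huv).
apply: (kernel_sub ip' ip hi' hi (GF4V e4)) => R gR; have [-> ->] := huv R gR.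
by rewrite exprVn !mulfK // expf_neq0.
Qed.

Lemma not_ordge1 Q : ~ generic Q -> ~ ordge Q 1 (fun=> 1).
Proof.
move=> gQ o1; have := lead_below (n := 0) gQ o1.
by rewrite lead_regular; [move/eqP; rewrite oner_eq0 | exact: regular1].
Qed.

Lemma cst_section n0 n1 n1' n2 n2' (U : xopen) k : k \in GF2 2 ->
  (forall Q, oset U Q -> 0 <= dv n0 n1 n1' n2 n2' Q) ->
  exists s : sec (push_O 2 (dv n0 n1 n1' n2 n2')) U,
    forall R, generic R -> oset U R -> fv s R = k.
Proof.
move=> k4 h; apply: fv_make; first exact: dv_special.
by move=> Q UQ; apply: ordgeW (ordge_cst Q k4); rewrite oppr_le0 h.
Qed.

Lemma open_inf_P : ~ oset open_inf P.
Proof.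
move=> /open_infP[//|/eqP]; have [[+ _ _ _] _] := special_neq alpha4 alpha2.
by rewrite eq_sym => ->.
Qed.
Lemma open_Y_P : ~ oset open_Y P.
Proof.
have [_ [[_ e1 e2 _ _] _]] := special_neq alpha4 alpha2.
by move=> /(open_YP alpha4 alpha2)[//|[/eqP|/eqP]]; rewrite ?e1 ?e2.
Qed.

Lemma GF4_cases a : a \in GF2 2 -> a != 0 -> [\/ a = 1, a = alpha | a = alpha + 1].
Proof.
move=> a4 a0; have a3 := GF4_cube a4 a0.
have : (a - 1) * ((a + alpha) * (a + (alpha + 1))) = 0.
  transitivity (a ^+ 3 - 1 + (a - 1) * (alpha ^+ 2 + alpha - 1) + 2%:R * (a * alpha * (a - 1))).
    by ring.
  by rewrite a3 subrr two0 mul0r addr0 add0r (alphaE alpha4 alpha2) subrr mulr0.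
move/eqP; rewrite !mulf_eq0 subr_eq0 !addF_eq0.
by case/or3P => /eqP ->; [constructor 1 | constructor 2 | constructor 3].
Qed.

Lemma conj_tw u v f R :
  conj (tw u v f) R = conj u R * conj f R + conj v R * conj (conj f) R.
Proof. by rewrite /tw conjD !conjM. Qed.

Lemma conj_on (U : xopen) F G R : generic R -> oset U R ->
  (forall S, generic S -> oset U S -> F S = G S) -> conj F R = conj G R.
Proof.
by move=> gR UR h; rewrite /conj h //; [apply/generic_Frob | apply/open_Frob].
Qed.

(** The constant e would be a section of E' over the generic points that is
    killed by i. *)
Lemma twist_inj D (i : hom E20 (push_O 2 D)) (p : hom (push_O 2 D) (sky P)) u v e :
  short_exact i p ->
  (forall U (f : sec E20 U) R, generic R -> oset U R -> fv (i U f) R = tw u v (fv f) R) ->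
  e \in GF2 2 -> e != 0 -> (forall R, generic R -> u R * e + v R * e ^+ 2 = 0) -> False.
Proof.
move=> ex hi e4 e0 h.
have [Q gQ|f hf] := @fv_make _ sp20 gen_open (fun=> e).
  by rewrite sp20 // oppr0; apply: ordge_cst.
have f0 : f = 0.
  apply: (ext_inj ex); rewrite linear0; apply: fv_ext => R gR _.
  by rewrite hi // (tw_on (U := gen_open) _ _ gR gR hf) /tw conj_cst // h.
have [R [gR _]] := near_generic (xopen_near 2 open_inf_x0).
by move: (hf R gR gR); rewrite f0 fv0 => /esym/eqP; rewrite (negbTE e0).
Qed.

Lemma twist_lift D (i : hom E20 (push_O 2 D)) (p : hom (push_O 2 D) (sky P)) u v
    (U : xopen) (s : sec (push_O 2 D) U) : short_exact i p -> ~ oset U P ->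
  (forall U (f : sec E20 U) R, generic R -> oset U R -> fv (i U f) R = tw u v (fv f) R) ->
  exists f : sec E20 U, forall R, generic R -> oset U R -> fv s R = tw u v (fv f) R.
Proof.
move=> ex UP hi; have [f ef] := ext_avoid ex s UP.
by exists f => R gR UR; rewrite -ef hi.
Qed.

(** Away from x the inclusion of E' is onto, so it cannot take all its values in the
    functions that vanish at S. *)
Lemma no_vanishing n0 n1 n1' n2 n2' (i : hom E20 (push_O 2 (dv n0 n1 n1' n2 n2')))
    (p : hom (push_O 2 (dv n0 n1 n1' n2 n2')) (sky P)) u v (U : xopen) S :
  short_exact i p ->
  (forall U (f : sec E20 U) R, generic R -> oset U R -> fv (i U f) R = tw u v (fv f) R) ->
  0 <= n0 -> 0 <= n1 -> 0 <= n1' -> 0 <= n2 -> 0 <= n2' ->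
  ~ oset U P -> oset U S -> ~ generic S ->
  ordge S (D20 S + 1) u -> ordge S (D20 (Frob S) + 1) v -> False.
Proof.
move=> ex hi h0 h1 h1' h2 h2' UP US gS ou ov.
have [|s hs] := @cst_section n0 n1 n1' n2 n2' U 1 (rpred1 _).
  by move=> Q _; apply: (@dv_ind _ _ _ (fun Q n => 0 <= n)).
have [f hf] := twist_lift s ex UP hi.
apply: (not_ordge1 gS); apply: ordge_near (tw_ordge f sp20 US ou ov).
by apply: nearS (xopen_near 2 US) => R UR gR; rewrite -(hs R gR UR) hf.
Qed.

(** ** Modifications of the split bundle *)

(** The morphisms are x (a f + b conj f). When a and b are both nonzero the
    constant a / b is killed; otherwise only one of the two terms remains, and
    it is one of the two embeddings above up to a scalar. *)
Lemma multiplicity_x0 : has_multiplicity P E20 (push_O 2 (dv 1 0 0 0 0)) 2.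
Proof.
have [i0 [p0 [ex0 cl0 t0 r0]]] := extension_x0 alpha4 alpha2.
have [i1 [p1 [ex1 cl1 t1 r1]]] := extension_x0_conj alpha4 alpha2.
have spD := dv_special alpha4 alpha2 1 0 0 0 0.
pose S0 := HeckeSeq ex0; pose S1 := HeckeSeq ex1.
(* The section y + alpha vanishes at P but not at P', so that only the second
   quotient map kills it. *)
have S01 : ~ hecke_seq_iso S0 S1.
  move=> h; pose W := form_open (form_coord 1 2).
  have WP : oset W P by rewrite /= evX2; have [_ _ ->] := px_coord alpha4 alpha2; rewrite oner_neq0.
  have [Q WQ|s hs] := @fv_make _ spD W fM.
    have e : dv 1 0 0 0 0 Q = 0.
      rewrite /dv; case: eqP => [Q0|_]; last by do !case: ifP.
      by move: WQ; rewrite Q0 /= evX2 cz_x0 eqxx.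
    rewrite e oppr0; apply: ordge_regular; apply: regular_fM => //.
    by move: WQ; rewrite /= evX2; have [->|//] := affineP Q; rewrite cz_x0 eqxx.
  have oV := ordis_x_inv alpha4 alpha2.
  have [_ e0] := cl0 _ _ _ (r0 _ s) WP; have [_ e1] := cl1 _ _ _ (r1 _ s) WP.
  have z1 : p1 W s = 0.
    apply: sv_ext => _; rewrite sv0 -[LHS]mulr1 -e1.
    have := ordisMdv oV (ordis_M alpha4 alpha2) P; rewrite dvE => -[o _ _].
    rewrite -[RHS](lead_below (n := -1) gP o) -[LHS]/(lead P (-1) _).
    apply: lead_near (ordgeW _ o) => //.
    apply: nearS (xopen_near 2 WP) => R WR gR.
    rewrite (conj_on gR WR (fun S gS WS => tw_on _ _ gS WS hs)) conj_tw conjV conj_cx.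
    rewrite [conj (fun=> 0) R](_ : _ = 0) ?mul0r ?add0r; last exact: sqrt2_0.
    by rewrite (conj_eq _ (conj_fM alpha4 alpha2)) conj_fM'.
  have /= z0 := iffRL (hecke_seq_iso_kernel s h) z1.
  have := ordisMdv oV (ordis_M' alpha4 alpha2) P; rewrite dvE => o; have [o' _ _] := o.
  have : lead P (-1) (fun R => (cx R)^-1 * fM' R) != 0 by apply: ordis_lead o.
  move/eqP; apply; transitivity (pol2 (tw (fun R => (cx R)^-1) (fun=> 0) (fv s))); last first.
    by rewrite e0 z0 sv0 mul0r.
  apply/esym/lead_near; first last.
    exact: o'.
  apply: nearS (xopen_near 2 WP) => R WR gR.
  rewrite (conj_on gR WR (fun S gS WS => tw_on _ _ gS WS hs)) conj_tw conjV conj_cx.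
  rewrite [conj (fun=> 0) R](_ : _ = 0) ?mul0r ?addr0; last exact: sqrt2_0.
  by rewrite conj_fM.
pose S (j : 'I_2) := if j == 0 then S0 else S1.
exists S; split=> [j|j k|T iT].
- by rewrite /S; case: ifP => _; apply: isomorphic_refl.
- rewrite /S; have [->|j0] := eqVneq j 0; have [->|k0] := eqVneq k 0 => // h.
  - by move: (hecke_seq_iso_sym h).
  - by move: j k j0 k0 {h} => [[|[|//]] ?] [[|[|//]] ?] // _ _; apply: val_inj.
have [i [u [v [ex hi huv]]]] := seq_hom spD iT.
have ou Q := (huv Q).1; have ov Q := (huv Q).2.
have ou' Q : ordge Q (dv (-2) 1 0 0 0 Q) u by have := ou Q; rewrite dvN dvD.
have ov' Q : ordge Q (dv (-2) 0 1 0 0 Q) v by have := ov Q; rewrite dv_Frob dvN dvD.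
have ox := ordis_x alpha4 alpha2.
have [|a a4 ha] := quotient_dv (gen_px' (alpha4 := alpha4) (alpha2 := alpha2)) ou' ox.
  by split; [rewrite dvE | apply: pole_cases => // h; case: h].
have [|b b4 hb] := quotient_dv gP ov' ox.
  by split; [rewrite dvE | apply: pole_cases => // h; case: h].
have [a0|a0] := eqVneq a 0; have [b0|b0] := eqVneq b 0.
- case: (@twist_inj _ _ _ u v 1 ex hi (rpred1 _) (oner_neq0 _)) => R gR.
  by rewrite ha // hb // a0 b0 !mul0r addr0.
- exists 1; apply: iso_of_kernel => U s.
  apply: (kernel_eq ex ex1 hi t1 (GF4_sq b4) (expf_neq0 2 b0)) => R gR.
  by rewrite ha // hb // a0 !mul0r -exprM GF4P // mulrC.
- exists 0; apply: iso_of_kernel => U s.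
  apply: (kernel_eq ex ex0 hi t0 a4 a0) => R gR.
  by rewrite ha // hb // b0 !mul0r mulrC.
have e4 : a / b \in GF2 2 by rewrite rpredM // GF4V.
case: (@twist_inj _ _ _ u v (a / b) ex hi e4) => [|R gR].
  by rewrite mulf_neq0 // invr_eq0.
rewrite ha // hb // -[RHS](addFF (a ^+ 2 / b * cx R)); congr (_ + _); first by ring.
by rewrite expr_div_n expr2 invfM; rewrite -{1}(mulVKf b0 (a ^+ 2 / b * cx R)); ring.
Qed.

(** ** Modifications of E_(y,1)^(2,2) *)

(** The morphisms are a g1 f + b g3 conj f, and exactness forces b = 0. *)
Lemma multiplicity_Y : has_multiplicity P E20 (push_O 2 (dv 0 0 0 1 0)) 1.
Proof.
have [i0 [p0 [ex0 cl0 t0 r0]]] := extension_Y alpha4 alpha2.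
have spD := dv_special alpha4 alpha2 0 0 0 1 0.
exists (fun=> HeckeSeq ex0); split=> [j|j k _|T iT].
- exact: isomorphic_refl.
- by rewrite !ord1.
have [i [u [v [ex hi huv]]]] := seq_hom spD iT.
have ou Q := (huv Q).1; have ov Q := (huv Q).2.
have ou' Q : ordge Q (dv (-1) 1 0 (-1) 0 Q) u by have := ou Q; rewrite dvN dvD.
have ov' Q : ordge Q (dv (-1) 0 1 (-1) 0 Q) v by have := ov Q; rewrite dv_Frob dvN dvD.
have o1 := ordis_g1 alpha4 alpha2; have o3 := ordis_g3 alpha4 alpha2.
have [|a a4 ha] := quotient_dv gP ou' o1.
  by split; [rewrite dvE | apply: pole_cases => // h; case: h].
have [|b b4 hb] := quotient_dv (gen_py' (alpha4 := alpha4) (alpha2 := alpha2)) ov' o3.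
  by split; [rewrite dvE | apply: pole_cases => // h; case: h].
have [a0|a0] := eqVneq a 0.
(* The image would vanish at Y', away from x. *)
  have YY' : oset open_Y Y' by apply: (@open_Y_in _ alpha4 alpha2); right.
  case: (no_vanishing ex hi _ _ _ _ _ open_Y_P YY') => //; first exact: gen_py'.
    by apply: ordge_ext (ordge0 _ _) => R gR; rewrite ha // a0 mul0r.
  have [og _ _] := o3 Y'; rewrite dvE in og; rewrite FrobFrob_py dvE.
  by apply: ordge_ext (ordgeZ b4 og) => R gR; rewrite hb.
have [b0|b0] := eqVneq b 0.
  exists ord0; apply: iso_of_kernel => U s.
  apply: (kernel_eq ex ex0 hi t0 a4 a0) => R gR.
  by rewrite ha // hb // b0 !mul0r mulrC.
(* On the fibre at x0 the map is A c + B c^2 = A^2 / B (d + d^2) with d = B c / A,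
   and d + d^2 lies in F_2; so the value A^2 / B alpha is not attained. *)
have o1x := o1 x0; have o3x := o3 x0; rewrite !dvE in o1x o3x.
have [o1g _ _] := o1x; have [o3g _ _] := o3x.
set l1 := lead x0 (-1) g1; set l3 := lead x0 (-1) g3.
pose A := a * l1; pose B := b * l3.
have l14 : l1 \in GF2 2 := lead_GF4 _ _ gen_x0.
have l34 : l3 \in GF2 2 := lead_GF4 _ _ gen_x0.
have A4 : A \in GF2 2 by rewrite rpredM.
have B4 : B \in GF2 2 by rewrite rpredM.
have A0 : A != 0 by rewrite mulf_neq0 // ordis_lead.
have B0 : B != 0 by rewrite mulf_neq0 // ordis_lead.
pose k := A ^+ 2 / B * alpha.
have k4 : k \in GF2 2 by rewrite !rpredM ?GF4V // rpredX.
have [|s hs] := @cst_section 0 0 0 1 0 open_inf k k4.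
  by move=> Q _; apply: (@dv_ind _ _ _ (fun Q n => 0 <= n)).
have [f hf] := twist_lift s ex open_inf_P hi.
have I0 := open_inf_x0.
have of1 := fv_ordge sp20 f I0; rewrite dvE in of1.
have of2 : ordge x0 1 (conj (fv f)) by apply: ordge_conj; rewrite Frob_x0.
set c := lead x0 1 (fv f).
have c4 : c \in GF2 2 := lead_GF4 _ _ gen_x0.
have key : k = A * c + B * c ^+ 2.
  have q1 : ordge x0 0 (fun R => a * g1 R * fv f R) := ordgeM (ordgeZ a4 o1g) of1.
  have q2 : ordge x0 0 (fun R => b * g3 R * conj (fv f) R) := ordgeM (ordgeZ b4 o3g) of2.
  transitivity (lead x0 0 (fun R => a * g1 R * fv f R + b * g3 R * conj (fv f) R)).
    rewrite -[LHS]/((fun=> k) x0) -(lead_regular (regular_cst x0 k4)).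
    apply: lead_near (ordgeD q1 q2); apply: nearS (xopen_near 2 I0) => R IR gR.
    by rewrite -(hs R gR IR) hf // /tw ha // hb.
  rewrite (leadD q1 q2); congr (_ + _).
    transitivity (lead x0 (-1 + 1) (fun R => a * g1 R * fv f R)) => //.
    by rewrite (leadM (ordgeZ a4 o1g) of1) (leadM0 (regular_cst x0 a4) o1g).
  transitivity (lead x0 (-1 + 1) (fun R => b * g3 R * conj (fv f) R)) => //.
  rewrite (leadM (ordgeZ b4 o3g) of2) (leadM0 (regular_cst x0 b4) o3g).
  by rewrite lead_conj Frob_x0 // (sqrt2_GF4 c4).
pose d := c * B / A.
have d4 : d \in GF2 2 by rewrite !rpredM ?GF4V.
have ed : d + d ^+ 2 = alpha.
  apply: (mulfI (mulf_neq0 (expf_neq0 2 A0) (invr_neq0 B0))).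
  rewrite -/k key; have -> : c = d * A / B by rewrite /d divfK // mulfK.
  transitivity (A ^+ 2 / B * d + (A ^+ 2 / B) * d ^+ 2); first by ring.
  congr (_ + _); first by ring.
  transitivity (A ^+ 2 * d ^+ 2 * (B * B^-1) * B^-1); last by ring.
  by rewrite mulfV // mulr1; ring.
case/negP: alpha2; rewrite inE expn1 -ed sqD -exprM (GF4P d4) addrC //.
Qed.

(** ** Modifications of E_(x,1)^(2,2) *)

(** The morphisms are a f + b g2 conj f, and exactness forces a and b to be
    nonzero. A scalar e in F_4^* multiplies a by e and b by e^2, so the product
    a b, which takes three values, classifies them. *)
Lemma multiplicity_P : has_multiplicity P E20 (push_O 2 (dv 0 1 0 0 0)) 3.
Proof.
have spD := dv_special alpha4 alpha2 0 1 0 0 0.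
have [n0 n1 n2 n3] := alpha_neq alpha2.
pose c (j : 'I_3) := nth 0 [:: 1; alpha; alpha + 1] j.
have c4 j : c j \in GF2 2.
  by move: j => [[|[|[|//]]] ?]; rewrite /c /= ?rpredD ?rpred1.
have c0 j : c j != 0 by move: j => [[|[|[|//]]] ?]; rewrite /c /= ?oner_neq0.
have c_inj : injective c.
  move=> [[|[|[|//]]] hj] [[|[|[|//]]] hk]; rewrite /c /= => e; apply: val_inj => //=; exfalso.
  - by move: n1; rewrite -e eqxx.
  - by move: n3; rewrite -e eqxx.
  - by move: n1; rewrite e eqxx.
  - by move: e; rewrite -[X in X = _]addr0 => /addrI/eqP; rewrite eq_sym oner_eq0.
  - by move: n3; rewrite e eqxx.
  - by move: e; rewrite -[X in _ = X]addr0 => /addrI/eqP; rewrite oner_eq0.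
have hI j : exists i p, extension (alpha4 := alpha4) (alpha2 := alpha2) (D := dv 0 1 0 0 0)
    (fun=> c j) g2 (fun R => c j ^+ 2 / cx R) (fun R => g2 R / cx R) 1 (c j) i p.
  exact: (extension_P alpha4 alpha2 (c4 j) (c0 j)).
pose i j := projT1 (cid (hI j)); pose hi' j := projT2 (cid (hI j)).
pose p j := projT1 (cid (hi' j)).
have hp j : extension (fun=> c j) g2 (fun R => c j ^+ 2 / cx R) (fun R => g2 R / cx R)
    1 (c j) (i j) (p j) by exact: (projT2 (cid (hi' j))).
have ex j : short_exact (i j) (p j) by case: (hp j).
exists (fun j => HeckeSeq (ex j)); split=> [j|j k h|T iT].
- exact: isomorphic_refl.
- apply: contrapT => /eqP jk.
  (* The image of 1 in the first extension is not killed by the second quotient. *)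
  have [Q PQ|f hf] := @fv_make _ sp20 open_P (fun=> 1).
    case: (open_PP alpha4 alpha2 PQ) => [gQ|[]->].
    - by rewrite sp20 // oppr0; apply: ordge_cst; rewrite rpred1.
    - by rewrite dvE; apply: ordgeW (ordge_cst _ (rpred1 _)).
    - by rewrite dvE; apply: ordgeW (ordge_cst _ (rpred1 _)).
  have PP := open_P_P alpha4 alpha2.
  have [_ _ tj _] := hp j; have [_ clk _ rk] := hp k.
  have /= z0 := iffLR (hecke_seq_iso_kernel (i j open_P f) h) (ext_image0 (ex j) f).
  have [+ _] := clk _ _ _ (rk _ (i j open_P f)) PP; rewrite z0 sv0 mul0r.
  set F := tw _ _ _; move=> l0.
  have ab : c j ^+ 2 + c k ^+ 2 != 0.
    rewrite -sqD sqrf_eq0 addF_eq0; apply: contra jk => /eqP e.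
    by apply/eqP/c_inj.
  have ab4 : c j ^+ 2 + c k ^+ 2 \in GF2 2 by rewrite rpredD ?rpredX.
  have oH := ordisMdv (ordis_cst alpha4 alpha2 ab4 ab)
    (ordisMdv (ordis_g2 alpha4 alpha2) (ordis_x_inv alpha4 alpha2)) P.
  rewrite dvE in oH.
  have d4 : c k ^+ 2 * c j + 1 \in GF2 2 by rewrite rpredD ?rpred1 // rpredM ?rpredX.
  have [oV _ _] := ordis_x_inv alpha4 alpha2 P; rewrite dvE in oV.
  have oG : ordge P (-1) (fun R => (c k ^+ 2 * c j + 1) * (cx R)^-1 + 1).
    by apply: ordgeD; [exact: ordgeZ | apply: ordgeW (ordge_cst _ (rpred1 _))].
  have oF := ordisD gP oH oG; have [oF' _ _] := oF.
  have : lead P (-2) F != 0; last by rewrite -[lead _ _ _]/(pol1 F) l0 eqxx.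
  have := ordis_lead oF; congr (_ != 0); apply/esym.
  apply: lead_near oF'; apply: nearS (xopen_near 2 PP) => R PR gR.
  have x0' := generic_x gR.
  have hs S : generic S -> oset open_P S -> fv (i j open_P f) S = c j + g2 S.
    by move=> gS PS; rewrite tj // (tw_on _ _ gS PS hf) /tw conj_cst ?rpred1 // expr1n !mulr1.
  rewrite /F (tw_on _ _ gR PR hs) /tw conjD (conj_cst R (c4 j)).
  transitivity ((c k ^+ 2 * c j) / cx R + (c j ^+ 2 + c k ^+ 2) * (g2 R / cx R)
     + g2 R * conj g2 R / cx R); last by ring.
  rewrite g2_norm // /fx1.
  transitivity ((c j ^+ 2 + c k ^+ 2) * (g2 R * (cx R)^-1) +
     (c k ^+ 2 * c j * (cx R)^-1 + (cx R)^-1 + cx R * (cx R)^-1)); last by ring.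
  by rewrite mulfV //; ring.
have [iT' [u [v [exT hi huv]]]] := seq_hom spD iT.
have ou Q := (huv Q).1; have ov Q := (huv Q).2.
have ou' Q : ordge Q (dv (-1) 0 0 0 0 Q) u by have := ou Q; rewrite dvN dvD.
have ov' Q : ordge Q (dv (-1) (-1) 1 0 0 Q) v by have := ov Q; rewrite dv_Frob dvN dvD.
have og := ordis_g2 alpha4 alpha2.
have [|a a4 ha] := quotient_dv gen_x0 ou' (ordis_one alpha4 alpha2).
  by split; [rewrite dvE | apply: pole_cases => // h; case: h].
have [|b b4 hb] := quotient_dv (gen_py (alpha4 := alpha4) (alpha2 := alpha2)) ov' og.
  by split; [rewrite dvE | apply: pole_cases => // h; case: h].
have [b0|b0] := eqVneq b 0.
(* The image would vanish at x0, away from x. *)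
  case: (no_vanishing exT hi _ _ _ _ _ open_inf_P open_inf_x0 gen_x0) => //.
    by rewrite dvE; apply: ordge_ext (ordge_cst _ a4) => R gR; rewrite ha // mulr1.
  by apply: ordge_ext (ordge0 _ _) => R gR; rewrite hb // b0 mul0r.
have [a0|a0] := eqVneq a 0.
(* The image would vanish at Y, away from x. *)
  have YY : oset open_Y Y by apply: (@open_Y_in _ alpha4 alpha2); left.
  case: (no_vanishing exT hi _ _ _ _ _ open_Y_P YY) => //; first exact: gen_py.
    by apply: ordge_ext (ordge0 _ _) => R gR; rewrite ha // a0 mul0r.
  have [o _ _] := og Y; rewrite dvE in o; rewrite dvE.
  by apply: ordge_ext (ordgeZ b4 o) => R gR; rewrite hb.
have ab0 : a * b != 0 by rewrite mulf_neq0.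
have [j hj] : exists j, c j = a * b.
  case: (GF4_cases (rpredM a4 b4) ab0) => ->.
  - by exists ord0.
  - by exists (Ordinal (isT : 1 < 3)%N).
  - by exists (Ordinal (isT : 2 < 3)%N).
exists j; apply: iso_of_kernel => U s; have [_ _ tj _] := hp j.
apply: (kernel_eq exT (ex j) hi tj (GF4_sq b4) (expf_neq0 2 b0)) => R gR.
rewrite ha // hb // hj -exprM GF4P // [g2 R * b]mulrC; split=> //.
by rewrite -mulrA -exprS GF4_cube.
Qed.
End Multiplicity.

(** * The bundles that E' modifies *)

Theorem mainTheorem2 (alpha : Fbar)
    (alpha4 : alpha \in GF2 2) (alpha2 : alpha \notin GF2 1) :
  let q := 2%N in
  let x := px alpha4 alpha2 in
  let y := py alpha4 alpha2 in
  let E' := E20 x in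
  (forall E : xsheaf,
     hecke_modification 2 x E' E <->
     [\/ isomorphic E (dsum E11 E11), isomorphic E (E22 x)
       | isomorphic E (E22 y)]) /\
  [/\ has_multiplicity x E' (dsum E11 E11) (q ^ 2 - q)%N,
      has_multiplicity x E' (E22 x) (q + 1)%N
    & has_multiplicity x E' (E22 y) 1].
Proof.
move=> q x y E'; rewrite {}/E' {}/q /x /y E20E E22EP E22EY.
have iso0 := dsum_iso alpha4 alpha2; rewrite (E22E0 alpha4 alpha2) in iso0.
have iso0' := isomorphic_sym iso0.
have v20 := gens_vector_bundle alpha4 alpha2 (dv_special _ _ _ _ _ _ _)
  (gens20 alpha4 alpha2).
have vx0 := gens_vector_bundle alpha4 alpha2 (dv_special _ _ _ _ _ _ _)
  (gens22_x0 alpha4 alpha2).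
have vP := gens_vector_bundle alpha4 alpha2 (dv_special _ _ _ _ _ _ _)
  (gens22_P alpha4 alpha2).
have vY := gens_vector_bundle alpha4 alpha2 (dv_special _ _ _ _ _ _ _)
  (gens22_Y alpha4 alpha2).
have [i0 [p0 [ex0 cl0 _ _]]] := extension_x0 alpha4 alpha2.
have [iY [pY [exY clY _ _]]] := extension_Y alpha4 alpha2.
split; last first.
  split; [|exact: multiplicity_P|exact: multiplicity_Y].
  by apply: has_multiplicity_iso iso0' _; exact: multiplicity_x0.
move=> E; split=> [[_ vE [i [p ip]]]|].
  have [c1 [c2 [c14 c24 cn cl]]] := class_exists vE ip.
  (* The coordinate lines c1 = 0 and c2 = 0 are the first and the third case. *)
  have [c10|c10] := eqVneq c1 0.
    constructor 1; apply: isomorphic_trans iso0'.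
    apply: (class_iso vE vx0 ip ex0 c24 _ _ cl0).
      by move: cn; rewrite c10 eqxx.
    by rewrite mulr0 mulr1 -c10.
  have [c20|c20] := eqVneq c2 0.
    constructor 3; apply: (class_iso vE vY ip exY c14 c10 _ clY).
    by rewrite mulr0 mulr1 -c20.
  have a4 : c2 / c1 \in GF2 2 by rewrite rpredM // GF4V.
  have a0 : c2 / c1 != 0 by rewrite mulf_neq0 // invr_eq0.
  have [iP [pP [exP clP _ _]]] := extension_P alpha4 alpha2 a4 a0.
  constructor 2; apply: (class_iso vE vP ip exP c14 c10 _ clP).
  by rewrite mulr1 mulrC divfK.
have [iP [pP [exP clP _ _]]] := extension_P alpha4 alpha2 (rpred1 _) (oner_neq0 _).
case=> /isomorphic_sym iE; apply: hecke_modification_iso iE _.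
- apply: hecke_modification_iso iso0' _; split=> //.
  by exists i0, p0.
- by split=> //; exists iP, pP.
by split=> //; exists iY, pY.
Qed.
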